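(* Let $n\ge 5$, let $S$ be a finite almost simple group whose socle is isomorphic to the alternating group $A_n$, and let $G$ be a solvable subgroup of $S$. Then $Reg_G(S,5)\ge 5$. In particular, $b_G(S)\le 5$.
   Context: All groups are finite. Let $G$ be a subgroup of a finite group $S$. Let $\Omega$ be the set of right cosets of $G$ in $S$, on which $S$ acts by right multiplication, and let $G_S=\bigcap_{g\in S}G^g$ be the core of $G$ in $S$ (here $G^g=g^{-1}Gg$), so that $S/G_S$ acts faithfully and transitively on $\Omega$. The group $S/G_S$ acts on $\Omega^k$ componentwise: $(\omega_1,\dots,\omega_k)g=(\omega_1 g,\dots,\omega_k g)$. A point of $\Omega^k$ is called regular if its stabilizer in $S/G_S$ is trivial, and an orbit is regular if it consists of regular points. $b_G(S)$ denotes the minimal number $k$ such that $\Omega^k$ contains a regular point for $S/G_S$; equivalently, the minimal $k$ such that there exist $x_1,\dots,x_k\in S$ with $G^{x_1}\cap\dots\cap G^{x_k}=G_S$. For a positive integer $m$, $Reg_G(S,m)$ denotes the number of regular orbits of $S/G_S$ on $\Omega^m$ (it equals $0$ if $m<b_G(S)$). *)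

(* Defs.v *)
From mathcomp Require Import all_boot all_fingroup all_solvable.

Set Implicit Arguments.
Unset Strict Implicit.
Unset Printing Implicit Defensive.

Import GroupScope.

Definition inner_aut (gT : finGroupType) (T : {group gT}) : {set {perm gT}} :=
  conj_aut T @* T.

Section AlmostSimple.

Variable gT : finGroupType.

Definition socle (S : {group gT}) : {set gT} :=
  <<\bigcup_(N : {group gT} | (N \subset S) && minnormal N S) N>>.

Canonical socle_group (S : {group gT}) : {group gT} :=
  Eval hnf in [group of socle S].

(* Inn T <= S <= Aut T up to isomorphism, for some nonabelian simple T. *)
Definition almost_simple (S : {group gT}) : Prop :=
  exists (rT : finGroupType) (T : {group rT}) (A : {group {perm rT}}),
    [/\ simple T, ~~ abelian T, inner_aut T \subset A, A \subset Aut T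
      & S \isog A].

End AlmostSimple.

Section RegularOrbits.

Variables (gT : finGroupType) (G S : {group gT}).

(* S / gcore G S acting componentwise by right translation on k-tuples of
   subsets of gT. On tuples not fixed by gcore G S the library's %% action is
   trivial by convention; tuples of right cosets of G in S are all fixed. *)
Definition coset_act k := (('Rs * k) %% gcore G S)%act.

Definition coset_tuples k : {set k.-tuple {set gT}} :=
  [set t | [forall i, tnth t i \in rcosets G S]].

Definition regular_point k (t : k.-tuple {set gT}) : bool :=
  'C_(S / gcore G S)[t | coset_act k] == 1.

Definition regular_orbits k : {set {set k.-tuple {set gT}}} :=
  [set O in orbit (coset_act k) (S / gcore G S) @: coset_tuples k
    | [forall t in O, regular_point t]].

Definition Reg k : nat := #|regular_orbits k|.

Definition has_regular_point k : bool :=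
  [exists t in coset_tuples k, regular_point t].

Lemma coset_actE k (t : k.-tuple {set gT}) x :
    t \in coset_tuples k -> x \in S ->
  coset_act k t (coset (gcore G S) x) = n_act 'Rs t x.
Proof.
move=> /[1!inE] /forallP tO Sx; apply: modactE; rewrite ?in_setT //.
  exact: (subsetP (gcore_norm G S)).
apply/afixP => y /setIP[_ Ky]; apply: eq_from_tnth => i; rewrite tnth_map /=.
have /rcosetsP[s Ss ->] := tO i; rewrite rcosetE -rcosetM.
have: y ^ s^-1 \in G.
  by rewrite -mem_conjg; move/bigcapP: Ky; apply.
move=> Gy; have ->: s * y = (y ^ s^-1) * s by rewrite conjgE invgK !mulgA mulgKV.
by rewrite rcosetM rcoset_id.
Qed.

Lemma has_regular_point_exists : exists k, has_regular_point k.
Proof.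
exists #|rcosets G S|; pose t := [tuple of enum (rcosets G S)].
have tO: t \in coset_tuples _.
  by rewrite inE; apply/forallP=> i; rewrite -mem_enum mem_tnth.
apply/existsP; exists t; rewrite tO /=; apply/eqP/trivgP/subsetP=> X.
case/setIP=> /morphimP[x Nx Sx ->{X}] /setIP[_]; rewrite inE sub1set inE.
rewrite coset_actE // => /eqP tx.
rewrite inE; apply/eqP/coset_id; apply/bigcapP=> s Ss.
have: G :* s \in enum (rcosets G S) by rewrite mem_enum -rcosetE imset_f.
have /(congr1 val)/= tx' := tx; move=> Gs.
have /eq_in_map/(_ _ Gs): map (fun A => A :* x) (enum (rcosets G S))
    = map id (enum (rcosets G S)).
  by rewrite map_id -[RHS]tx'; apply: eq_map => A; rewrite rcosetE.
move=> /= e; rewrite mem_conjg conjgE invgK mulgA -mem_rcoset -e -rcosetM.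
exact: rcoset_refl.
Qed.

Definition base_size : nat := ex_minn has_regular_point_exists.

End RegularOrbits.

(* Main.v *)
Require Import Defs.
From mathcomp Require Import all_boot all_fingroup all_solvable.
From mathcomp Require Import zmodp.

(* Five tuples of five elements of S, such that no element of S other than the identity carries one of the corresponding tuples of cosets of G to itself or to another one, give five regular orbits. When four cosets G x with x in a subgroup N of S already have trivial pointwise stabiliser in S, the fifth entry is free, and five inequivalent values for it exist in N as soon as 24 < |N|, because G meets N in a core-free subgroup, hence of index at least 5.

For S a symmetric group Sym A these tuples are found by induction on |A|, and can be taken in the alternating group. If G is intransitive, tuples for an invariant set and for its complement are multiplied together, or combined with transpositions joining the two sets when one of them has at most four points. If G is imprimitive with blocks of size at least 5, the five tuples of a block are distributed over the blocks according to a colouring with five colours which distinguishes the action on the blocks; any solvable permutation group has five inequivalent such colourings. Blocks of size 2, 3 or 4 are moved apart explicitly by cyclic shifts of layers and transpositions. If G has a regular normal elementary abelian subgroup, two odd cycles sharing one point and covering a basis suffice, except in degrees 5, 7, 8 and 9, where three 3-cycles do.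

In general S acts on its socle 'Alt_('I_n). The product of two conjugates of a 3-cycle has order dividing 30, which characterises 3-cycles among the elements of order 3 when n <> 6; and an automorphism preserving the 3-cycles is conjugation by an element of 'Sym_('I_n), so the symmetric case applies. When n = 6 and G contains an element exchanging the two classes of elements of order 3, G normalises a Sylow p-subgroup of the socle with p = 2, 3 or 5, and there are four Sylow p-subgroups whose normalisers in Aut 'Alt_('I_6) meet trivially. *)

Set Implicit Arguments.
Unset Strict Implicit.
Unset Printing Implicit Defensive.

Import GroupScope.
(* The file alt of the library shadows this name with the symmetric group of the whole type. *)
Local Notation Sym := perm.Sym.

(** * Five regular orbits from rigid tuples *)

(** Entries are confined to N while g ranges over S, because S may be as small as the alternating
    group or may contain automorphisms that no permutation induces. Asking for five inequivalent
    tuples rather than one makes the induction close: on a block system the colour of a block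
    selects one of its five tuples, and inequivalence forces any element matching two tuples to
    respect the colours. The obstacle is degree at most 4: there the symmetric group is itself
    solvable, and for it no rigid tuples exist, so small invariant sets and small blocks need
    transpositions and shifts that leave them. Since the condition passes to subgroups of G
    ([rigidS]), G is often replaced by a larger, possibly non-solvable group that contains an odd
    permutation or has an explicit description. *)

Definition rigid (gT : finGroupType) (N S G : {set gT}) :=
  exists x : 'I_5 -> 'I_5 -> gT, (forall c i, x c i \in N) /\
    forall c c' g, g \in S -> (forall i, x c i * g * (x c' i)^-1 \in G) ->
    c = c' /\ g = 1.

(** Right translation by g carries [G :* x] to [G :* y] exactly when x * g * y^-1 lies in G, so the
    five tuples of cosets are regular points in different orbits. *)
Lemma rigid_regular (gT : finGroupType) (G S : {group gT}) :
  G \subset S -> rigid S S G -> 5 <= Reg G S 5 /\ base_size G S <= 5.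
Proof.
move=> sGS [x [Sx rx]].
pose t c : 5.-tuple {set gT} := [tuple G :* x c i | i < 5].
have tO c : t c \in coset_tuples G S 5.
  by rewrite inE; apply/forallP=> i; rewrite tnth_mktuple -rcosetE imset_f.
have act_t c c' g : g \in S ->
    coset_act G S 5 (t c) (coset (gcore G S) g) = t c' -> c = c' /\ g = 1.
  move=> Sg; rewrite coset_actE // => e; apply: (rx) => // i.
  have := congr1 (fun u => tnth u i) e.
  rewrite tnth_map !tnth_mktuple /= rcosetE -rcosetM => /rcoset_eqP.
  by rewrite mem_rcoset.
have reg c : regular_point G S (t c).
  apply/eqP/trivgP/subsetP=> X /setIP[/morphimP[g Ng Sg ->{X}] /setIP[_]].
  rewrite inE sub1set inE => /eqP e; rewrite inE.
  by case: (act_t _ _ _ Sg e) => _ ->; rewrite morph1.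
have regO c u : u \in orbit (coset_act G S 5) (S / gcore G S) (t c) ->
    regular_point G S u.
  case/imsetP=> X SX ->; have sSD : S / gcore G S \subset setT / gcore G S.
    exact: morphimS (subsetT S).
  rewrite /regular_point astab1_act_in ?(subsetP sSD) //.
  by rewrite -{1}(conjGid SX) -conjIg (eqP (reg c)) conjs1g.
pose O c := orbit (coset_act G S 5) (S / gcore G S) (t c).
split.
  have injO : injective O.
    move=> c c' eO; have : t c' \in O c by rewrite eO orbit_refl.
    case/imsetP=> X /morphimP[g _ Sg ->] e.
    by case: (act_t c c' g Sg (esym e)).
  rewrite -[leqLHS]card_ord -(card_imset _ injO) subset_leq_card //.
  apply/subsetP=> _ /imsetP[c _ ->]; rewrite inE; apply/andP; split; first exact: imset_f.
  by apply/forall_inP=> u; apply: regO.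
rewrite /base_size; case: ex_minnP => m _; apply.
by apply/existsP; exists (t ord0); rewrite tO reg.
Qed.

Lemma rigidS (gT : finGroupType) (N S G H : {set gT}) :
  G \subset H -> rigid N S H -> rigid N S G.
Proof.
move=> /subsetP sGH [x [Nx rx]]; exists x; split=> // c c' g Sg Gx.
by apply: rx => // i; apply/sGH/Gx.
Qed.

(** N acts faithfully on the cosets of a core-free subgroup. *)
Lemma leq_card_fact_index (gT : finGroupType) (N L : {group gT}) :
  gcore L N = 1 -> #|N| <= #|rcosets L N|`!.
Proof.
move=> core1; have nLN := actsRs_rcosets L N.
pose f := actperm <[nLN]>.
have injf : 'injm f.
  by rewrite ker_actperm astab_actby setIT astabRs_rcosets core1 setIg1.
rewrite -(card_injm injf (subxx _)) -perm.card_Sym subset_leq_card //.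
apply/subsetP=> _ /morphimP[g _ Ng ->]; rewrite inE; apply/subsetP=> X.
by apply: contraR => /negbTE nX; rewrite /f /= actpermE /= /actby nX.
Qed.

(* The cosets of [N :&: G] in [N] are indexed injectively by the fifth entry of the tuples. *)
Lemma rigid_base4 (gT : finGroupType) (N S G : {group gT}) (x : 'I_4 -> gT) :
    N \subset S -> 24 < #|N| -> (forall i, x i \in N) ->
    (forall g, g \in S -> (forall i, x i * g * (x i)^-1 \in G) -> g = 1) ->
  rigid N S G.
Proof.
move=> sNS N24 Nx bx; pose L := (N :&: G)%G.
have core1 : gcore L N = 1.
  apply/trivgP/subsetP=> g /bigcapP gL; rewrite inE; apply/eqP/bx.
    by have := gL 1 (group1 N); rewrite conjsg1 => /setIP[Ng _]; apply: (subsetP sNS).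
  move=> i; have := gL (x i) (Nx i).
  by rewrite mem_conjg => /setIP[_]; rewrite conjgE invgK mulgA.
(* With at most four cosets, N would embed in a symmetric group of order at most 24. *)
have r5 : 5 <= #|rcosets L N|.
  have := leq_trans N24 (leq_card_fact_index core1); rewrite ltnNge.
  by apply: contraR; rewrite -ltnNge; move: #|_| => [|[|[|[|[|k]]]]].
pose X (c : 'I_5) := enum_val (widen_ord r5 c).
have XP c : exists2 y, y \in N & X c = L :* y.
  have : X c \in rcosets L N by apply: enum_valP.
  by case/rcosetsP=> y Ny ->; exists y.
have [y Ny Ey] := fin_all_exists2 XP.
(* The four given entries are common to all tuples and already force g = 1; only the last entry
   depends on c. *)
exists (fun c i => if unlift ord_max i is Some j then x j else y c); split.
  by move=> c i; case: unliftP => [j _|_].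
move=> c c' g Sg Gx; have g1: g = 1.
  apply: bx => // i; have := Gx (lift ord_max i).
  by rewrite liftK.
split=> //; have := Gx ord_max; rewrite unlift_none g1 mulg1 => Gy.
have : X c = X c'.
  rewrite !Ey; apply/rcoset_eqP; rewrite mem_rcoset inE Gy andbT.
  by rewrite groupM ?groupV.
by move/enum_val_inj/(congr1 val)=> /= ?; apply: val_inj.
Qed.

Definition even_sym (T : finType) (A : {set T}) : {set {perm T}} :=
  Sym A :&: 'Alt_T.

Canonical even_sym_group (T : finType) (A : {set T}) :=
  Eval hnf in [group of even_sym A].

(* An odd element k of K makes the entries even without changing their cosets. *)
Lemma rigid_even (T : finType) (A : {set T}) (K : {group {perm T}}) k :
    k \in K -> k \in Sym A -> odd_perm k ->
  rigid (Sym A) (Sym A) K -> rigid (even_sym A) (Sym A) K.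
Proof.
move=> Kk Ak odd_k [x [Ax rx]].
pose y c i := if odd_perm (x c i) then k * x c i else x c i.
have yP c i : exists2 l, l \in K & y c i = l * x c i.
  by rewrite /y; case: ifP => _; [exists k | exists 1; rewrite ?mul1g].
exists y; split=> [c i|c c' g Ag Gy].
  rewrite inE Alt_even /y; case: ifPn => [ox|->]; last by rewrite Ax.
  by rewrite groupM // odd_permM odd_k ox.
apply: rx => // i; have := Gy i.
have [l Kl ->] := yP c i; have [l' Kl' ->] := yP c' i.
by rewrite invMg !mulgA groupMr ?groupV // -!mulgA groupMl.
Qed.

(** The odd elements of [Sym A] lie in a single coset of [even_sym A], whose order is therefore at
    least 60. *)
Lemma card_even_sym (T : finType) (A : {set T}) : 5 <= #|A| -> 24 < #|even_sym A|.
Proof.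
move=> A5; have [x [y [Ax Ay xy]]] : exists x y, [/\ x \in A, y \in A & x != y].
  have /card_gt1P[x [y [Ax Ay xy]]] : 1 < #|A| by apply: leq_trans A5.
  by exists x, y.
pose t := tperm x y.
have At : t \in Sym A.
  rewrite inE; apply/subsetP=> z; rewrite inE /t; case: tpermP => [->|->|] //.
  by rewrite eqxx.
have: #|Sym A| <= #|even_sym A| + #|even_sym A|.
  rewrite -(cardsID 'Alt_T (Sym A)) leq_add2l.
  rewrite -(card_lcoset (even_sym A) t) subset_leq_card //.
  apply/subsetP=> p /setDP[Ap]; rewrite Alt_even negbK => op.
  by rewrite mem_lcoset inE groupM ?groupV //= Alt_even odd_permM odd_permV op odd_tperm xy.
rewrite perm.card_Sym addnn => le; have : 120 <= #|A|`! by apply: (@leq_trans 5`!) => //; apply: leq_fact.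
move/leq_trans/(_ le); rewrite -[120]/(60.*2) leq_double; exact: leq_trans.
Qed.

(** * Permutation groups *)

Lemma perm_imset_stable (T : finType) (B : {set T}) (g : {perm T}) :
  {in B, forall x, g x \in B} -> g @: B = B.
Proof.
move=> gB; apply/eqP; rewrite eqEcard card_imset ?leqnn ?andbT; last exact: perm_inj.
by apply/subsetP=> _ /imsetP[x Bx ->]; apply: gB.
Qed.

Lemma imset_setD (T : finType) (A B : {set T}) (g : {perm T}) :
  g @: A = A -> g @: B = B -> g @: (A :\: B) = A :\: B.
Proof.
move=> gA gB; apply: perm_imset_stable => x /setDP[Ax nBx].
by rewrite inE -{1}gB -{1}gA !mem_imset ?Ax ?andbT //; apply: perm_inj.
Qed.

Lemma Sym_imset (T : finType) (A : {set T}) (g : {perm T}) :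
  g \in Sym A -> g @: A = A.
Proof. by rewrite inE; apply: im_perm_on. Qed.

Lemma Sym_out (T : finType) (A : {set T}) (g : {perm T}) x :
  g \in Sym A -> x \notin A -> g x = x.
Proof. by rewrite inE => Ag Ax; apply: out_perm Ag Ax. Qed.

Lemma Sym_closed (T : finType) (A : {set T}) (g : {perm T}) x :
  g \in Sym A -> (g x \in A) = (x \in A).
Proof. by rewrite inE => Ag; rewrite (perm_closed _ Ag). Qed.

Lemma Sym_eq1 (T : finType) (A : {set T}) (g : {perm T}) :
  g \in Sym A -> (forall x, x \in A -> g x = x) -> g = 1.
Proof.
move=> Ag g1; apply/permP=> x; rewrite perm1.
by have [/g1 //|] := boolP (x \in A); apply: Sym_out.
Qed.

Definition block_system (T : finType) (A : {set T}) (G : {group {perm T}})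
    (P : {set {set T}}) :=
  [/\ partition P A, forall g B, g \in G -> B \in P -> g @: B \in P
    & forall B C, B \in P -> C \in P -> exists2 g, g \in G & g @: B = C].

Definition regular_on (T : finType) (A : {set T}) (V : {group {perm T}}) :=
  (forall x y, x \in A -> y \in A -> exists2 v, v \in V & v x = y) /\
  (forall x (v : {perm T}), x \in A -> v \in V -> v x = x -> v = 1).

(* The cases are: intransitive, imprimitive, and transitive with an abelian minimal normal subgroup that is regular. *)
Lemma solvable_trichotomy (T : finType) (A : {set T}) (G : {group {perm T}}) :
    G \subset Sym A -> solvable G -> 1 < #|A| ->
  [\/ exists2 B : {set T}, B \subset A & 0 < #|B| < #|A| /\
        (forall g, g \in G -> g @: B = B),
      exists2 P, block_system A G P &
        1 < #|P| /\ (forall B, B \in P -> 1 < #|B| < #|A|)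
    | exists2 V : {group {perm T}}, V <| G & is_abelem V /\ regular_on A V].
Proof.
move=> sGA solG A1; have GA g : g \in G -> g \in Sym A by apply: (subsetP sGA).
have actsA (H : {group {perm T}}) : H \subset G -> [acts H, on A | 'P].
  move=> sHG; apply/actsP=> g Hg x; rewrite /= apermE Sym_closed //.
  exact/GA/(subsetP sHG).
have [trG|ntrG] := boolP [transitive G, on A | 'P]; last first.
  have [x Ax] : exists x, x \in A by apply/card_gt0P/ltnW.
  have sBA : orbit 'P G x \subset A by rewrite (acts_sub_orbit _ (actsA G _)).
  apply: Or31; exists (orbit 'P G x) => //; split.
    apply/andP; split; first by apply/card_gt0P; exists x; apply: orbit_refl.
    rewrite ltn_neqAle subset_leq_card // andbT.
    apply: contra ntrG => /eqP eBA; apply/imsetP; exists x => //.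
    by apply/esym/eqP; rewrite eqEcard sBA eBA leqnn.
  move=> g Gg; apply: perm_imset_stable => y xy; rewrite -[g y]/(aperm y g).
  exact: (orbit_trans (mem_orbit 'P y Gg) xy).
have nt : G :!=: 1.
  apply: contraTneq A1 => G1; rewrite -leqNgt; apply/card_le1_eqP=> x y Ax Ay.
  have : x \in orbit 'P G y by rewrite (atransP trG).
  by rewrite G1 => /imsetP[g /set1P-> ->]; rewrite act1.
have [V minV sVG] := minnormal_exists nt (normG G).
have [nVG ntV abV] := minnormal_solvable minV sVG solG.
have nsV : V <| G by apply/andP.
have [trV|ntrV] := boolP [transitive V, on A | 'P].
  apply: Or33; exists V => //; split=> //; split.
    move=> x y Ax Ay; have : y \in orbit 'P V x by rewrite (atransP trV).
    by case/imsetP=> v Vv ->; exists v.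
  (* v commutes with the transitive group V, so as soon as it fixes x it fixes every point. *)
  move=> x v Ax Vv vx; apply: (Sym_eq1 (GA v (subsetP sVG v Vv))) => y Ay.
  have : y \in orbit 'P V x by rewrite (atransP trV).
  case/imsetP=> w Vw -> /=; rewrite apermE.
  have [p _ /abelem_abelian/centsP cVV] := is_abelemP abV.
  by rewrite -permM -(cVV v Vv w Vw) permM vx.
have actG g x : g \in G -> g @: orbit 'P V x = orbit 'P V (g x).
  move=> Gg; have nVg := subsetP nVG g Gg.
  have sub h y : h \in G -> h @: orbit 'P V y \subset orbit 'P V (h y).
    move=> Gh; apply/subsetP=> _ /imsetP[_ /imsetP[v Vv ->] ->].
    rewrite /= apermE -permM; have -> : v * h = h * v ^ h by rewrite conjgE mulKVg.
    by rewrite permM -apermE mem_orbit // memJ_norm // (subsetP nVG).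
  apply/eqP; rewrite eqEsubset sub //=.
  apply/subsetP=> y yo; have := sub g^-1 (g x) (groupVr Gg).
  rewrite permK => /subsetP/(_ (g^-1 y) (imset_f _ yo)) h.
  by rewrite -[y](permKV g) imset_f.
apply: Or32; exists (orbit 'P V @: A); first split.
- exact: orbit_partition (actsA V sVG).
- move=> g _ Gg /imsetP[x Ax ->]; rewrite actG // imset_f //.
  by rewrite Sym_closed // GA.
- move=> _ _ /imsetP[x Ax ->] /imsetP[y Ay ->].
  have : y \in orbit 'P G x by rewrite (atransP trG).
  by case/imsetP=> g Gg ->; exists g => //; rewrite actG.
have sBA x : x \in A -> orbit 'P V x \subset A.
  by rewrite (acts_sub_orbit _ (actsA V sVG)).
have neA x : x \in A -> orbit 'P V x != A.
  by move=> Ax; apply: contra ntrV => /eqP eA; apply/imsetP; exists x.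
split.
  have [x Ax] : exists x, x \in A by apply/card_gt0P/ltnW.
  have [y Ay ny] : exists2 y, y \in A & y \notin orbit 'P V x.
    apply/subsetPn; apply: contra (neA x Ax) => sA.
    by rewrite eqEsubset sA sBA.
  apply/card_gt1P; exists (orbit 'P V x), (orbit 'P V y).
  rewrite !imset_f //; split=> //; apply: contra ny => /eqP->.
  exact: orbit_refl.
move=> _ /imsetP[x Ax ->]; apply/andP; split; last first.
  by rewrite proper_card // properEneq neA // sBA.
(* V moves some point y, and G carries the orbit of x to that of y, so no orbit is a single
   point. *)
have [v Vv v1] : exists2 v, v \in V & v != 1 by apply/trivgPn.
have Gv := subsetP sVG v Vv.
have [y Ay vy] : exists2 y, y \in A & v y != y.
  apply/exists_inP; apply: contraR v1; rewrite negb_exists_in => /forall_inP v1.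
  by apply/eqP/(Sym_eq1 (GA v Gv)) => y /v1; rewrite negbK => /eqP.
have : y \in orbit 'P G x by rewrite (atransP trG).
case/imsetP=> g Gg /= ey.
suff : 1 < #|orbit 'P V y| by rewrite ey apermE -actG // card_imset //; apply: perm_inj.
apply/card_gt1P; exists (v y), y; split=> //; last exact: orbit_refl.
exact: (mem_orbit 'P y Vv).
Qed.

(** * Distinguishing colourings *)

(** Irredundance takes the place of linear independence for an abelian group V without a basis at
    hand. *)
Lemma irredundant_gens (gT : finGroupType) (V : {group gT}) :
  exists s : seq gT, [/\ uniq s, <<[set x in s]>> = V
    & forall v, v \in s -> v \notin <<[set x in s] :\ v>>].
Proof.
have [X /minsetP[/eqP gX minX] _] := @minset_exists gT (fun X => <<X>> == V) V (introT eqP (genGid V)).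
have sX : [set x in enum X] = X by apply/setP=> x; rewrite inE mem_enum.
exists (enum X); split; rewrite ?enum_uniq ?sX // => v; rewrite mem_enum => Xv.
apply/negP=> gv; have : X :\ v = X; last by move/setP/(_ v); rewrite !inE eqxx Xv.
apply: minX; last exact: subsetDl.
rewrite eqEsubset -{1}gX genS ?subsetDl //= -{1}gX gen_subG.
apply/subsetP=> w Xw; have [->//|nwv] := eqVneq w v.
by rewrite mem_gen // !inE nwv.
Qed.

(** Under v -> v x, the action on A of an element fixing x becomes its action on V by
    conjugation. *)
Lemma regular_on_conj (T : finType) (A : {set T}) (V : {group {perm T}}) (g : {perm T}) x :
    regular_on A V -> x \in A -> g \in 'N(V) -> g \in Sym A -> g x = x ->
    (forall v, v \in V -> v ^ g = v) -> g = 1.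
Proof.
move=> [trV _] Ax nVg Ag gx cVg; apply: (Sym_eq1 Ag) => y Ay.
have [v Vv <-] := trV x y Ax Ay.
by rewrite -permM conjgC cVg // permM gx.
Qed.

(* Five colourings of A by 'I_5, pairwise inequivalent under G and each with trivial stabiliser. *)
Definition distinguishing (T : finType) (A : {set T}) (G : {set {perm T}})
    (f : 'I_5 -> T -> 'I_5) :=
  forall c c' g, g \in G -> (forall x, x \in A -> f c x = f c' (g x)) ->
  c = c' /\ g = 1.

(* The five colourings are the translates of f by 'I_5 seen as the cyclic group of order 5: if two of them were equivalent, all the colour classes of f would have the same size. *)
Lemma distinguishing_shift (T : finType) (A : {set T}) (G : {set {perm T}})
    (f : T -> 'I_5) (k l : 'I_5) :
    G \subset Sym A ->
    (forall g, g \in G -> (forall x, x \in A -> f (g x) = f x) -> g = 1) ->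
    #|[set x in A | f x == k]| != #|[set x in A | f x == l]| ->
  exists f, distinguishing A G f.
Proof.
move=> sGA df nkl; exists (fun c x => f x * c) => c c' g Gg fg.
have Ag := subsetP sGA g Gg.
pose d := c * c'^-1; have fd x : x \in A -> f (g x) = f x * d.
  by move=> Ax; rewrite mulgA fg // mulgK.
have nd j : #|[set x in A | f x == j * d]| = #|[set x in A | f x == j]|.
  rewrite -[RHS](card_imset _ (@perm_inj _ g)); apply: eq_card => y.
  rewrite -[y](permKV g) mem_imset; last exact: perm_inj.
  rewrite !inE Sym_closed //; case: (boolP (_ \in A)) => //= Ax.
  by rewrite fd // (inj_eq (mulIg d)).
suff d1 : d = 1.
  have ecc : c = c' by apply/eqP; rewrite eq_mulgV1 -/d d1.
  by split=> //; apply: df => // x Ax; rewrite fd // d1 mulg1.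
apply: contraNeq nkl => d1; apply/eqP.
have od : #[d] = 5.
  have : #[d] %| 5 by rewrite -(card_ord 5) -cardsT order_dvdG ?inE.
  case/(@dvdn_pfactor 5 _ 1 isT) => -[|[|//]] _ // /eqP.
  by rewrite order_eq1 (negPf d1).
have : k^-1 * l \in <[d]>.
  suff -> : <[d]> = setT by rewrite inE.
  by apply/eqP; rewrite eqEcard subsetT cardsT card_ord -[#|<[d]>|]/#[d] od.
case/cycleP=> m e; have -> : l = k * d ^+ m by rewrite -e mulKVg.
by elim: m {e} => [|m IHm]; rewrite ?mulg1 // expgSr mulgA nd.
Qed.

(* Points are identified with V. Along an irredundant generating sequence v_1, v_2, ... of V, the identity gets colour 0, v_1 colour 3, the other v_i colour 1, the products v_i v_(i+1) colour 2, and the rest colour 4: an element of G preserving the colours fixes the identity, then v_1, then successively all the v_i. *)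
Lemma distinguishing_regular (T : finType) (A : {set T}) (G V : {group {perm T}}) :
    G \subset Sym A -> V <| G -> abelian V -> regular_on A V -> 1 < #|A| ->
  exists f, distinguishing A G f.
Proof.
move=> sGA /andP[sVG nVG] abV regV A1; have [trV freeV] := regV.
have [x0 Ax0] : exists x, x \in A by apply/card_gt0P/ltnW.
have [s [Us gs irr]] := irredundant_gens V.
have sV v : v \in s -> v \in V by move=> sv; rewrite -gs mem_gen ?inE.
have GA g : g \in G -> g \in Sym A by apply: (subsetP sGA).
have VA v : v \in V -> v x0 \in A by move=> Vv; rewrite Sym_closed // GA // (subsetP sVG).
have injV v w : v \in V -> w \in V -> v x0 = w x0 -> v = w.
  move=> Vv Vw e; apply/eqP; rewrite eq_mulgV1; apply/eqP.
  by apply: (freeV x0) => //; rewrite ?groupM ?groupV // permM e permK.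
pose sub u := <<[set x in s] :\ u>>.
have subP u v : v \in s -> v != u -> v \in sub u.
  by move=> sv nvu; rewrite mem_gen // !inE nvu.
have irrP u w : u \in s -> u = w -> w \in sub u -> False.
  by move=> su <- ; apply/negP/irr.
have s1 : 1 \notin s by apply/negP=> /irr; rewrite group1.
pose pr i := nth 1 s i * nth 1 s i.+1.
pose prods := [seq pr i | i <- iota 0 (size s).-1].
pose colN v := if v == 1 then 0 else if v == head 1 s then 3
  else if v \in s then 1%N else if v \in prods then 2 else 4.
have col5 v : colN v < 5 by rewrite /colN; repeat case: ifP => _.
pose col v := Ordinal (col5 v).
have colE v w : col v = col w -> colN v = colN w by move/(congr1 val).
have hs : s != [::].
  apply: contraTneq A1 => s0; rewrite -leqNgt; apply/card_le1_eqP=> x y Ax Ay.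
  have [v] := trV x y Ax Ay; rewrite -gs s0 (_ : [set x in [::]] = set0).
    by rewrite gen0 => /set1P->; rewrite perm1.
  by apply/setP=> z; rewrite !inE.
have sh : head 1 s \in s by case: (s) hs => // v r _; rewrite mem_head.
have h1 : head 1 s != 1 by apply: contraNneq s1 => <-.
have col0 v : (colN v == 0) = (v == 1) by rewrite /colN; repeat case: ifP.
have col3 v : (colN v == 3) = (v == head 1 s).
  rewrite /colN; have [->|_] := eqVneq v 1; first by rewrite [1 == _]eq_sym (negPf h1).
  by repeat case: ifP.
have col1 v : colN v == 1%N -> v \in s by rewrite /colN; repeat case: ifP.
have col2 v : colN v == 2 -> v \in prods by rewrite /colN; repeat case: ifP.
have nths i : i < size s -> nth 1 s i \in s by apply: mem_nth.
have nth_inj i j : i < size s -> j < size s -> nth 1 s i = nth 1 s j -> i = j.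
  by move=> si sj /eqP; rewrite nth_uniq // => /eqP.
(* Irredundance keeps v_i v_(i+1) apart from 1 and from all generators, so its colour is really
   2. *)
have colpr i : i.+1 < size s -> colN (pr i) = 2.
  move=> si; have si' := ltnW si; rewrite /colN.
  have irri := irr _ (nths _ si'); have irri1 := irr _ (nths _ si).
  have nii : nth 1 s i != nth 1 s i.+1 by rewrite nth_uniq // neq_ltn ltnSn.
  have prP u : u \in s -> pr i = u -> False.
    move=> su e; have [eu|nu] := eqVneq u (nth 1 s i).
      have : nth 1 s i.+1 = 1 by apply: (mulgI (nth 1 s i)); rewrite mulg1 -[LHS]/(pr i) e.
      by move=> e1; rewrite -e1 nths in s1.
    have [eu'|nu'] := eqVneq u (nth 1 s i.+1).
      have : nth 1 s i = 1 by apply: (mulIg (nth 1 s i.+1)); rewrite mul1g -[LHS]/(pr i) e.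
      by move=> e1; rewrite -e1 nths in s1.
    by apply: (irrP u (pr i)); rewrite // groupM // subP ?nths // eq_sym.
  case: eqP => [e|_].
    case: (@irrP (nth 1 s i) (nth 1 s i.+1)^-1); rewrite ?nths //.
      by apply: (mulIg (nth 1 s i.+1)); rewrite mulVg.
    by rewrite groupV subP ?nths 1?eq_sym.
  case: eqP => [/prP[]//|_]; case: ifP => [/prP[]//|_].
  by rewrite ifT //; apply: map_f; rewrite mem_iota add0n /= ltn_predRL.
pose inv x := if [pick v in V | v x0 == x] is Some v then v else 1.
have invE v : v \in V -> inv (v x0) = v.
  move=> Vv; rewrite /inv; case: pickP => [w /andP[Vw /eqP /injV->] //|/(_ v)].
  by rewrite Vv eqxx.
have df g : g \in G -> (forall x, x \in A -> col (inv (g x)) = col (inv x)) -> g = 1.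
  move=> Gg fg; have nVg := subsetP nVG g Gg.
  have gx0 : g x0 = x0.
    have /= := fg x0 Ax0; have [v Vv ev] := trV x0 (g x0) Ax0 ltac:(by rewrite Sym_closed ?GA).
    rewrite -{1}ev invE // -{1}[x0](perm1 x0) invE // => /colE/eqP.
    rewrite (_ : colN 1 = 0) ?col0; last by rewrite /colN eqxx.
    by move=> /eqP e; rewrite -ev e perm1.
  have gcol v : v \in V -> colN (v ^ g) = colN v.
    move=> Vv; have /= := fg (v x0) (VA v Vv).
    by rewrite -permM conjgC permM gx0 !invE ?memJ_norm // => /colE.
  have fixs i : i < size s -> nth 1 s i ^ g = nth 1 s i.
    elim/ltn_ind: i => [[|i]] IH si.
      have /eqP := gcol _ (sV _ sh); rewrite [X in _ == X](eqP (_ : colN _ == 3)) ?col3 //.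
      by rewrite nth0 => /eqP.
    have si' := ltnW si; have ei := IH i (ltnSn i) si'.
    have : nth 1 s i.+1 ^ g \in s.
      apply: col1; rewrite gcol ?sV ?nths // /colN.
      rewrite ifN; last by apply: contraNneq s1 => <-; apply: nths.
      rewrite -nth0 nth_uniq //; last exact: leq_trans si.
      by rewrite nths.
    case/(nthP 1)=> j sj ej.
    have : pr i ^ g \in prods.
      by apply: col2; rewrite gcol ?colpr // groupM ?sV ?nths.
    rewrite conjMg ei -ej => /mapP[k]; rewrite mem_iota add0n ltn_predRL /= => sk ek.
    have sk' := ltnW sk.
    have nij : i != j.
      apply/eqP=> eij; move: ej; rewrite -eij -{1}ei => /conjg_inj /(nth_inj _ _ si' si) e.
      by case: (n_Sn _ e).
    (* By irredundance, v_i v_j = v_k v_(k+1) forces {i, j} = {k, k+1}. If j = k, then g sends both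
       v_(i+1) and the already fixed v_k to v_k, which is impossible. *)
    have ik : (i == k) || (i == k.+1).
      rewrite -[_ || _]negbK; apply/negP; rewrite negb_or => /andP[nik nik1].
      case: (irrP (nth 1 s i) (pr k * (nth 1 s j)^-1)); rewrite ?nths //.
        by rewrite -ek mulgK.
      by rewrite !groupM ?groupV // subP ?nths // nth_uniq // eq_sym.
    case/orP: ik => /eqP eik.
      move: ek; rewrite /pr -eik => /mulgI e.
      exact: e.
    have jk : (j == k) || (j == k.+1).
      rewrite -[_ || _]negbK; apply/negP; rewrite negb_or => /andP[njk njk1].
      case: (irrP (nth 1 s j) ((nth 1 s i)^-1 * pr k)); rewrite ?nths //.
        by rewrite -ek mulKg.
      by rewrite !groupM ?groupV // subP ?nths // nth_uniq // eq_sym.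
    case/orP: jk => /eqP ejk; last by rewrite eik ejk eqxx in nij.
    have ki : k < i.+1 by rewrite eik ltnW.
    move: ej; rewrite ejk -{1}(IH k ki sk') => /conjg_inj /(nth_inj _ _ sk' si) e.
    by rewrite e ltnn in ki.
  apply: (regular_on_conj regV Ax0 nVg (GA g Gg) gx0) => v.
  rewrite -{1}gs => gv; apply/conjg_fixP/commgP.
  have : g \in 'C([set x in s]).
    apply/centP=> u; rewrite inE => /(nthP 1)[i si <-].
    by apply/commute_sym/commgP/conjg_fixP/fixs.
  by rewrite -cent_gen => /centP/(_ v gv).
have eqcard m : #|[set x in A | col (inv x) == m]| = #|[set v in V | col v == m]|.
  have injx : {in V &, injective (fun v : {perm T} => v x0)} by move=> v w Vv Vw; apply: injV.
  rewrite -[RHS](card_in_imset (f := fun v : {perm T} => v x0)); last first.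
    by move=> v w /setIdP[Vv _] /setIdP[Vw _]; apply: injV.
  apply: eq_card => y; rewrite inE; apply/andP/imsetP => [[Ay cy]|[v /setIdP[Vv cv] ->]].
    have [v Vv ev] := trV x0 y Ax0 Ay; exists v => //.
    by rewrite inE Vv; move: cy; rewrite -ev invE.
  by rewrite VA // invE.
pose n m := #|[set x in A | col (inv x) == m]|.
(* Colour 0 is used once only. If all classes had this size, V would have order 5 and be generated
   by its first generator, leaving no room for one of colour 1. *)
have [/existsP[k /existsP[l nkl]]|] := boolP [exists k, [exists l, n k != n l]].
  exact: (distinguishing_shift sGA df nkl).
rewrite negb_exists => /forallP nE.
have n1 k : n k = 1%N.
  have -> : n k = n (col 1).
    by have := nE k; rewrite negb_exists => /forallP/(_ (col 1)); rewrite negbK => /eqP.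
  rewrite /n eqcard; apply/eqP/cards1P; exists 1; apply/setP=> v; rewrite !inE.
  apply/andP/eqP => [[_ /eqP/colE e]|->]; last by rewrite group1 eqxx.
  by apply/eqP; rewrite -col0 e col0.
have oV : #|V| = 5.
  rewrite -[5]card_ord -sum1_card (partition_big col predT) //= -sum1_card.
  apply: eq_bigr => k _; rewrite -[RHS](n1 k) /n eqcard -sum1_card.
  by apply: eq_bigl => v; rewrite inE.
have [v /setIdP[Vv /eqP/(congr1 val) cv]] : exists v, v \in [set v in V | col v == inord 1].
  by apply/card_gt0P; rewrite -eqcard -/(n _) n1.
rewrite /= inordK // in cv; have sv := col1 _ (introT eqP cv).
have nvh : head 1 s != v.
  by apply/eqP=> e; have := col3 (head 1 s); rewrite eqxx e cv.
case/negP: (irr _ sv); apply: (subsetP _ _ Vv).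
have -> : V = <[head 1 s]> :> {set _}.
  apply/esym/eqP; rewrite eqEcard cycle_subG sV //= oV.
  have : #[head 1 s] %| 5 by rewrite -oV order_dvdG ?sV.
  case/(@dvdn_pfactor 5 _ 1 isT) => -[|[|//]] _ e; last by rewrite -[#|_|]/#[_] e.
  by move/eqP: e; rewrite order_eq1 (negPf h1).
by rewrite cycle_subG subP.
Qed.

(** * Groups induced on invariant sets and on block systems *)

Definition restr_group (T : finType) (B : {set T}) (G : {group {perm T}}) :=
  [group of restr_perm B @* 'N_G(B | 'P)].

Section RestrGroup.

Variables (T : finType) (B : {set T}) (G : {group {perm T}}).

Lemma restr_group_Sym : restr_group B G \subset Sym B.
Proof.
by apply/subsetP=> _ /morphimP[g _ _ ->]; rewrite inE restr_perm_on.
Qed.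

Lemma restr_group_sol : solvable G -> solvable (restr_group B G).
Proof. by move=> solG; apply/morphim_sol/(solvableS (subsetIl _ _)). Qed.

Lemma imset_astabs (g : {perm T}) : g @: B = B -> g \in 'N(B | 'P).
Proof.
move=> gB; apply/astabsP=> x; rewrite /= apermE.
by rewrite -{1}gB mem_imset //; apply: perm_inj.
Qed.

Lemma astabs_imset (g : {perm T}) : g \in 'N(B | 'P) -> g @: B = B.
Proof.
move=> nBg; apply: perm_imset_stable => x Bx.
by have := astabsP nBg x; rewrite /= apermE Bx.
Qed.

Lemma mem_restr_group g :
  g \in G -> g @: B = B -> restr_perm B g \in restr_group B G.
Proof.
move=> Gg gB; have nBg := imset_astabs gB.
by rewrite mem_morphim // inE Gg.
Qed.

Lemma restr_imsetE (g : {perm T}) x : g @: B = B -> x \in B -> restr_perm B g x = g x.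
Proof. by move=> gB Bx; rewrite restr_permE // imset_astabs. Qed.

End RestrGroup.

Lemma imset_permM (T : finType) (B : {set T}) (g h : {perm T}) :
  (g * h) @: B = h @: (g @: B).
Proof. by rewrite -imset_comp; apply: eq_imset => x; rewrite permM. Qed.

Lemma imset_perm1 (T : finType) (B : {set T}) : (1 : {perm T}) @: B = B.
Proof. by rewrite -[RHS]imset_id; apply: eq_imset => x; rewrite perm1. Qed.

Lemma imset_permV (T : finType) (B C : {set T}) (g : {perm T}) :
  g @: B = C -> g^-1 @: C = B.
Proof. by move <-; rewrite -imset_permM mulgV imset_perm1. Qed.

(** Each block is identified with B by an element of G, so that colourings and tuples of B can be
    copied to every block. *)
Lemma block_transport (T : finType) (A : {set T}) (G : {group {perm T}}) P B :
    block_system A G P -> B \in P ->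
  exists h : {set T} -> {perm T}, forall C, C \in P -> h C \in G /\ h C @: B = C.
Proof.
move=> [_ _ trP] PB; have hP C : exists k, C \in P -> k \in G /\ k @: B = C.
  have [/(trP _ _ PB)[k Gk kB]|] := boolP (C \in P); first by exists k.
  by exists 1.
by have [h hh] := fin_all_exists hP; exists h.
Qed.

(** The action on all subsets is cut down to P, so that the results on subgroups of [Sym A] apply to
    the permutations of the blocks. *)
Lemma block_action (T : finType) (A : {set T}) (G : {group {perm T}}) P :
    solvable G -> block_system A G P ->
  exists H : {group {perm {set T}}}, [/\ solvable H, H \subset Sym P
    & forall g, g \in G -> exists2 h, h \in H & forall B, B \in P -> h B = g @: B].
Proof.
move=> solG [partP actP _]; pose f := actperm (('P : action [set: {perm T}] T)^*)%act.
have fE g B : f g B = g @: B by rewrite actpermE.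
exists (restr_group P [group of f @* G]); split.
- exact/restr_group_sol/morphim_sol.
- exact: restr_group_Sym.
move=> g Gg; have fP : f g @: P = P.
  by apply: perm_imset_stable => B PB; rewrite fE actP.
exists (restr_perm P (f g)); first by rewrite mem_restr_group ?mem_morphim ?inE.
by move=> B PB; rewrite restr_imsetE.
Qed.

Lemma block_perm_eq1 (T : finType) (A : {set T}) (P : {set {set T}}) (g : {perm T}) :
    partition P A -> g \in Sym A ->
    (forall B x, B \in P -> x \in B -> g x = x) -> g = 1.
Proof.
move=> /and3P[/eqP covP _ _] Ag gx; apply: (Sym_eq1 Ag) => x.
by rewrite -covP => /bigcupP[B PB Bx]; apply: gx Bx.
Qed.

(* On blocks, the colouring of a block is chosen among the five available ones by the colour given to that block in a distinguishing colouring of the block system. *)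
Theorem solvable_distinguishing (T : finType) (A : {set T}) (G : {group {perm T}}) :
  G \subset Sym A -> solvable G -> A != set0 -> exists f, distinguishing A G f.
Proof.
have [n leAn] := ubnP #|A|.
elim: n T A G leAn => // n IHn T A G leAn sGA solG A0.
have GA g : g \in G -> g \in Sym A by apply: (subsetP sGA).
have [A1|A1] := leqP #|A| 1.
  (* On a single point the five constant colourings are inequivalent. *)
  have [x Ax] := set0Pn _ A0; exists (fun c _ => c) => c c' g Gg fg.
  split; first exact: fg Ax.
  apply: (Sym_eq1 (GA g Gg)) => y Ay.
  by apply: (card_le1_eqP A1); rewrite ?Sym_closed ?GA.
have [[B sBA [/andP[B0 ltBA] GB]]|[P sysP [P1 cardP]]|[V nsVG [abV regV]]]
    := solvable_trichotomy sGA solG A1.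
- pose C := A :\: B.
  have GC g : g \in G -> g @: C = C.
    by move=> Gg; rewrite imset_setD ?GB // Sym_imset ?GA.
  have C0 : C != set0 by rewrite setD_eq0; apply: contraL ltBA => /subset_leq_card; rewrite -leqNgt.
  have ltCA : #|C| < #|A| by rewrite cardsD (setIidPr sBA) ltn_subrL B0 (leq_trans B0) ?subset_leq_card.
  have [|f1 d1] := IHn _ B (restr_group B G) (leq_trans ltBA leAn) (restr_group_Sym _ _) (restr_group_sol _ solG).
    by rewrite -card_gt0.
  have [f2 d2] := IHn _ C (restr_group C G) (leq_trans ltCA leAn) (restr_group_Sym _ _) (restr_group_sol _ solG) C0.
  exists (fun c x => if x \in B then f1 c x else f2 c x) => c c' g Gg fg.
  have [ecc g1] : c = c' /\ restr_perm B g = 1.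
    apply: d1; first by rewrite mem_restr_group ?GB.
    move=> x Bx; have gBx : g x \in B by rewrite -(GB g Gg) imset_f.
    by have := fg x (subsetP sBA x Bx); rewrite restr_imsetE ?GB // Bx gBx.
  have [_ g2] : c = c' /\ restr_perm C g = 1.
    apply: d2; first by rewrite mem_restr_group ?GC.
    move=> x Cx; have : g x \in C by rewrite -(GC g Gg) imset_f.
    case/setDP: (Cx) => Ax /negbTE nBx /setDP[_ /negbTE nBgx].
    by have := fg x Ax; rewrite restr_imsetE ?GC // nBx nBgx.
  split=> //; apply: (Sym_eq1 (GA g Gg)) => x Ax.
  have [Bx|nBx] := boolP (x \in B); first by rewrite -(restr_imsetE (GB g Gg) Bx) g1 perm1.
  have Cx : x \in C by rewrite inE nBx.
  by rewrite -(restr_imsetE (GC g Gg) Cx) g2 perm1.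
- have [partP actP trP] := sysP; have /and3P[/eqP covP tiP P0] := partP.
  have [B PB] : exists B, B \in P by apply/card_gt0P/ltnW.
  have [h hP] := block_transport sysP PB.
  have [H [solH sHP HP]] := block_action solG sysP.
  have /andP[B1 ltBA] := cardP B PB.
  have [|f1 d1] := IHn _ B (restr_group B G) (leq_trans ltBA leAn) (restr_group_Sym _ _) (restr_group_sol _ solG).
    by rewrite -card_gt0 ltnW.
  have ltPA : #|P| < #|A|.
    have : \sum_(C in P) 2 <= \sum_(C in P) #|C|.
      by apply: leq_sum => C /cardP /andP[].
    rewrite -(card_partition partP) sum_nat_const; apply: leq_trans.
    by rewrite muln2 -addnn -[X in X < _]addn0 ltn_add2l ltnW.
  have [|f2 d2] := IHn _ P H (leq_trans ltPA leAn) sHP solH.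
    by rewrite -card_gt0 ltnW.
  pose F c x := f1 (f2 c (pblock P x)) ((h (pblock P x))^-1 x).
  exists F => c c' g Gg Fg.
  (* Read on B through h, g becomes an element of [restr_group B G]; inequivalence of the colourings
     f1 then yields equal colours for C and its image. *)
  have key C : C \in P -> f2 c C = f2 c' (g @: C) /\ restr_perm B (h C * g * (h (g @: C))^-1) = 1.
    move=> PC; have PgC := actP g C Gg PC.
    have [Gh hB] := hP C PC; have [Gh' hB'] := hP _ PgC.
    have kB : (h C * g * (h (g @: C))^-1) @: B = B.
      by rewrite !imset_permM hB (imset_permV hB').
    apply: d1; first by rewrite mem_restr_group // !groupM ?groupV.
    move=> x Bx; rewrite restr_imsetE //.
    have Cx : h C x \in C by move: (imset_f (h C) Bx); rewrite hB.
    have Ax : h C x \in A by rewrite -covP; apply/bigcupP; exists C.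
    have := Fg _ Ax; rewrite /F (def_pblock tiP PC Cx) permK.
    by rewrite (def_pblock tiP PgC) ?imset_f // !permM.
  have [k Hk kE] := HP g Gg.
  have [ecc k1] : c = c' /\ k = 1.
    by apply: d2 => // C PC; rewrite kE //; case: (key C PC).
  have gC C : C \in P -> g @: C = C by move=> PC; rewrite -kE // k1 perm1.
  split=> //; apply: (block_perm_eq1 partP (GA g Gg)) => C x PC Cx.
  have [_] := key C PC; rewrite gC // => e.
  have [Gh hB] := hP C PC.
  have Bx : (h C)^-1 x \in B by move: (imset_f (h C)^-1 Cx); rewrite (imset_permV hB).
  have := congr1 (fun p : {perm T} => p ((h C)^-1 x)) e.
  rewrite perm1 restr_imsetE //; last by rewrite !imset_permM hB gC // (imset_permV hB).
  by rewrite !permM permKV => /perm_inj.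
- have [p _ /abelem_abelian cVV] := is_abelemP abV.
  exact: distinguishing_regular sGA nsVG cVV regV A1.
Qed.

(** * Intransitive groups *)

Lemma SymS (T : finType) (A B : {set T}) : A \subset B -> Sym A \subset Sym B.
Proof. by move=> sAB; apply/subsetP=> g; rewrite !inE => /subset_trans; apply. Qed.

Lemma disjoint_setD (T : finType) (A B : {set T}) : [disjoint B & A :\: B].
Proof. by rewrite -setI_eq0 setDE setICA setICr setI0. Qed.

Lemma tperm_Sym (T : finType) (A : {set T}) x y :
  x \in A -> y \in A -> tperm x y \in Sym A.
Proof.
move=> Ax Ay; rewrite inE; apply/subsetP=> z; rewrite inE.
by case: tpermP => [->|->|]; rewrite ?eqxx.
Qed.

Lemma tperm_odd_Sym (T : finType) (A : {set T}) :
  1 < #|A| -> exists2 t, t \in Sym A & odd_perm t.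
Proof.
case/card_gt1P=> x [y [Ax Ay xy]]; exists (tperm x y); first exact: tperm_Sym.
by rewrite odd_tperm xy.
Qed.

(** G and the entries lie in [Sym C], so the condition at [ord0] alone puts g there. *)
Lemma rigid_sub (T : finType) (A C : {set T}) (G : {group {perm T}}) :
    C \subset A -> G \subset Sym C -> rigid (even_sym C) (Sym C) G ->
  rigid (even_sym A) (Sym A) G.
Proof.
move=> sCA sGC [x [Ex rx]]; exists x; split=> [c i|c c' g Ag Gx].
  by have /setIP[Cx ex] := Ex c i; rewrite inE ex (subsetP (SymS sCA)).
have Cx d i : x d i \in Sym C by have /setIP[] := Ex d i.
apply: rx => //; have := subsetP sGC _ (Gx ord0).
by rewrite groupMr ?groupV // groupMl.
Qed.

Lemma restr_perm_Sym (T : finType) (C : {set T}) (g : {perm T}) :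
  g \in Sym C -> restr_perm C g = g.
Proof.
move=> Cg; apply/permP=> x; have [Cx|Cx] := boolP (x \in C).
  by rewrite restr_imsetE // Sym_imset.
by rewrite !(@Sym_out _ C) // inE restr_perm_on.
Qed.

(** Turns a condition for G into one for the group induced on B, when the entries x and x' are only
    controlled on B. *)
Lemma restr_rigid (T : finType) (B : {set T}) (x g x' y y' : {perm T}) :
    y \in Sym B -> y' \in Sym B -> {in B, x =1 y} -> {in B, x' =1 y'} ->
    (x * g * x'^-1) @: B = B ->
  g @: B = B /\ restr_perm B (x * g * x'^-1) = y * restr_perm B g * y'^-1.
Proof.
move=> By By' xy xy' kB.
have xB : x @: B = B by rewrite -[RHS](Sym_imset By); apply: eq_in_imset.
have xB' : x' @: B = B by rewrite -[RHS](Sym_imset By'); apply: eq_in_imset.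
have gB : g @: B = B.
  by rewrite -{2}xB' -{2}kB !imset_permM xB -imset_permM mulVg imset_perm1.
split=> //; apply/permP=> z; have [Bz|nBz] := boolP (z \in B); last first.
  by rewrite !(@Sym_out _ B) // ?groupM ?groupV // inE restr_perm_on.
rewrite restr_imsetE // !permM xy //.
have Byz : y z \in B by rewrite Sym_closed.
rewrite restr_imsetE //.
have Bgyz : g (y z) \in B by rewrite -gB imset_f.
apply: (@perm_inj _ x'); rewrite permKV.
have By'g : y'^-1 (g (y z)) \in B by rewrite Sym_closed ?groupV.
by rewrite xy' // permKV.
Qed.

Lemma Sym_disjoint_out (T : finType) (B C : {set T}) (y : {perm T}) x :
  [disjoint B & C] -> y \in Sym C -> x \in B -> y x = x.
Proof. by move=> dBC Cy Bx; rewrite (Sym_out Cy) // (disjointFr dBC). Qed.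

Lemma rigid_prod (T : finType) (A B : {set T}) (G : {group {perm T}}) :
    B \subset A -> G \subset Sym A -> (forall g, g \in G -> g @: B = B) ->
    rigid (even_sym B) (Sym B) (restr_group B G) ->
    rigid (even_sym (A :\: B)) (Sym (A :\: B)) (restr_group (A :\: B) G) ->
  rigid (even_sym A) (Sym A) G.
Proof.
set C := A :\: B => sBA sGA GB [y [Ey ry]] [z [Ez rz]].
have GC g : g \in G -> g @: C = C.
  by move=> Gg; rewrite imset_setD ?GB // Sym_imset // (subsetP sGA).
have dBC : [disjoint B & C] by apply: disjoint_setD.
have dCB : [disjoint C & B] by rewrite disjoint_sym.
have sCA : C \subset A by apply: subsetDl.
have By d i : y d i \in Sym B by have /setIP[] := Ey d i.
have Cz d i : z d i \in Sym C by have /setIP[] := Ez d i.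
pose x c i := y c i * z c i.
have xB d i : {in B, x d i =1 y d i}.
  by move=> p Bp; rewrite permM (Sym_disjoint_out dBC) // Sym_closed.
have xC d i : {in C, x d i =1 z d i}.
  by move=> p Cp; rewrite permM (Sym_disjoint_out dCB (By d i)).
exists x; split=> [c i|c c' g Ag Gx].
  have /setIP[_ ey] := Ey c i; have /setIP[_ ez] := Ez c i.
  by rewrite inE !groupM // (subsetP (SymS _) _ (By c i), subsetP (SymS _) _ (Cz c i)).
have [ecc gB1] : c = c' /\ restr_perm B g = 1.
  apply: ry => [|i]; first by rewrite inE restr_perm_on.
  have [_ <-] := restr_rigid (By c i) (By c' i) (xB c i) (xB c' i) (GB _ (Gx i)).
  by rewrite mem_restr_group ?GB.
have [_ gC1] : c = c' /\ restr_perm C g = 1.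
  apply: rz => [|i]; first by rewrite inE restr_perm_on.
  have [_ <-] := restr_rigid (Cz c i) (Cz c' i) (xC c i) (xC c' i) (GC _ (Gx i)).
  by rewrite mem_restr_group ?GC.
have [gB _] := restr_rigid (By c _) (By c' _) (xB c _) (xB c' _) (GB _ (Gx ord0)).
have [gC _] := restr_rigid (Cz c _) (Cz c' _) (xC c _) (xC c' _) (GC _ (Gx ord0)).
split=> //; apply: (Sym_eq1 Ag) => p Ap.
have [Bp|nBp] := boolP (p \in B); first by rewrite -(restr_imsetE gB Bp) gB1 perm1.
have Cp : p \in C by rewrite inE nBp.
by rewrite -(restr_imsetE gC Cp) gC1 perm1.
Qed.

(* The two sets stabilised by g, B and its image under the transposition, differ only at u and w. *)
Lemma tperm_setwise_fix (T : finType) (B : {set T}) (g : {perm T}) u w :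
    u \in B -> w \notin B -> g @: B = B ->
    (tperm u w * g * tperm u w) @: B = B -> g u = u /\ g w = w.
Proof.
move=> Bu nBw gB; set t := tperm u w; pose D := t @: B => tB.
have gD : g @: D = D.
  rewrite /D -{2}tB !imset_permM -[in RHS]imset_permM.
  by rewrite tperm2 imset_perm1.
have tt z : t z \in D = (z \in B) by rewrite mem_imset //; apply: perm_inj.
have Dw : w \in D by rewrite -(tpermL u w) tt.
have nDu : u \notin D by rewrite -(tpermR u w) tt.
have uP z : z \in B -> z \notin D -> z = u.
  move=> Bz; apply: contraNeq => zu; rewrite -(tpermK u w z) tt tpermD // eq_sym //.
  by apply: contraNneq nBw => <-.
have wP z : z \in D -> z \notin B -> z = w.
  case/imsetP=> z' Bz' ->; rewrite /t; by case: tpermP; rewrite // ?Bu ?Bz'.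
have memg (E : {set T}) z : g @: E = E -> (g z \in E) = (z \in E).
  by move=> gE; rewrite -{1}gE mem_imset //; apply: perm_inj.
by split; [apply: uP | apply: wP]; rewrite memg.
Qed.

(* A permutation of at most four points is determined by its values on three of them, possibly repeated. *)
Lemma cover3 (T : finType) (B : {set T}) : 0 < #|B| <= 4 ->
  exists u : 'I_3 -> T, (forall j, u j \in B) /\
    forall g : {perm T}, g @: B = B -> (forall j, g (u j) = u j) ->
    forall x, x \in B -> g x = x.
Proof.
case/andP=> /card_gt0P[b Bb] B4.
exists (fun j => nth b (enum B) j); split=> [j|g gB gu x Bx].
  have [lt|ge] := ltnP j (size (enum B)); first by rewrite -mem_enum mem_nth.
  by rewrite nth_default.
have fixi i : i < 3 -> g (nth b (enum B) i) = nth b (enum B) i by move=> i3; apply: (gu (Ordinal i3)).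
have [i iB ->] : exists2 i, i < size (enum B) & x = nth b (enum B) i.
  by exists (index x (enum B)); rewrite ?index_mem ?nth_index ?mem_enum.
have i4 : i < 4 by apply: leq_trans B4; rewrite cardE.
have [/fixi//|i3] := ltnP i 3.
have : g (nth b (enum B) i) \in B by rewrite -{2}gB imset_f // -mem_enum mem_nth.
rewrite -mem_enum => /(nthP b)[j jB ej].
have j4 : j < 4 by apply: leq_trans B4; rewrite cardE.
have [/fixi|j3] := ltnP j 3; last by rewrite -ej; congr nth; apply/eqP; rewrite eqn_leq !ltnS in i4 j4 *; rewrite (leq_trans j4) ?(leq_trans i4).
by rewrite ej => /perm_inj.
Qed.

(** The part B is too small to have rigid tuples. Transpositions joining it to a point of C force g
    to be trivial on B, then commute with g and leave the conditions for C. *)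
Lemma rigid_small_big (T : finType) (A B : {set T}) (G : {group {perm T}}) :
    B \subset A -> G \subset Sym A -> (forall g, g \in G -> g @: B = B) ->
    1 < #|B| <= 4 -> A :\: B != set0 ->
    rigid (even_sym (A :\: B)) (Sym (A :\: B)) (restr_group (A :\: B) G) ->
  rigid (even_sym A) (Sym A) G.
Proof.
set C := A :\: B => sBA sGA GB /andP[B1 B4] /set0Pn[w Cw] [y [Ey ry]].
have GC g : g \in G -> g @: C = C.
  by move=> Gg; rewrite imset_setD ?GB // Sym_imset // (subsetP sGA).
have sCA : C \subset A by apply: subsetDl.
have dBC : [disjoint B & C] by apply: disjoint_setD.
have dCB : [disjoint C & B] by rewrite disjoint_sym.
have /setDP[Aw nBw] := Cw.
have Cy d i : y d i \in Sym C by have /setIP[] := Ey d i.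
(* K contains G and all of [Sym B], hence an odd permutation trivial on C, as [rigid_even]
   requires. *)
pose K := ('N_(Sym A)(B | 'P) :&: restr_perm C @*^-1 (restr_group C G))%G.
have sGK : G \subset K.
  apply/subsetP=> g Gg; rewrite 2!inE (subsetP sGA) // imset_astabs ?GB //.
  by apply/morphpreP; rewrite imset_astabs ?GC // mem_restr_group ?GC.
apply: rigidS sGK _; have [t Bt ot] := tperm_odd_Sym B1.
apply: (rigid_even (k := t)) ot _.
- rewrite 2!inE (subsetP (SymS sBA)) //= imset_astabs ?Sym_imset //=.
  have tC1 : {in C, t =1 id} by move=> x; apply: Sym_disjoint_out Bt.
  have tC : t @: C = C by rewrite -[RHS]imset_id; apply: eq_in_imset.
  apply/morphpreP; rewrite imset_astabs //; split=> //.
  suff e : restr_perm C t = 1 by move: (group1 (restr_group C G)); rewrite -e.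
  apply: (@Sym_eq1 _ C) => [|x Cx]; first by rewrite inE restr_perm_on.
  by rewrite restr_imsetE ?tC1.
- exact: subsetP (SymS sBA) _ Bt.
have [u [Bu fixB]] := cover3 (introT andP (conj (ltnW B1) B4)).
(* Entry 0 shows that g preserves B; entries 2, 3 and 4 serve the three points of [cover3], all
   joined to the same point w. *)
pose s (i : 'I_5) := if i < 2 then 1 else tperm (u (inord (i - 2))) w.
have As i : s i \in Sym A.
  by rewrite /s; case: ifP => _; rewrite ?group1 // tperm_Sym // (subsetP sBA).
exists (fun c i => y c i * s i); split=> [c i|c c' g Ag Kx].
  by rewrite groupM // (subsetP (SymS sCA)).
have KB k : k \in K -> k @: B = B.
  by case/setIP=> /setIP[_ /astabs_imset].
have yB d i : y d i @: B = B.
  rewrite -[RHS]imset_id; apply: eq_in_imset => x Bx.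
  exact: Sym_disjoint_out dBC (Cy d i) Bx.
have sB i : (s i * g * (s i)^-1) @: B = B.
  have -> : s i * g * (s i)^-1 = (y c i)^-1 * (y c i * s i * g * (y c' i * s i)^-1) * y c' i.
    by rewrite invMg !mulgA mulVg mul1g mulgKV.
  by rewrite imset_permM (imset_permM _ (y c i)^-1) (imset_permV (yB _ _)) KB // yB.
have gB : g @: B = B by have := sB ord0; rewrite /s /= mul1g invg1 mulg1.
have fixuw j : g (u j) = u j /\ g w = w.
  apply: (tperm_setwise_fix (B := B)) => //.
  have := sB (inord j.+2); rewrite /s inordK ?ltnS //= ?subSS ?subn0 ?inord_val.
    by rewrite tpermV.
  by rewrite -ltnS ltn_ord.
have gfixB := fixB g gB (fun j => (fixuw j).1).
have [_ gw] := fixuw ord0.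
have sg i : s i * g * (s i)^-1 = g.
  rewrite /s; case: ifP => _; first by rewrite mul1g invg1 mulg1.
  by rewrite (conjgC _ g) tpermJ (fixuw _).1 gw mulgK.
have Cg : g \in Sym C.
  rewrite inE; apply/subsetP=> x; rewrite inE => gx.
  have Ax : x \in A by apply: contraR gx => nAx; rewrite (Sym_out Ag nAx).
  by rewrite inE Ax andbT; apply: contra gx => /gfixB->.
apply: ry => // i; have := Kx i.
have -> : y c i * s i * g * (y c' i * s i)^-1 = y c i * (s i * g * (s i)^-1) * (y c' i)^-1.
  by rewrite invMg !mulgA.
rewrite sg => /setIP[_ /morphpreP[_]] /=.
by rewrite restr_perm_Sym // !groupM ?groupV.
Qed.

Lemma card_Sym5 (T : finType) (A : {set T}) : 5 <= #|A| -> 24 < #|Sym A|.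
Proof.
move=> A5; rewrite perm.card_Sym; apply: (@leq_trans 5`!) => //; exact: leq_fact.
Qed.

(** Here the full setwise stabiliser of B has four translates with trivial intersection: three
    transpositions treat the points of [cover3] in both parts at once. *)
Lemma rigid_small (T : finType) (A B : {set T}) (G : {group {perm T}}) :
    B \subset A -> G \subset Sym A -> (forall g, g \in G -> g @: B = B) ->
    0 < #|B| <= 4 -> 0 < #|A :\: B| <= 4 -> 5 <= #|A| ->
  rigid (even_sym A) (Sym A) G.
Proof.
set C := A :\: B => sBA sGA GB B4 C4 A5; have sCA : C \subset A by apply: subsetDl.
pose K := ('N_(Sym A)(B | 'P))%G.
have sGK : G \subset K.
  by apply/subsetP=> g Gg; rewrite inE (subsetP sGA) // imset_astabs ?GB.
(* As A has at least five points, one of the two parts has two points to transpose. *)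
have [t Kt [At ot]] : exists2 t, t \in K & t \in Sym A /\ odd_perm t.
  have : (1 < #|B|) || (1 < #|C|).
    have := A5; rewrite -(cardsID B A) (setIidPr sBA) -/C; apply: contraLR.
    rewrite negb_or -!leqNgt => /andP[B1 C1].
    by apply: leq_trans (leq_add B1 C1) _.
  case/orP=> /tperm_odd_Sym[t St ot]; exists t.
  - by rewrite inE (subsetP (SymS sBA)) //= imset_astabs ?Sym_imset.
  - by rewrite (subsetP (SymS sBA)).
  - rewrite inE (subsetP (SymS sCA)) //= imset_astabs //.
    rewrite -[RHS]imset_id; apply: eq_in_imset => x Bx.
    exact: Sym_disjoint_out (disjoint_setD _ _) St Bx.
  - by rewrite (subsetP (SymS sCA)).
apply: rigidS sGK _; apply: (rigid_even Kt At ot).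
have [u [Bu fixB]] := cover3 B4; have [w [Cw fixC]] := cover3 C4.
pose x (i : 'I_4) := if unlift ord0 i is Some j then tperm (u j) (w j) else 1.
have Ax i : x i \in Sym A.
  rewrite /x; case: unlift => [j|] //; rewrite tperm_Sym //.
    exact: subsetP sBA _ (Bu j).
  exact: subsetP sCA _ (Cw j).
apply: (rigid_base4 (x := x)) => //; first exact: card_Sym5.
move=> g Ag Kx.
have KB k : k \in K -> k @: B = B by case/setIP=> _ /astabs_imset.
have gB : g @: B = B.
  by have := KB _ (Kx ord0); rewrite /x unlift_none mul1g invg1 mulg1.
have fixuw j : g (u j) = u j /\ g (w j) = w j.
  have /setDP[_ nBw] := Cw j.
  apply: (tperm_setwise_fix (B := B)) => //.
  by have := KB _ (Kx (lift ord0 j)); rewrite /x liftK tpermV.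
have gC : g @: C = C by rewrite imset_setD // Sym_imset.
apply: (Sym_eq1 Ag) => y Ay; have [By|nBy] := boolP (y \in B).
  by apply: fixB => // j; case: (fixuw j).
by apply: fixC; rewrite ?inE ?nBy // => j; case: (fixuw j).
Qed.

(** * Imprimitive groups with large blocks *)

Lemma prod_block_perm (T : finType) (P : {set {set T}}) (y : {set T} -> {perm T}) C x :
    trivIset P -> (forall D, D \in P -> y D \in Sym D) -> C \in P -> x \in C ->
  (\prod_(D in P) y D) x = y C x.
Proof.
move=> tiP yP PC Cx; have -> : \prod_(D in P) y D = \prod_(D <- enum P) y D by rewrite big_filter.
have : all (mem P) (enum P) by apply/allP=> D; rewrite mem_enum.
have : uniq (enum P) := enum_uniq P.
have : C \in enum P by rewrite mem_enum.
have out s z : z \in C -> C \notin s -> all (mem P) s -> (\prod_(D <- s) y D) z = z.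
  move=> Cz; elim: s => [|D s IHs]; first by rewrite big_nil perm1.
  rewrite inE negb_or big_cons permM => /andP[CD sC] /= /andP[PD Ps].
  rewrite (Sym_out (yP D PD)) ?IHs //.
  by rewrite (disjointFr (trivIsetP tiP C D PC PD CD)).
elim: (enum P) => // D s IHs; rewrite inE big_cons permM /=.
have [<-|CD] := eqVneq C D => /=.
  move=> _ /andP[sC _] /andP[_ Ps]; apply: out => //.
  by rewrite (Sym_closed _ (yP C PC)).
move=> sC /andP[_ Us] /andP[PD Ps].
rewrite (Sym_out (yP D PD)) ?IHs //.
by rewrite (disjointFr (trivIsetP tiP C D PC PD CD)).
Qed.

(** On a block C the entries are those of the tuple of B numbered by the colour [f c C]. They
    preserve every block, so g permutes the blocks as an element of G does, and the colouring
    finishes the argument. *)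
Lemma rigid_wreath (T : finType) (A B : {set T}) (G : {group {perm T}}) P :
    G \subset Sym A -> solvable G -> block_system A G P -> B \in P ->
    rigid (even_sym B) (Sym B) (restr_group B G) ->
  rigid (even_sym A) (Sym A) G.
Proof.
move=> sGA solG sysP PB [y [Ey ry]].
have [partP actP trP] := sysP; have /and3P[/eqP covP tiP P0] := partP.
have sPA C : C \in P -> C \subset A by move=> PC; rewrite -covP; apply: bigcup_sup.
have [h hP] := block_transport sysP PB.
have [H [solH sHP HP]] := block_action solG sysP.
have [|f df] := solvable_distinguishing sHP solH; first by apply/set0Pn; exists B.
have By d i : y d i \in Sym B by have /setIP[] := Ey d i.
pose z c i C := y (f c C) i ^ h C.
have zC c i C : C \in P -> z c i C \in Sym C.
  move=> PC; have [_ hB] := hP C PC; rewrite inE; apply/subsetP=> p.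
  rewrite inE -{1 2}[p](permKV (h C)) permJ (inj_eq perm_inj) => np.
  have : (h C)^-1 p \in B by apply: contraR np => /(Sym_out (By _ _))->.
  by move/(imset_f (h C)); rewrite permKV hB.
pose x c i := \prod_(C in P) z c i C.
have xE c i C p : C \in P -> p \in C -> x c i p = z c i C p.
  by move=> PC Cp; apply: (prod_block_perm tiP) Cp => // D; apply: zC.
exists x; split=> [c i|c c' g Ag Gx].
  apply: group_prod => C PC; rewrite inE (subsetP (SymS (sPA C PC)) _ (zC _ _ _ PC)) /=.
  by have /setIP[_] := Ey (f c C) i; rewrite !Alt_even odd_permJ.
have xC d i C : C \in P -> x d i @: C = C.
  move=> PC; rewrite -[RHS](Sym_imset (zC d i C PC)); apply: eq_in_imset => p.
  exact: xE.
have gk i C : C \in P -> (x c i * g * (x c' i)^-1) @: C = g @: C.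
  move=> PC; have /= kC := actP _ _ (Gx i) PC.
  rewrite -[LHS](xC c' i) // -imset_permM mulgKV imset_permM xC //.
have gP C : C \in P -> g @: C \in P by move=> PC; rewrite -(gk ord0) // actP.
(* Rigidity on B is applied to g read from C to its image; it returns the equality of colours along
   with triviality on the block. *)
have key C : C \in P -> f c C = f c' (g @: C) /\
    restr_perm B (h C * g * (h (g @: C))^-1) = 1.
  move=> PC; have PgC := gP C PC; set C' := g @: C in PgC *.
  have [Gh hB] := hP C PC; have [Gh' hB'] := hP _ PgC.
  have conjE d i D : D \in P -> {in B, h D * x d i * (h D)^-1 =1 y (f d D) i}.
    move=> PD p Bp; have [_ hD] := hP D PD.
    have Dp : h D p \in D by move: (imset_f (h D) Bp); rewrite hD.
    by rewrite !permM (xE d i D) // permJ permK.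
  have kE i : (h C * x c i * (h C)^-1) * (h C * g * (h C')^-1) * (h C' * x c' i * (h C')^-1)^-1
      = h C * (x c i * g * (x c' i)^-1) * (h C')^-1.
    by rewrite !invMg invgK !mulgA mulgKV mulgKV.
  have kB i : ((h C * x c i * (h C)^-1) * (h C * g * (h C')^-1) * (h C' * x c' i * (h C')^-1)^-1) @: B = B.
    by rewrite kE imset_permM (imset_permM _ (h C)) hB gk // (imset_permV hB').
  apply: ry => [|i]; first by rewrite inE restr_perm_on.
  have [_ <-] := restr_rigid (By _ _) (By _ _) (conjE c i C PC) (conjE c' i C' PgC) (kB i).
  by apply: mem_restr_group (kB i); rewrite kE groupM ?groupV // groupM.
have [k Hk kE] := HP _ (Gx ord0).
have [ecc k1] : c = c' /\ k = 1.
  by apply: df => // C PC; rewrite kE // gk //; case: (key C PC).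
have gC C : C \in P -> g @: C = C by move=> PC; rewrite -(gk ord0) // -kE // k1 perm1.
split=> //; apply: (block_perm_eq1 partP Ag) => C p PC Cp.
have [_] := key C PC; rewrite gC // => e.
have [Gh hB] := hP C PC.
have Bp : (h C)^-1 p \in B by move: (imset_f (h C)^-1 Cp); rewrite (imset_permV hB).
have := congr1 (fun q : {perm T} => q ((h C)^-1 p)) e.
rewrite perm1 restr_imsetE //; last by rewrite !imset_permM hB gC // (imset_permV hB).
by rewrite !permM permKV => /perm_inj.
Qed.

(** * Imprimitive groups with small blocks *)

Section Transport.

Variables (T' T : finType) (e : T' -> T).
Hypothesis inj_e : injective e.

(** Permutations are extended by the identity outside the image of e; a transposition extends to a
    transposition, so parity is kept. *)
Lemma perm_push : exists f : {perm T'} -> {perm T},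
  [/\ forall p z, f p (e z) = e (p z), forall p, f p \in Sym (e @: setT)
    & forall p, f p = p :> bool].
Proof.
pose f0 (p : {perm T'}) x := if [pick z | e z == x] is Some z then e (p z) else x.
have f0E p z : f0 p (e z) = e (p z).
  by rewrite /f0; case: pickP => [y /eqP/inj_e->|/(_ z)] //; rewrite eqxx.
have f0out p x : x \notin e @: setT -> f0 p x = x.
  by rewrite /f0; case: pickP => // z /eqP <-; rewrite imset_f ?inE.
have f0M p q x : f0 (p * q) x = f0 q (f0 p x).
  have [/imsetP[z _ ->]|nx] := boolP (x \in e @: setT); first by rewrite !f0E permM.
  by rewrite !f0out.
have f01 x : f0 1 x = x.
  have [/imsetP[z _ ->]|nx] := boolP (x \in e @: setT); first by rewrite !f0E perm1.
  by rewrite !f0out.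
have f0K p : cancel (f0 p) (f0 p^-1) by move=> x; rewrite -f0M mulgV f01.
pose f p := perm (can_inj (f0K p)).
have fE p z : f p (e z) = e (p z) by rewrite permE f0E.
have fS p : f p \in Sym (e @: setT).
  rewrite inE; apply/subsetP=> x; apply: contraR => nx.
  by rewrite permE f0out.
have fM p q : f (p * q) = f p * f q by apply/permP=> x; rewrite permM !permE f0M.
exists f; split=> // p; have [ts -> _] := prod_tpermP p.
elim: ts => [|t ts IHts]; first by rewrite !big_nil (_ : f 1 = 1) ?odd_perm1 //; apply/permP=> x; rewrite permE f01 perm1.
rewrite !big_cons fM !odd_permM IHts; congr (_ (+) _).
have -> : f (tperm t.1 t.2) = tperm (e t.1) (e t.2).
  apply/permP=> x; have [/imsetP[z _ ->]|nx] := boolP (x \in e @: setT).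
    rewrite fE; case: tpermP => [->|->|]; rewrite ?tpermL ?tpermR // => /eqP n1 /eqP n2.
    by rewrite tpermD // eq_sym (inj_eq inj_e).
  rewrite permE f0out // tpermD //; by apply: contraNneq nx => <-; rewrite imset_f ?inE.
by rewrite !odd_tperm (inj_eq inj_e).
Qed.

Lemma perm_pull (g : {perm T}) : g \in Sym (e @: setT) ->
  exists p : {perm T'}, forall z, g (e z) = e (p z).
Proof.
move=> Ag; have ge z : exists y, g (e z) = e y.
  have : g (e z) \in e @: setT by rewrite Sym_closed // imset_f ?inE.
  by case/imsetP=> y _ ->; exists y.
have [f fE] := fin_all_exists ge.
have inj_f : injective f by move=> y z eyz; apply/inj_e/(@perm_inj _ g); rewrite !fE eyz.
by exists (perm inj_f) => z; rewrite permE.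
Qed.

(** Allows rigidity to be proved in a concrete model: K has only to contain every permutation of T'
    induced by G. *)
Lemma rigid_transport (K : {set {perm T'}}) (G : {group {perm T}}) :
    (forall g (p : {perm T'}), g \in G -> (forall z, g (e z) = e (p z)) -> p \in K) ->
    rigid (even_sym [set: T']) (Sym [set: T']) K ->
  rigid (even_sym (e @: setT)) (Sym (e @: setT)) G.
Proof.
move=> GK [x [Ex rx]]; have [f [fE fS fodd]] := perm_push.
exists (fun c i => f (x c i)); split=> [c i|c c' g Ag Gx].
  by rewrite inE fS Alt_even fodd -Alt_even; have /setIP[] := Ex c i.
have [p gE] := perm_pull Ag.
have [|i|ecc p1] := rx c c' p; first by rewrite inE; apply/subsetP=> z; rewrite inE.
  apply: GK (Gx i) _ => z; rewrite !permM fE gE.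
  by apply: (@perm_inj _ (f (x c' i))); rewrite permKV fE permKV.
split=> //; apply: (Sym_eq1 Ag) => _ /imsetP[z _ ->].
by rewrite gE p1 perm1.
Qed.

End Transport.

(** * Permutations of a grid that preserve its columns *)

Section Grid.

Variables (b a : nat).
Hypothesis b1 : 1 < b.
Local Notation pt := ('I_b * 'I_a)%type.

(** The wreath product of the symmetric groups of degrees a and b; any group with b blocks of size a
    embeds in it. *)
Definition col_perm : {set {perm pt}} :=
  [set g : {perm pt} | [forall z, forall z', (z.1 == z'.1) ==> ((g z).1 == (g z').1)]].

Lemma col_permP (g : {perm pt}) :
  reflect (forall z z', z.1 = z'.1 -> (g z).1 = (g z').1) (g \in col_perm).
Proof.
rewrite inE; apply: (iffP forallP) => [gP z z' ezz'|gP z].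
  by have /forallP/(_ z')/implyP := gP z; rewrite ezz' eqxx => /(_ isT)/eqP.
by apply/forallP=> z'; apply/implyP=> /eqP/gP->.
Qed.

Lemma col_perm_group_set : group_set col_perm.
Proof.
apply/group_setP; split; first by apply/col_permP=> z z'; rewrite !perm1.
move=> g h /col_permP gP /col_permP hP; apply/col_permP=> z z' /gP/hP.
by rewrite !permM.
Qed.
Canonical col_perm_group := Group col_perm_group_set.

Lemma ordS_neq (j : 'I_b) : ordS j != j.
Proof.
apply/negP=> /eqP/(congr1 val)/=; have := ltn_ord j.
rewrite leq_eqVlt => /orP[/eqP ej|lt]; last by rewrite modn_small // => e; case: (n_Sn j).
by rewrite -[X in _ %% X]ej modnn => j0; move: b1; rewrite -ej -j0.
Qed.

Lemma ordS_closed (Q : pred 'I_b) j0 :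
  Q j0 -> (forall j, Q j -> Q (ordS j)) -> forall j, Q j.
Proof.
move=> Q0 QS j.
have Qi m : Q (iter m (@ordS b) j0) by elim: m => //= m; apply: QS.
have iE m : iter m (@ordS b) j0 = (j0 + m) %% b :> nat.
  elim: m => [|m IHm]; first by rewrite addn0 modn_small.
  by rewrite iterS /= IHm addnS -addn1 modnDml addn1.
have -> : j = iter (j + b - j0) (@ordS b) j0; last exact: Qi.
apply: val_inj; rewrite /= iE subnKC; first by rewrite modnDr modn_small.
by rewrite (leq_trans (ltnW (ltn_ord j0))) // leq_addl.
Qed.

(* A column {j} * 'I_a is a block; shifting the layer r moves the r-th point of every block to the next block. *)
Definition shift_fun (r : 'I_a) (z : pt) : pt :=
  (if z.2 == r then ordS z.1 else z.1, z.2).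

Lemma shift_fun_inj r : injective (shift_fun r).
Proof.
move=> [j k] [j' k']; rewrite /shift_fun /= => -[e ek]; move: e; rewrite -ek.
by case: eqP => _; [move/(can_inj (@ordSK _))-> | move->].
Qed.

Definition shift r : {perm pt} := perm (@shift_fun_inj r).

Lemma shiftE r z : shift r z = (if z.2 == r then ordS z.1 else z.1, z.2).
Proof. by rewrite permE. Qed.

Lemma shiftVE r z : (shift r)^-1 z = (if z.2 == r then ord_pred z.1 else z.1, z.2).
Proof.
apply: (@perm_inj _ (shift r)); rewrite permKV shiftE /=.
by case: z => j k /=; case: eqP => // _; rewrite ord_predK.
Qed.

Lemma ord_avoid2 (k1 k2 : 'I_a) : 2 < a -> exists2 k, k != k1 & k != k2.
Proof.
move=> a2; have /subsetPn[k _] : ~~ ([set: 'I_a] \subset [set k1; k2]).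
  apply: contraL a2 => /subset_leq_card; rewrite cardsT card_ord -leqNgt => /leq_trans; apply.
  by rewrite cards2; case: eqP.
by rewrite !inE negb_or => /andP[]; exists k.
Qed.

Lemma col_perm_img (k0 : 'I_a) (g : {perm pt}) : g \in col_perm ->
  exists2 pi : 'I_b -> 'I_b, injective pi & forall z, (g z).1 = pi z.1.
Proof.
move=> Kg; exists (fun j => (g (j, k0)).1) => [j j' e|z]; last by apply: (col_permP _ Kg).
have /col_permP/(_ _ _ e) := groupVr (Kg : g \in col_perm_group).
by rewrite !permK.
Qed.

Section ShiftLayer.

Variables (r : 'I_a) (g : {perm pt}) (pi : 'I_b -> 'I_b).
Hypotheses (inj_pi : injective pi) (gE : forall z, (g z).1 = pi z.1).
Hypothesis Kg : shift r * g * (shift r)^-1 \in col_perm.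

Lemma shift_layer : 2 < a ->
  (forall j, (g (j, r)).2 = r) /\ (forall j, pi (ordS j) = ordS (pi j)).
Proof.
move=> a2; pose g' := shift r * g * (shift r)^-1.
have g'E z : (g' z).1 = if (g (shift r z)).2 == r then ord_pred (pi (shift r z).1) else pi (shift r z).1.
  by rewrite !permM shiftVE gE; case: eqP.
have pred_neq (j : 'I_b) : ord_pred j != j.
  by apply/eqP=> e; have := ordS_neq (ord_pred j); rewrite ord_predK e eqxx.
have sh0 j k : k != r -> shift r (j, k) = (j, k) by move=> /negbTE kr; rewrite shiftE /= kr.
(* Of two cells of column j off layer r, at most one is sent into layer r. The other is not shifted
   at all, so g' induces pi on the columns as well. *)
have g'1 j k : (g' (j, k)).1 = pi j.
  have [k1 k1r _] := ord_avoid2 r r a2; have [k2 k2r k12] := ord_avoid2 r k1 a2.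
  have colg' k' : (g' (j, k)).1 = (g' (j, k')).1 by apply: (col_permP _ Kg).
  have [e1|n1] := eqVneq (g (j, k1)).2 r; last first.
    by rewrite (colg' k1) g'E sh0 // (negbTE n1).
  rewrite (colg' k2) g'E sh0 // ifN //.
  apply: contraNneq k12 => e2; have : g (j, k2) = g (j, k1).
    by rewrite [LHS]surjective_pairing [RHS]surjective_pairing !gE e1 e2.
  by move/perm_inj=> [->].
have SrE j : shift r (j, r) = (ordS j, r) by rewrite shiftE /= eqxx.
(* If g moved (ordS j, r) out of layer r, then g' would send (j, r) to column pi (ordS j) instead of
   pi j. *)
have key j : (g (ordS j, r)).2 = r /\ ord_pred (pi (ordS j)) = pi j.
  have := g'1 j r; rewrite g'E SrE; case: eqP => // _ /inj_pi /eqP.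
  by rewrite (negPf (ordS_neq _)).
split=> j; last by case: (key j) => _ <-; rewrite ord_predK.
by rewrite -[j]ord_predK; case: (key (ord_pred j)).
Qed.

End ShiftLayer.

Lemma cross_tperm (u v u' v' : pt) : 2 < a -> u.1 != v.1 -> u'.1 != v'.1 ->
    tperm u v * tperm u' v' \in col_perm ->
  (u = u' /\ v = v') \/ (u = v' /\ v = u').
Proof.
move=> a2.
have half (x y : pt) : x.1 != y.1 -> u'.1 != v'.1 ->
    tperm x y * tperm u' v' \in col_perm -> y = u' \/ y = v'.
  (* At most one of u', v' lies in the column of x, and m is then its row; w is a cell of that
     column fixed by both transpositions, to be compared with x. *)
  move=> xy uv' Kp; pose m := if u'.1 == x.1 then u'.2 else v'.2.
  have [k kx km] := ord_avoid2 x.2 m a2; pose w : pt := (x.1, k).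
  have wx : x != w by apply: contraNneq kx => ->.
  have wy : y != w by apply: contraNneq xy => ->.
  have wu : u' != w.
    by apply: contraNneq km => eu; rewrite /m eu eqxx.
  have wv : v' != w.
    by apply: contraNneq km => ev; rewrite /m; move: uv'; rewrite ev /= => /negbTE->.
  have := col_permP _ Kp x w (erefl _).
  rewrite !permM tpermL (tpermD wx wy) (tpermD wu wv) /=.
  by case: tpermP => [->|->|_ _ e]; [left | right | rewrite e eqxx in xy].
move=> uv uv' Kp; have ev := half u v uv uv' Kp.
have eu : u = u' \/ u = v' by apply: (half v u); rewrite // 1?eq_sym 1?tpermC.
case: ev eu => ev [] eu; [|by right|by left|]; by rewrite eu ev eqxx in uv.
Qed.

End Grid.

Arguments shift {b a} r.

Section GridRigid.

Variables (b a : nat).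
Hypothesis b1 : 1 < b.
Local Notation pt := ('I_b * 'I_a)%type.
Implicit Types (g : {perm 'I_b * 'I_a}) (pi : 'I_b -> 'I_b).

(** One layer need not be shifted: when all the others are preserved, so is the last. What remains
    is a rotation of the columns. *)
Lemma shift_layers (k0 : 'I_a) g : 2 < a -> g \in col_perm b a ->
    (forall r, r != k0 -> shift r * g * (shift r)^-1 \in col_perm b a) ->
  exists pi, (forall z, g z = (pi z.1, z.2)) /\ forall j, pi (ordS j) = ordS (pi j).
Proof.
move=> a2 Kg Kr; have [pi inj_pi gE] := col_perm_img k0 Kg.
have layer r (rk0 : r != k0) := shift_layer b1 inj_pi gE (Kr r rk0) a2.
exists pi; split=> [[j k]|]; last first.
  by have [r rk0 _] := ord_avoid2 k0 k0 a2; case: (layer r rk0).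
rewrite [LHS]surjective_pairing gE /=; congr (_, _).
have [ek|/layer[]//] := eqVneq k k0.
have [//|nk] := eqVneq (g (j, k)).2 k.
have mk0 : (g (j, k)).2 != k0 by rewrite -ek.
have [lm _] := layer _ mk0; have : g (j, (g (j, k)).2) = g (j, k).
  by rewrite [LHS]surjective_pairing [RHS]surjective_pairing lm !gE.
by move/perm_inj=> [->].
Qed.

Lemma rotation_eq1 g pi j0 : (forall z, g z = (pi z.1, z.2)) ->
  (forall j, pi (ordS j) = ordS (pi j)) -> pi j0 = j0 -> g = 1.
Proof.
move=> gE piS pi0; have piE j : pi j = j.
  apply/eqP; apply: (@ordS_closed b (fun j => pi j == j) j0) => [|{}j /eqP ej].
    exact/eqP.
  by rewrite piS ej.
by apply/permP=> -[j k]; rewrite gE perm1 piE.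
Qed.

(** The second alternative arises only with two columns exchanged by g; a consistent ordering of the
    rows excludes it in the applications. *)
Lemma cross_tperm_rotation g pi j0 (k k' l l' : 'I_a) : 2 < a ->
    (forall z, g z = (pi z.1, z.2)) -> (forall j, pi (ordS j) = ordS (pi j)) ->
    g \in col_perm b a ->
    tperm (j0, k) (ordS j0, k') * g * (tperm (j0, l) (ordS j0, l'))^-1 \in col_perm b a ->
  [/\ k = l, k' = l' & g = 1] \/ (k = l' /\ k' = l).
Proof.
move=> a2 gE piS Kg; rewrite tpermV (conjgC _ g) tpermJ -mulgA groupMl // => Kt.
have nS j : j != ordS j :> 'I_b by rewrite eq_sym ordS_neq.
have := cross_tperm a2 _ _ Kt; rewrite !gE /= piS !nS.
case=> // [[[e1 ek] [_ ek']]|[[_ ek] [_ ek']]]; last by right.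
by left; split=> //; apply: rotation_eq1 e1.
Qed.

End GridRigid.

Lemma rigid_even_grid b a (j0 : 'I_b) : 1 < a ->
    rigid (Sym setT) (Sym setT) (col_perm b a) ->
  rigid (even_sym setT) (Sym setT) (col_perm b a).
Proof.
move=> a1; pose k0 := Ordinal (ltnW a1); pose k1 := Ordinal a1.
apply: (rigid_even (k := tperm (j0, k0) (j0, k1))).
- apply/col_permP; have tE z : (tperm (j0, k0) (j0, k1) z).1 = z.1.
    by case: tpermP => [->|->|].
  by move=> z z'; rewrite !tE.
- by rewrite inE; apply/subsetP=> z; rewrite inE.
- by rewrite odd_tperm xpair_eqE eqxx.
Qed.

Lemma Sym_setT (T : finType) (g : {perm T}) : g \in Sym setT.
Proof. by rewrite inE; apply/subsetP=> z; rewrite inE. Qed.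

Lemma rigid_grid3 b (j0 : 'I_b) : 1 < b ->
  rigid (even_sym setT) (Sym setT) (col_perm b 3).
Proof.
move=> b1; apply: (rigid_even_grid j0) => //.
pose r0 : 'I_3 := ord0; pose r1 : 'I_3 := Ordinal (isT : 1 < 3).
pose x := tnth [tuple 1; @shift b _ r0; @shift b _ r1; tperm (j0, r0) (ordS j0, r1)].
apply: (rigid_base4 (x := x)) => //.
- by apply: card_Sym5; rewrite cardsT card_prod !card_ord (@leq_trans (2 * 3)) // leq_mul2r b1.
- by move=> i; apply: Sym_setT.
move=> g _ Kx.
have Kg : g \in col_perm b 3 by have := Kx ord0; rewrite /x (tnth_nth 1) /= mul1g invg1 mulg1.
have [|pi [gE piS]] := @shift_layers b _ b1 ord_max g isT Kg.
  case=> -[|[|[|//]]] // lt _.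
    by have := Kx (Ordinal (isT : 1 < 4)); rewrite /x (tnth_nth 1) /= (_ : Ordinal lt = r0) //; apply: val_inj.
  by have := Kx (Ordinal (isT : 2 < 4)); rewrite /x (tnth_nth 1) /= (_ : Ordinal lt = r1) //; apply: val_inj.
have := Kx ord_max; rewrite /x (tnth_nth 1) /= => Kt.
by case: (@cross_tperm_rotation _ _ b1 g pi j0 _ _ _ _ isT gE piS Kg Kt) => [[_ _ ->]|[/(congr1 val)]].
Qed.

(** The identity and three shifts occupy four entries, so no entry is free. The tuples differ in the
    fifth one, a transposition between two rows, for five of the six pairs of rows; p c < q c
    excludes reversal. *)
Lemma rigid_grid4 b (j0 : 'I_b) : 1 < b ->
  rigid (even_sym setT) (Sym setT) (col_perm b 4).
Proof.
move=> b1; apply: (rigid_even_grid j0) => //.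
pose r0 : 'I_4 := ord0; pose r1 : 'I_4 := Ordinal (isT : 1 < 4).
pose r2 : 'I_4 := Ordinal (isT : 2 < 4); pose r3 : 'I_4 := ord_max.
pose p := tnth [tuple r0; r0; r0; r1; r1]; pose q := tnth [tuple r1; r2; r3; r2; r3].
pose x c := tnth [tuple 1; @shift b _ r0; @shift b _ r1; @shift b _ r2; tperm (j0, p c) (ordS j0, q c)].
exists x; split=> [c i|c c' g _ Kx]; first exact: Sym_setT.
have Kg : g \in col_perm b 4 by have := Kx ord0; rewrite /x !(tnth_nth 1) /= mul1g invg1 mulg1.
have [|pi [gE piS]] := @shift_layers b _ b1 ord_max g isT Kg.
  case=> -[|[|[|[|//]]]] // lt _.
  - by have := Kx (Ordinal (isT : 1 < 5)); rewrite /x !(tnth_nth 1) /= (_ : Ordinal lt = r0) //; apply: val_inj.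
  - by have := Kx (Ordinal (isT : 2 < 5)); rewrite /x !(tnth_nth 1) /= (_ : Ordinal lt = r1) //; apply: val_inj.
  by have := Kx (Ordinal (isT : 3 < 5)); rewrite /x !(tnth_nth 1) /= (_ : Ordinal lt = r2) //; apply: val_inj.
have := Kx ord_max; rewrite /x !(tnth_nth 1) /= => Kt.
have [[epp eqq g1]|[epq eqp]] := @cross_tperm_rotation _ _ b1 g pi j0 _ _ _ _ isT gE piS Kg Kt.
  split=> //; move: epp eqq; rewrite /p /q !(tnth_nth r0).
  by case: c {Kx Kt} => -[|[|[|[|[|c]]]]] // lt; case: c' => -[|[|[|[|[|c']]]]] //= lt';
    move=> /(congr1 val)//= _ /(congr1 val)//= _; apply: val_inj.
have pq d : p d < q d by rewrite /p /q !(tnth_nth r0); case: d => -[|[|[|[|[|d]]]]].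
by move: (pq c) (pq c'); rewrite epq eqp => /ltn_trans h /h; rewrite ltnn.
Qed.

(** Weak form of [cross_tperm] that still holds when a column has only two cells. *)
Lemma cross_tperm_col b a (u v u' v' : 'I_b * 'I_a) : 1 < a -> u.1 != v.1 ->
    tperm u v * tperm u' v' \in col_perm b a ->
  (v.1 == u'.1) || (v.1 == v'.1).
Proof.
move=> a1 uv Kp; pose k := if val u.2 == 0 then Ordinal a1 else Ordinal (ltnW a1).
pose w : 'I_b * 'I_a := (u.1, k).
have wu : u != w.
  by apply/eqP=> /(congr1 (fun z => val z.2)); rewrite /w /k /=; case: eqP => //= ->.
have wv : v != w by apply: contraNneq uv => ->.
apply: contraT; rewrite negb_or => /andP[vu' vv'].
have := col_permP _ Kp u w (erefl _).
have u'v : u' != v by apply: contraNneq vu' => ->.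
have v'v : v' != v by apply: contraNneq vv' => ->.
rewrite !permM tpermL (tpermD wu wv) (tpermD u'v v'v).
case: tpermP => [_ e|_ e|_ _ e]; first by rewrite e eqxx in vv'.
  by rewrite e eqxx in vu'.
by rewrite e eqxx in uv.
Qed.

(** Columns of two cells lack the third cell used in [shift_layer]. Two transpositions fix the
    columns j0 and j1, and the shift propagates fixedness from each column to the next. *)
Lemma rigid_grid2 b (j0 : 'I_b) : 2 < b ->
  rigid (even_sym setT) (Sym setT) (col_perm b 2).
Proof.
move=> b2; have b1 := ltnW b2; apply: (rigid_even_grid j0) => //.
pose r0 : 'I_2 := ord0; pose r1 : 'I_2 := ord_max.
have rP (k : 'I_2) : k != r0 -> k = r1 by case: k => -[|[|k]] //= lt _; apply: val_inj.
pose j1 := ordS j0; pose j2 := ordS j1.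
have j01 : j0 != j1 by rewrite eq_sym ordS_neq.
have j12 : j1 != j2 by rewrite eq_sym ordS_neq.
have j02 : j0 != j2.
  apply/eqP=> /(congr1 val) /=; rewrite -[(_ %% _).+1]addn1 modnDml addn1 => e.
  have : j0 + 2 == j0 + 0 %[mod b] by rewrite addn2 addn0 -e modn_small.
  by rewrite eqn_modDl mod0n modn_small.
pose x := tnth [tuple 1; @shift b _ r0; tperm (j0, r0) (j1, r0); tperm (j1, r0) (j2, r0)].
apply: (rigid_base4 (x := x)) => //.
- by apply: card_Sym5; rewrite cardsT card_prod !card_ord (@leq_trans (3 * 2)) // leq_mul2r b2.
- by move=> i; apply: Sym_setT.
move=> g _ Kx.
have Kg : g \in col_perm b 2 by have := Kx ord0; rewrite /x (tnth_nth 1) /= mul1g invg1 mulg1.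
have [pi inj_pi gE] := col_perm_img r0 Kg.
have tcol j j' : j != j' -> tperm (j, r0) (j', r0) * g * (tperm (j, r0) (j', r0))^-1 \in col_perm b 2 ->
    ((pi j == j) || (pi j == j')) && ((pi j' == j) || (pi j' == j')).
  move=> jj'; rewrite tpermV (conjgC _ g) tpermJ -mulgA groupMl // => Kt; apply/andP; split.
    rewrite tpermC in Kt; have := cross_tperm_col (isT : 1 < 2) _ Kt.
    by rewrite !gE /= (inj_eq inj_pi) eq_sym; apply.
  have := cross_tperm_col (isT : 1 < 2) _ Kt.
  by rewrite !gE /= (inj_eq inj_pi); apply.
have pi1 : pi j1 = j1.
  have := Kx (Ordinal (isT : 2 < 4)); rewrite /x (tnth_nth 1) /= => /(tcol _ _ j01) /andP[_ h1].
  have := Kx ord_max; rewrite /x (tnth_nth 1) /= => /(tcol _ _ j12) /andP[h2 _].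
  by apply/eqP; case/orP: h2 => // /eqP e2; move: h1; rewrite e2 ![j2 == _]eq_sym (negPf j02) (negPf j12).
have pi0 : pi j0 = j0.
  have := Kx (Ordinal (isT : 2 < 4)); rewrite /x (tnth_nth 1) /= => /(tcol _ _ j01) /andP[/orP[/eqP//|/eqP e] _].
  by case/negP: j01; rewrite -(inj_eq inj_pi) e pi1.
have Ks : shift r0 * g * (shift r0)^-1 \in col_perm b 2.
  by have := Kx (Ordinal (isT : 1 < 4)); rewrite /x (tnth_nth 1).
(* The column to which the inverse shift moves the cell (j, k). *)
pose col k j : 'I_b := if k == r0 then ord_pred j else j.
have colE j : col (g (j, r1)).2 (pi j) = col (g (ordS j, r0)).2 (pi (ordS j)).
  have := col_permP _ Ks (j, r1) (j, r0) (erefl _).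
  by rewrite !permM !shiftE !shiftVE /= !gE.
pose Q j := (pi j == j) && ((g (j, r1)).2 == r1).
have predK : cancel (@ord_pred b) (@ordS b) := @ord_predK b.
have pairE j k : g (j, k) = (pi j, (g (j, k)).2) by rewrite [LHS]surjective_pairing gE.
have allQ j : Q j.
  apply: (@ordS_closed b Q j0) => [|{}j /andP[/eqP pj /eqP e1]].
    rewrite /Q pi0 eqxx /=; apply/eqP/rP/eqP => e0.
    have := colE j0; rewrite -/j1 pi0 pi1 e0 {1}/col eqxx /col; case: eqP => _.
      by move/(congr1 (@ordS b)); rewrite !predK => /eqP; rewrite (negPf j01).
    by move/(congr1 (@ordS b)); rewrite predK => /eqP; rewrite (negPf j02).
  have := colE j; rewrite e1 pj /col /=; case: eqP => [e0|_ e]; last first.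
    by case/negP: (ordS_neq b1 j); apply/eqP/inj_pi; rewrite -e pj.
  move/(congr1 (@ordS b)); rewrite predK /Q => <-; rewrite eqxx /=.
  apply/eqP/rP; apply/eqP=> e1'; have : g (ordS j, r1) = g (ordS j, r0).
    by rewrite [LHS]pairE [RHS]pairE e0 e1'.
  by move/perm_inj=> /(congr1 (fun z => val z.2)).
apply/permP=> -[j k]; rewrite perm1 pairE.
have /andP[/eqP pj /eqP e1] := allQ j; rewrite pj; congr (_, _).
have [->|/rP-> //] := eqVneq k r0.
apply/eqP; apply: contraT => /rP e0; have : g (j, r1) = g (j, r0).
  by rewrite [LHS]pairE [RHS]pairE e0 e1.
by move/perm_inj=> /(congr1 (fun z => val z.2)).
Qed.

Lemma rigid_small_blocks (T : finType) (A : {set T}) (G : {group {perm T}}) P a :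
    G \subset Sym A -> block_system A G P -> (forall C, C \in P -> #|C| = a) ->
    1 < #|P| -> 1 < a <= 4 -> 5 <= #|A| ->
  rigid (even_sym A) (Sym A) G.
Proof.
move=> sGA sysP cardP P1 /andP[a1 a4] A5.
have [partP actP trP] := sysP; have /and3P[/eqP covP tiP P0] := partP.
have [x0 _] : exists x, x \in A by apply/card_gt0P; apply: leq_trans A5.
pose blk (j : 'I_#|P|) : {set T} := enum_val j.
have Pblk j : blk j \in P by apply: enum_valP.
(* Coordinates on A: the number of the block, then the position in it. *)
pose e (z : 'I_#|P| * 'I_a) := nth x0 (enum (blk z.1)) z.2.
have eblk z : e z \in blk z.1 by rewrite -mem_enum mem_nth // -cardE cardP.
have blkP j x C : C \in P -> x \in C -> x \in blk j -> blk j = C.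
  by move=> PC Cx jx; rewrite -(def_pblock tiP PC Cx) (def_pblock tiP (Pblk j) jx).
have inj_e : injective e.
  move=> z z' ez; have e1 : z.1 = z'.1.
    by apply/enum_val_inj/(blkP _ (e z)); rewrite ?Pblk ?eblk // ez eblk.
  rewrite [z]surjective_pairing [z']surjective_pairing e1; congr (_, _).
  move/eqP: ez; rewrite /e e1 nth_uniq ?enum_uniq -?cardE ?cardP //.
  by move=> /eqP/val_inj.
have imA : e @: setT = A.
  apply/eqP; rewrite eqEcard; apply/andP; split.
    by apply/subsetP=> _ /imsetP[z _ ->]; rewrite -covP; apply/bigcupP; exists (blk z.1).
  rewrite card_imset // cardsT card_prod !card_ord (card_partition partP).
  by rewrite (eq_bigr (fun=> a)) ?sum_nat_const // => C PC; rewrite cardP.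
have AE : #|A| = (#|P| * a)%N by rewrite -imA card_imset // cardsT card_prod !card_ord.
rewrite -imA; apply: (rigid_transport inj_e (K := col_perm #|P| a)) => [g p Gg gp|].
  apply/col_permP=> z z' zz'; apply: enum_val_inj.
  have gP := actP _ _ Gg (Pblk z.1).
  have pz y : y.1 = z.1 -> blk (p y).1 = g @: blk z.1.
    move=> ey; apply: (blkP _ (e (p y))); rewrite ?eblk //.
    by rewrite -gp imset_f // -ey eblk.
  by rewrite -/(blk _) -[RHS]/(blk _) !pz.
have j0 : 'I_#|P| := Ordinal (ltnW P1).
move: a1 a4 AE; case: (a) => [|[|[|[|[|//]]]]] // _ _ AE.
- apply: rigid_grid2 => //; rewrite ltnNge; apply: contraL A5 => P2.
  by rewrite -leqNgt AE -[4]/(2 * 2)%N leq_mul2r P2.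
- exact: rigid_grid3.
- exact: rigid_grid4.
Qed.

(** * Affine groups *)

Section CyclePerm.

Variables (T : finType) (s : seq T).
Hypothesis Us : uniq s.

Definition cycle_perm : {perm T} := perm (can_inj (prev_next Us)).

Lemma cycle_permE z : cycle_perm z = next s z.
Proof. by rewrite permE. Qed.

Lemma cycle_perm_out z : z \notin s -> cycle_perm z = z.
Proof. by move=> sz; rewrite cycle_permE next_nth (negPf sz). Qed.

Lemma cycle_perm_moved z : 1 < size s -> (cycle_perm z != z) = (z \in s).
Proof.
move=> s1; apply/idP/idP; first by apply: contraR => /cycle_perm_out->.
move=> sz; rewrite cycle_permE; have [i s' es] := rot_to sz.
have : size (z :: s') = size s by rewrite -es size_rot.
rewrite -(next_rot i Us) es; case: s' es => [|y s'] es; first by move=> e; rewrite -e in s1.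
have : uniq (z :: y :: s') by rewrite -es rot_uniq.
by rewrite /= eqxx inE negb_or => /andP[/andP[zy _] _] _; rewrite eq_sym.
Qed.

(** The power [size s] is the identity, and an odd power has the same parity as the permutation. *)
Lemma cycle_perm_even : odd (size s) -> cycle_perm = false :> bool.
Proof.
move=> os; have : odd_perm (cycle_perm ^+ size s) = cycle_perm :> bool.
  rewrite -(odd_double_half (size s)) os expgD expg1 odd_permM.
  by rewrite -muln2 expgM expgS expg1 odd_permM addbb addbF.
move <-; rewrite (_ : _ ^+ _ = 1) ?odd_perm1 //; apply/permP=> z; rewrite perm1.
have permXE m : (cycle_perm ^+ m) z = iter m (next s) z.
  by elim: m => [|m IHm]; rewrite ?expg0 ?perm1 // expgSr permM IHm cycle_permE.
have [sz|nsz] := boolP (z \in s).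
  rewrite permXE -(order_cycle (cycle_next Us) Us sz).
  exact: (iter_order_cycle (cycle_next Us) sz sz).
rewrite permXE; elim: (size s) => //= m ->; by rewrite next_nth (negPf nsz).
Qed.

Lemma cycle_perm_commute (g : {perm T}) z : commute cycle_perm g ->
  z \in s -> g z = z -> forall y, y \in s -> g y = y.
Proof.
move=> cg sz gz; have [i s' es] := rot_to sz.
have : fcycle (next s) (seq.rot i s) by rewrite rot_cycle cycle_next.
move=> cyc y; rewrite -(mem_rot i) es inE => /predU1P[->//|].
move: cyc; rewrite es /= rcons_path => /andP[pth _].
elim: s' z {sz es} gz pth => // x s' IHs z gz /= /andP[/eqP ex pth].
have gx : g x = x.
  rewrite -ex -cycle_permE -permM cg permM gz //.
by rewrite inE => /predU1P[->//|]; apply: IHs pth.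
Qed.

End CyclePerm.

(** * Normalisers of a regular elementary abelian group *)

Section Regular.

Variables (T : finType) (A : {set T}) (V : {group {perm T}}) (p : nat).
Hypotheses (sVA : V \subset Sym A) (pr_p : prime p) (abV : p.-abelem V).
Hypothesis regV : regular_on A V.

Lemma card_regular : A != set0 -> #|V| = #|A|.
Proof.
case/set0Pn=> x Ax; have [trV freeV] := regV.
have -> : A = [set (v : {perm T}) x | v in V].
  apply/setP=> y; apply/idP/imsetP => [Ay|[v Vv ->]].
    by have [v Vv <-] := trV x y Ax Ay; exists v.
  by rewrite Sym_closed // (subsetP sVA).
rewrite card_in_imset // => v w Vv Vw e; apply/eqP; rewrite eq_mulgV1; apply/eqP.
by apply: (freeV x) => //; rewrite ?groupM ?groupV // permM e permK.
Qed.

(* The fixed points of g, if any, form an orbit of the proper subgroup 'C_V[g]. *)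
Lemma card_fix_normaliser (g : {perm T}) : g \in 'N(V) -> g \in Sym A -> g != 1 ->
  p * #|[set x in A | g x == x]| <= #|A|.
Proof.
move=> nVg Ag g1; have [trV freeV] := regV.
have [->|[x /setIdP[Ax /eqP gx]]] := set_0Vmem [set x in A | g x == x].
  by rewrite cards0 muln0.
rewrite -card_regular; last by apply/set0Pn; exists x.
have sC : 'C_V[g] \proper V.
  rewrite properE subsetIl; apply: contra g1 => /subsetP sV; apply/eqP.
  apply: (regular_on_conj regV Ax nVg Ag gx) => v /sV/setIP[_ /cent1P cvg].
  by apply/conjg_fixP/commgP.
rewrite -(Lagrange (proper_sub sC)) mulnC leq_mul //.
  apply: leq_trans (_ : #|[set (v : {perm T}) x | v in 'C_V[g]]| <= _); last exact: leq_imset_card.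
  apply/subset_leq_card/subsetP=> y /setIdP[Ay /eqP gy].
  have [v Vv ey] := trV x y Ax Ay; apply/imsetP; exists v => //.
  rewrite inE Vv; apply/cent1P/commgP/conjg_fixP.
  apply/eqP; rewrite eq_mulgV1; apply/eqP; apply: (freeV x) => //.
    by rewrite groupM ?groupV ?memJ_norm.
  have e2 : (v ^ g) x = v x by rewrite -{1}gx -permM -conjgC permM ey gy.
  by rewrite permM e2 permK.
have : p.-nat #|V : 'C_V[g]| by apply: pnat_dvd (dvdn_indexg _ _) (abelem_pgroup abV).
have : 1 < #|V : 'C_V[g]| by rewrite indexg_gt1; case/andP: sC.
move=> k1 /p_natP[[|m] e]; first by rewrite e in k1.
by rewrite e expnS leq_pmulr // expn_gt0 prime_gt0.
Qed.

Lemma agree_normaliser (g h : {perm T}) :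
    g \in 'N(V) -> g \in Sym A -> h \in 'N(V) -> h \in Sym A ->
    #|A| < p * #|[set x in A | g x == h x]| -> g = h.
Proof.
move=> nVg Ag nVh Ah; apply: contraTeq => gh; rewrite -leqNgt.
have <- : #|[set x in A | (g * h^-1) x == x]| = #|[set x in A | g x == h x]|.
  apply: eq_card => x; rewrite !inE permM -(inj_eq (@perm_inj _ h)) permKV.
  by [].
by apply: card_fix_normaliser; rewrite ?groupM ?groupV // -eq_mulgV1.
Qed.

(* g and its conjugate by x agree outside U and the preimage of U by g. *)
Lemma commute_small_support (U : {set T}) (g x : {perm T}) :
    U \subset A -> x \in Sym U -> #|A| < p * (#|A| - #|U|.*2) ->
    g \in 'N(V) -> g \in Sym A -> x * g * x^-1 \in 'N(V) -> commute x g.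
Proof.
move=> sUA Ux ltA nVg Ag nVx; have Ax : x \in Sym A by apply: subsetP (SymS sUA) _ Ux.
apply: (mulIg x^-1); rewrite mulgK; apply: agree_normaliser => //.
  by rewrite !groupM ?groupV.
apply: leq_trans ltA _; rewrite leq_mul2l; apply/orP; right.
rewrite -addnn leq_subLR.
have sAU : A \subset (U :|: g^-1 @: U) :|: [set y in A | (x * g * x^-1) y == g y].
  apply/subsetP=> y Ay; rewrite !inE Ay /=; case: (boolP (y \in U)) => //= nUy.
  case: (boolP (y \in _)) => //= nUgy; rewrite !permM (Sym_out Ux nUy).
  rewrite (Sym_out (groupVr Ux)) //; apply: contra nUgy => Ugy.
  by rewrite -[y](permK g) imset_f.
apply: leq_trans (subset_leq_card sAU) _; apply: leq_trans (leq_card_setU _ _) _.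
rewrite leq_add2r; apply: leq_trans (leq_card_setU _ _) _.
by rewrite leq_add2l card_imset //; apply: perm_inj.
Qed.

End Regular.

(* If g and its conjugate by an m-cycle normalise V, they agree on too many points to differ, so g commutes with the cycle. Hence g commutes with the two cycles, fixes their common point, and so fixes both cycles pointwise. *)
Lemma rigid_affine (T : finType) (A : {set T}) (G V : {group {perm T}}) p m :
    G \subset Sym A -> V <| G -> prime p -> p.-abelem V -> regular_on A V ->
    5 <= #|A| -> odd m -> 3 <= m -> logn p #|A| <= m.+1 ->
    #|A| < p * (#|A| - m.*2) ->
  rigid (even_sym A) (Sym A) G.
Proof.
move=> sGA /andP[sVG nVG] pr_p abV regV A5 om m3 dm ltA.
have [x0 Ax0] : exists x, x \in A by apply/card_gt0P; apply: leq_trans A5.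
have GA g : g \in G -> g \in Sym A by apply: (subsetP sGA).
have sVA := subset_trans sVG sGA.
have mA : m.+2 <= #|A|.
  have : 0 < #|A| - m.*2 by move: ltA; case: (_ - _) => //; rewrite muln0.
  by rewrite subn_gt0 => /ltnW; apply: leq_trans; rewrite -addnn -addn2 leq_add2l ltnW.
(* A generating set of least size has [logn p #|A|] members, at most m + 1. *)
have [B gB oB] := grank_witness V.
have BV v : v \in B -> v \in V by move=> Bv; rewrite -gB mem_gen.
pose L := undup (x0 :: [seq (v : {perm T}) x0 | v <- enum B]).
have sL : size L <= m.+2.
  apply: leq_trans (size_undup _) _; rewrite /= size_map -cardE oB.
  rewrite (grank_abelian (abelem_abelian abV)) (rank_abelem abV).
  by rewrite (card_regular sVA regV) //; apply/set0Pn; exists x0.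
have LA x : x \in L -> x \in A.
  rewrite mem_undup inE => /predU1P[->//|/mapP[v]]; rewrite mem_enum => /BV Vv ->.
  by rewrite Sym_closed // (subsetP sVA).
pose F := L ++ [seq x <- enum A | x \notin L].
have FA : F =i A.
  move=> x; rewrite mem_cat mem_filter mem_enum.
  by case: (boolP (x \in L)) => [/LA->|].
have UF : uniq F.
  rewrite cat_uniq undup_uniq filter_uniq ?enum_uniq // andbT.
  by apply/hasPn=> x; rewrite mem_filter => /andP[].
have sF : size F = #|A| by rewrite -(card_uniqP UF); apply: eq_card.
(* Positions 0 to 2 and 2 to m + 1 of F: the two cycles share only c and together cover the first m
   + 2 points, among them L. *)
pose s1 := take 3 F; pose s2 := take m (drop 2 F).
have U1 : uniq s1 by apply: take_uniq.
have U2 : uniq s2 by apply/take_uniq/drop_uniq.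
have z1 : size s1 = 3 by rewrite size_takel // sF (leq_trans _ A5).
have z2 : size s2 = m.
  by rewrite size_takel // size_drop sF leq_subRL // (leq_trans _ A5).
pose c := nth x0 F 2.
have c1 : c \in s1 by rewrite /c -(nth_take x0 (n0 := 3)) // mem_nth // z1.
have c2 : c \in s2.
  rewrite /c -[2]addn0 -nth_drop -(nth_take x0 (n0 := m)) ?mem_nth ?z2 //; exact: leq_trans m3.
have c12 z : z \in s1 -> z \in s2 -> z = c.
  case/(nthP x0)=> i; rewrite z1 => i3; rewrite nth_take // => <-.
  case/(nthP x0)=> j; rewrite z2 => jm; rewrite nth_take // nth_drop => /eqP.
  have iF : i < size F by rewrite sF (leq_trans i3) ?(leq_trans _ A5).
  have jF : 2 + j < size F by rewrite sF (leq_trans _ mA) // add2n !ltnS.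
  rewrite nth_uniq //.
  by move=> /eqP e; move: i3; rewrite -e /c; case: (j) => // j'; rewrite addnS.
have F1 z : z \in s1 -> z \in A by move/mem_take; rewrite FA.
have F2 z : z \in s2 -> z \in A by move/mem_take/mem_drop; rewrite FA.
have L12 z : z \in L -> (z \in s1) || (z \in s2).
  move=> Lz; have : z \in take m.+2 F by rewrite take_cat ltnNge sL /= mem_cat Lz.
  rewrite -[m.+2]/(2 + m)%N takeD mem_cat => /orP[z2'|->]; last by rewrite orbT.
  by rewrite /s1 -[3]/(2 + 1)%N takeD mem_cat z2'.
have cycA s (Us : uniq s) : {subset s <= A} -> cycle_perm Us \in Sym A.
  move=> sA; rewrite inE; apply/subsetP=> z; apply: contraR => Az.
  by apply/eqP/cycle_perm_out; apply: contra Az => /sA.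
have comm s (Us : uniq s) g : {subset s <= A} -> size s <= m ->
    g \in G -> cycle_perm Us * g * (cycle_perm Us)^-1 \in G -> commute (cycle_perm Us) g.
  move=> sA sm Gg Gx; apply: (commute_small_support sVA pr_p abV regV (U := [set z in s])) => //.
  - by apply/subsetP=> z; rewrite inE; apply: sA.
  - by rewrite inE; apply/subsetP=> z; apply: contraR; rewrite inE => /cycle_perm_out->.
  - apply: leq_trans ltA _; rewrite leq_mul2l; apply/orP; right.
    by rewrite leq_sub2l // leq_double cardsE (leq_trans (card_size _)).
  - exact: (subsetP nVG).
  - exact: GA.
  - exact: (subsetP nVG).
(* Two cycles suffice; the last 1 only pads the tuple to the four entries of [rigid_base4]. *)
pose x := tnth [tuple 1; cycle_perm U1; cycle_perm U2; 1].
apply: (rigid_base4 (x := x)).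
- exact: subsetIl.
- exact: card_even_sym.
- case=> -[|[|[|[|//]]]] i4; rewrite /x (tnth_nth 1) /= inE ?group1 // Alt_even.
    by rewrite cycA // cycle_perm_even ?z1.
  by rewrite cycA // cycle_perm_even ?z2.
move=> g Ag Kx.
have Gg : g \in G by have := Kx ord0; rewrite /x (tnth_nth 1) /= mul1g invg1 mulg1.
have cg1 : commute (cycle_perm U1) g.
  apply: comm => //; first by rewrite z1.
  by have := Kx (Ordinal (isT : 1 < 4)); rewrite /x (tnth_nth 1).
have cg2 : commute (cycle_perm U2) g.
  apply: comm => //; first by rewrite z2.
  by have := Kx (Ordinal (isT : 2 < 4)); rewrite /x (tnth_nth 1).
have movg s (Us : uniq s) z : 1 < size s -> commute (cycle_perm Us) g -> z \in s -> g z \in s.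
  move=> sz cg; rewrite -!(cycle_perm_moved Us) // -permM -cg permM.
  by rewrite (inj_eq perm_inj).
have gc : g c = c.
  by apply: c12; [apply: (movg _ U1) | apply: (movg _ U2)]; rewrite ?z1 ?z2 // ltnW.
have fixL z : z \in L -> g z = z.
  case/L12/orP; first exact: (cycle_perm_commute cg1 c1 gc).
  exact: (cycle_perm_commute cg2 c2 gc).
have gx0 : g x0 = x0 by apply: fixL; rewrite mem_undup mem_head.
have nVg := subsetP nVG g Gg.
apply: (regular_on_conj regV Ax0 nVg Ag gx0) => v Vv; apply/conjg_fixP/commgP.
have : g \in 'C(B).
  apply/centP=> w Bw; have Vw := BV w Bw.
  have e : g (w x0) = w x0.
    by apply: fixL; rewrite mem_undup inE map_f ?orbT // mem_enum.
  apply/commute_sym/commgP/conjg_fixP; apply/eqP; rewrite eq_mulgV1; apply/eqP.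
  apply: (regV.2 x0) => //; first by rewrite groupM ?groupV ?memJ_norm.
  have e2 : (w ^ g) x0 = w x0 by rewrite -{1}gx0 -permM -conjgC permM e.
  by rewrite permM e2 permK.
by rewrite -cent_gen gB => /centP/(_ v Vv).
Qed.

(** In the excluded degrees 5, 7, 8 and 9 the last inequality fails already for m = 3. Since p >= 2,
    it follows from 4 m < p ^ d ([suff4]). *)
Lemma affine_cycle_length p d : prime p -> 5 <= p ^ d -> (p ^ d)%N \notin [:: 5; 7; 8; 9] ->
  exists m, [/\ odd m, 3 <= m, d <= m.+1 & p ^ d < p * (p ^ d - m.*2)].
Proof.
move=> pr_p; have p1 := prime_gt1 pr_p.
have suff4 m : 4 * m < p ^ d -> p ^ d < p * (p ^ d - m.*2).
  move=> ltN; apply: (@leq_trans (2 * (p ^ d - m.*2))); last by rewrite leq_mul2r p1 orbT.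
  by rewrite mulnBr ltn_subRL [(2 * p ^ d)%N]mul2n -[(p ^ d).*2%N]addnn ltn_add2r -[m.*2]mul2n mulnA.
case: d suff4 => [|[|[|[|[|d]]]]] suff4 //.
- rewrite expn1 => p5 np; exists 3; split=> //.
  have p11 : 11 <= p.
    by case: p pr_p p5 np {suff4 p1} => [|[|[|[|[|[|[|[|[|[|[|p]]]]]]]]]]].
  by rewrite -{1}[p]muln1 ltn_mul2l (ltnW p1) ltn_subRL (leq_trans _ p11).
- move=> p5 np; exists 3; split=> //; apply: suff4.
  case: p pr_p p1 p5 np => [|[|[|[|[|p]]]]] //= _ _ _ _.
  by apply: (@leq_trans (5 ^ 2)) => //; rewrite leq_exp2r.
- move=> p5 np; exists 3; split=> //; apply: suff4.
  case: p pr_p p1 p5 np => [|[|[|p]]] //= _ _ _ _.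
  by apply: (@leq_trans (3 ^ 3)) => //; rewrite leq_exp2r.
- move=> p5 np; exists 3; split=> //; apply: suff4.
  by apply: (@leq_trans (2 ^ 4)) => //; rewrite leq_exp2r.
(* The original exponent is d + 5; m is the odd one among it and its predecessor. *)
move=> _ _; exists (if odd d then d.+4 else d.+4.+1); split.
- by case: ifP => /= od; rewrite ?negbK ?od.
- by case: ifP.
- by case: ifP.
apply: suff4; apply: (@leq_ltn_trans (4 * d.+4.+1)); first by rewrite leq_mul2l; case: ifP => /=.
apply: (@leq_trans (2 ^ d.+4.+1)); last by rewrite leq_exp2r.
elim: d => // d IHd; rewrite expnS.
apply: (@leq_ltn_trans (2 * (4 * d.+4.+1))); last by rewrite ltn_mul2l.
by rewrite mulnCA leq_mul2l /= mul2n -addnn -[d.+4.+2]addn1 leq_add2l.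
Qed.

(** * Affine groups of degrees 5, 7, 8 and 9 *)

(* Unlike [all], stops at the first failure under call-by-value. *)
Fixpoint lazy_all (T : Type) (f : T -> bool) s :=
  if s is x :: s' then if f x then lazy_all f s' else false else true.

Lemma lazy_allE (T : Type) (f : T -> bool) s : lazy_all f s = all f s.
Proof. by elim: s => //= x s ->; case: (f x). Qed.

Section AffineTable.

Variables (n p d : nat) (gens : seq nat).
Local Notation pts := (iota 0 n.+1).

(* Points are the numbers below p ^ d, read in base p as vectors of F_p^d; affine_op i j k is i - j + k. *)
Definition digit t i := (i %/ p ^ t) %% p.

Definition affine_op i j k :=
  sumn [seq ((digit t i + (p - digit t j) + digit t k) %% p * p ^ t)%N | t <- iota 0 d].

(* The affine permutations of F_p^d, characterised by preservation of i - j + k. *)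
Definition affine_perms : {set 'S_n.+1} :=
  [set q : 'S_n.+1 | [forall i : 'I_n.+1, forall j : 'I_n.+1, forall k : 'I_n.+1, forall l : 'I_n.+1,
    (val l == affine_op i j k) ==> (val (q l) == affine_op (q i) (q j) (q k))]].

Lemma affine_permsP (q : 'S_n.+1) :
  reflect (forall i j k l : 'I_n.+1, val l = affine_op i j k -> val (q l) = affine_op (q i) (q j) (q k))
    (q \in affine_perms).
Proof.
rewrite inE; apply: (iffP forallP) => [qP i j k l e|qP i].
  move: (qP i) => /forallP/(_ j)/forallP/(_ k)/forallP/(_ l)/implyP.
  by rewrite e eqxx => /(_ isT)/eqP.
apply/forallP=> j; apply/forallP=> k; apply/forallP=> l.
by apply/implyP=> /eqP/qP->.
Qed.

Lemma affine_perms_group_set : group_set affine_perms.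
Proof.
apply/group_setP; split; first by apply/affine_permsP=> i j k l; rewrite !perm1.
move=> q r /affine_permsP qP /affine_permsP rP; apply/affine_permsP=> i j k l /qP/rP.
by rewrite !permM.
Qed.
Canonical affine_perms_group := Group affine_perms_group_set.

(* gens lists a frame of F_p^d, whose first member is 0; the values cs of an affine map on the frame determine its table of values, computed by affine_table. *)
Definition base_of i := last 0 [seq g <- gens | g <= i].

Fixpoint affine_table cs m := if m is m'.+1 then
    let l := affine_table cs m' in
    rcons l (if m' \in gens then nth 0 cs (index m' gens)
             else affine_op (nth 0 l (m' - base_of m')) (nth 0 l 0) (nth 0 l (base_of m')))
  else [::].

(** Every point off the frame is the sum of two smaller points, so [affine_table] can be filled in
    increasing order. *)
Definition gens_ok := all (fun i => (i \in gens) ||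
  [&& base_of i < i, i - base_of i < i & affine_op (i - base_of i) 0 (base_of i) == i]) pts.

Lemma affine_tableE F : gens_ok ->
    (forall i j k l, i <= n -> j <= n -> k <= n -> l <= n ->
      l = affine_op i j k -> F l = affine_op (F i) (F j) (F k)) ->
  affine_table [seq F g | g <- gens] n.+1 = [seq F i | i <- pts].
Proof.
move=> /allP gP FP; have : n.+1 <= n.+1 by [].
elim: {1 3 4}n.+1 => // m IHm mn; rewrite -[in RHS]addn1 iotaD map_cat cats1 /= add0n.
rewrite IHm 1?ltnW //; congr rcons.
have := gP m; rewrite mem_iota /= => /(_ mn) /orP[gm|/and3P[b1 b2 /eqP b3]].
  by rewrite gm (nth_map 0) ?nth_index ?index_mem.
case: ifP => [gm|_]; first by rewrite (nth_map 0) ?nth_index ?index_mem.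
have m0 : 0 < m by apply: leq_ltn_trans b1.
rewrite !(nth_map 0) ?size_iota // !nth_iota // !add0n.
apply/esym/FP => //; first exact: leq_trans (ltnW b2) _.
exact: leq_trans (ltnW b1) _.
Qed.

Definition swap a b z : nat := if z == a then b else if z == b then a else z.

(** From the table l of g, the table of t * g * t^-1 for the 3-cycle [cycle3 t]. *)
Definition conj_table (t : nat * nat * nat) l :=
  let: (a, b, c) := t in
  [seq swap a b (swap b c (nth 0 l (swap b c (swap a b z)))) | z <- pts].

(** A cheap necessary condition for being affine, on sums with a frame vector only; [base_check]
    verifies that it is strong enough. *)
Definition affine_test l :=
  lazy_all (fun i => lazy_all (fun k => (n < affine_op i 0 k) ||
    (nth 0 l (affine_op i 0 k) == affine_op (nth 0 l i) (nth 0 l 0) (nth 0 l k))) gens) pts.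

Fixpoint lists m := if m is m'.+1 then [seq c :: l | c <- pts, l <- lists m']
  else [:: [::]].

(** Runs through all images of the frame, hence all affine maps. Nested conditionals replace boolean
    conjunction, whose second argument call by value would always evaluate. *)
Definition base_check ts := all (fun cs => let l := affine_table cs n.+1 in
  if uniq l then if lazy_all (fun t => affine_test (conj_table t l)) ts then l == pts
  else true else true)
  (lists (size gens)).

Lemma base_checkP ts cs l : base_check ts -> cs \in lists (size gens) ->
  affine_table cs n.+1 = l -> uniq l -> all (fun t => affine_test (conj_table t l)) ts ->
  l = pts.
Proof.
move=> /allP/(_ cs) bc /bc {}bc el Ul; rewrite -lazy_allE => tl; apply/eqP.
by move: bc; rewrite el /= Ul tl.
Qed.

Definition triple_ok (t : nat * nat * nat) :=
  let: (a, b, c) := t in [&& a <= n, b <= n, c <= n, a != b & b != c].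

Definition cycle3 (t : nat * nat * nat) : 'S_n.+1 :=
  let: (a, b, c) := t in tperm (inord a) (inord b) * tperm (inord b) (inord c).

Lemma mem_lists m l : size l = m -> (forall x, x \in l -> x <= n) -> l \in lists m.
Proof.
elim: m l => [|m IHm] [|c l] // [sl] lP.
have -> : lists m.+1 = [seq c :: l | c <- pts, l <- lists m] by [].
apply: allpairs_f; first by rewrite mem_iota /= ltnS lP ?mem_head.
by apply: IHm => // x lx; apply: lP; rewrite inE lx orbT.
Qed.

Lemma rigid_affine_table t1 t2 t3 : 4 <= n -> all (fun g => g <= n) gens ->
    gens_ok -> all triple_ok [:: t1; t2; t3] -> base_check [:: t1; t2; t3] ->
  rigid (even_sym [set: 'I_n.+1]) (Sym [set: 'I_n.+1]) affine_perms.
Proof.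
move=> n4 gn gok tok bc.
have inordE a b : a <= n -> b <= n -> (inord a == inord b :> 'I_n.+1) = (a == b).
  by move=> an bn; rewrite -val_eqE /= !inordK.
have tpermE a b (z : 'I_n.+1) : a <= n -> b <= n ->
    val (tperm (inord a) (inord b) z) = swap a b z.
  have nz c : z <> inord c -> (val z == c) = false by apply: contra_notF => /eqP <-; rewrite inord_val.
  move=> an bn; rewrite /swap; case: tpermP => [->|->|/nz-> /nz-> //]; rewrite !inordK // eqxx //.
    exact: inordK.
  by rewrite [LHS]inordK //; have [->|_] := eqVneq b a.
have cycE t (z : 'I_n.+1) : triple_ok t -> val (cycle3 t z) =
   let: (a, b, c) := t in swap b c (swap a b z).
  by case: t => [[a b] c] /and5P[an bn cn _ _]; rewrite /= permM !tpermE.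
have cycVE t (z : 'I_n.+1) : triple_ok t -> val ((cycle3 t)^-1 z) =
   let: (a, b, c) := t in swap a b (swap b c z).
  by case: t => [[a b] c] /and5P[an bn cn _ _]; rewrite /= invMg !tpermV permM !tpermE.
have evc t : triple_ok t -> cycle3 t = false :> bool.
  by case: t => [[a b] c] /and5P[an bn cn ab bc']; rewrite odd_permM !odd_tperm !inordE // ab bc'.
have [k1 k2 k3] : [/\ triple_ok t1, triple_ok t2 & triple_ok t3] by case/and4P: tok.
pose x := tnth [tuple 1; cycle3 t1; cycle3 t2; cycle3 t3].
apply: (rigid_base4 (x := x)).
- exact: subsetIl.
- by apply: card_even_sym; rewrite cardsT card_ord.
- have Ec t : triple_ok t -> cycle3 t \in even_sym setT.
    by move=> tk; apply/setIP; split; [exact: Sym_setT | rewrite Alt_even evc].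
  case=> -[|[|[|[|//]]]] i4; rewrite /x (tnth_nth 1) /=; [exact: group1 | | |]; exact: Ec.
move=> g _ Kx; pose F z := val (g (inord z)).
have Kg : g \in affine_perms by have := Kx ord0; rewrite /x (tnth_nth 1) /= mul1g invg1 mulg1.
have Fn z : F z <= n by rewrite -ltnS ltn_ord.
have tabE : affine_table [seq F g | g <- gens] n.+1 = [seq F i | i <- pts].
  apply: affine_tableE => // i j k l *; rewrite /F.
  by apply: (affine_permsP _ Kg); rewrite /= !inordK.
have nthF z : z <= n -> nth 0 [seq F i | i <- pts] z = F z.
  by move=> zn; rewrite (nth_map 0) ?size_iota // nth_iota.
have testP t : triple_ok t -> cycle3 t * g * (cycle3 t)^-1 \in affine_perms ->
    affine_test (conj_table t [seq F i | i <- pts]).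
  move=> tk /affine_permsP qP.
  have nthC z : z <= n -> nth 0 (conj_table t [seq F i | i <- pts]) z =
      val ((cycle3 t * g * (cycle3 t)^-1) (inord z)).
    move=> zn; rewrite !permM cycVE //; have := cycE t (inord z) tk.
    case: t tk {qP} => [[a b] c] tk ec.
    rewrite /conj_table (nth_map 0) ?size_iota // nth_iota // add0n.
    have sn : swap b c (swap a b z) <= n by rewrite -[z in swap a b z](@inordK n) // -ec -ltnS ltn_ord.
    by rewrite nthF // /F; congr (swap _ _ (swap _ _ (val (g _)))); apply: val_inj; rewrite /= ec !inordK.
  rewrite /affine_test lazy_allE; apply/allP=> i; rewrite mem_iota add0n => /andP[_ ii].
  rewrite lazy_allE; apply/allP=> k gk.
  have kn := allP gn k gk.
  have [//|tn] /= := ltnP n (affine_op i 0 k); rewrite !nthC //.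
  by apply/eqP/qP; rewrite /= !inordK.
have ePts : [seq F i | i <- pts] = pts.
  apply: (base_checkP bc _ tabE).
  - by apply: mem_lists => [|_ /mapP[z _ ->]] //; rewrite size_map.
  - rewrite map_inj_in_uniq ?iota_uniq // => y z; rewrite !mem_iota !add0n /= => yn zn /val_inj/perm_inj/eqP.
    by rewrite inordE // => /eqP.
  rewrite /= !testP //.
  + by have := Kx (Ordinal (isT : 3 < 4)); rewrite /x (tnth_nth 1).
  + by have := Kx (Ordinal (isT : 2 < 4)); rewrite /x (tnth_nth 1).
  + by have := Kx (Ordinal (isT : 1 < 4)); rewrite /x (tnth_nth 1).
apply/permP=> z; rewrite perm1; apply: val_inj.
have zn : z <= n by rewrite -ltnS.
by have := nthF z zn; rewrite ePts nth_iota // add0n /F inord_val => /esym.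
Qed.

End AffineTable.

(* The 3-cycles were found by a computer search. *)
Lemma base_check5 : base_check 4 5 1 [:: 0; 1]%N [:: (4, 1, 0); (4, 0, 1); (0, 2, 3)]%N.
Proof. by vm_compute. Qed.
Lemma base_check7 : base_check 6 7 1 [:: 0; 1]%N [:: (1, 0, 6); (4, 6, 0); (6, 5, 0)]%N.
Proof. by vm_compute. Qed.
Lemma base_check8 : base_check 7 2 3 [:: 0; 1; 2; 4]%N [:: (1, 5, 3); (6, 7, 3); (0, 6, 3)]%N.
Proof. by vm_compute. Qed.
Lemma base_check9 : base_check 8 3 2 [:: 0; 1; 3]%N [:: (1, 2, 7); (5, 1, 6); (7, 5, 8)]%N.
Proof. by vm_compute. Qed.

(* dec labels the elements of gT by numbers, so that affine_op computes i - j + k in gT. *)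
Definition decode_ok (gT : finGroupType) n p d (dec : nat -> gT) :=
  uniq [seq dec i | i <- iota 0 n.+1] &&
  all (fun i => all (fun j => all (fun k => (affine_op p d i j k <= n) &&
    (dec (affine_op p d i j k) == dec i * (dec j)^-1 * dec k))
    (iota 0 n.+1)) (iota 0 n.+1)) (iota 0 n.+1).

Lemma rigid_affine_label (T : finType) (A : {set T}) (G V : {group {perm T}})
    (gT : finGroupType) n p d (dec : nat -> gT) :
    G \subset Sym A -> V <| G -> p.-abelem V -> regular_on A V -> #|A| = n.+1 ->
    prime p -> p.-abelem [set: gT] -> #|gT| = n.+1 -> decode_ok n p d dec ->
    rigid (even_sym [set: 'I_n.+1]) (Sym [set: 'I_n.+1]) (affine_perms n p d) ->
  rigid (even_sym A) (Sym A) G.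
Proof.
move=> sGA /andP[sVG nVG] abV regV oA pr_p abT oT /andP[Udec /allP decP] rig.
have [x0 Ax0] : exists x, x \in A by apply/card_gt0P; rewrite oA.
have GA g : g \in G -> g \in Sym A by apply: (subsetP sGA).
have sVA := subset_trans sVG sGA.
have [trV freeV] := regV.
have oV : #|V| = #|A| by apply: card_regular => //; apply/set0Pn; exists x0.
have /isogP[f injf imf] : [set: gT] \isog V.
  by rewrite (isog_abelem_card _ abT) abV oV oA cardsT oT eqxx.
have fI x y : f x = f y -> x = y by apply: (injmP injf); rewrite inE.
have Vf x : f x \in V by rewrite -imf mem_morphim ?inE.
have injV v w : v \in V -> w \in V -> v x0 = w x0 -> v = w.
  move=> Vv Vw e; apply/eqP; rewrite eq_mulgV1; apply/eqP.
  by apply: (freeV x0) => //; rewrite ?groupM ?groupV // permM e permK.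
have dec_inj i j : i <= n -> j <= n -> dec i = dec j -> i = j.
  move=> li lj eij; have := nth_uniq 1 (i := i) (j := j) _ _ Udec.
  rewrite size_map size_iota !(nth_map 0) ?size_iota // !nth_iota // !add0n eij eqxx.
  by move=> /(_ li lj)/esym/eqP.
have decE i j k : i <= n -> j <= n -> k <= n -> affine_op p d i j k <= n /\
    dec (affine_op p d i j k) = dec i * (dec j)^-1 * dec k.
  move=> li lj lk; have mi m : m <= n -> m \in iota 0 n.+1 by rewrite mem_iota.
  by have /allP/(_ j (mi _ lj))/allP/(_ k (mi _ lk))/andP[-> /eqP] := decP i (mi _ li).
pose e (i : 'I_n.+1) := f (dec i) x0.
have ord_le (i : 'I_n.+1) : i <= n by rewrite -ltnS.
have inj_e : injective e.
  move=> i j /injV eij; apply/val_inj/dec_inj; try exact: ord_le.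
  by apply: fI; apply: eij.
have imA : e @: setT = A.
  apply/eqP; rewrite eqEcard card_imset // cardsT card_ord oA leqnn andbT.
  by apply/subsetP=> _ /imsetP[i _ ->]; rewrite Sym_closed // (subsetP sVA).
rewrite -imA; apply: (rigid_transport inj_e _ rig) => g q Gg gq.
have nVg := subsetP nVG g Gg.
(* w is the translation part of g: on V, g acts as conjugation followed by multiplication by w,
   which is affine. *)
have [w Vw ew] : exists2 w, w \in V & w x0 = g x0.
  by apply: trV => //; rewrite Sym_closed ?GA.
have fq i : f (dec (q i)) = w * f (dec i) ^ g.
  apply: injV; rewrite ?Vf // 1?groupMl ?memJ_norm ?Vf //.
  by have := gq i; rewrite /e => <-; rewrite -permM conjgC !permM ew.
apply/affine_permsP=> i j k l el; have [_ dl] := decE i j k (ord_le i) (ord_le j) (ord_le k).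
have [lq dq] := decE (q i) (q j) (q k) (ord_le _) (ord_le _) (ord_le _).
apply: dec_inj; try exact: ord_le; first exact: lq.
apply: fI; rewrite fq -[nat_of_ord l]/(val l) el dl dq.
rewrite !morphM ?morphV ?inE // !fq !conjMg conjVg.
move: (f (dec i) ^ g) (f (dec j) ^ g) (f (dec k) ^ g) => a b c.
by rewrite invMg !mulgA mulgKV.
Qed.

Lemma abelem_Zp p : prime p.+1 -> p.+1.-abelem [set: 'I_p.+1].
Proof.
move=> pr_p; rewrite abelemE //; apply/andP; split.
  by apply/centsP=> x _ y _; apply: Zp_mulgC.
by apply/exponentP=> x _; have := expg_cardG (in_setT x); rewrite cardsT card_ord.
Qed.

Lemma abelem_pair p (gT hT : finGroupType) : prime p ->
  p.-abelem [set: gT] -> p.-abelem [set: hT] -> p.-abelem [set: gT * hT].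
Proof.
move=> pr_p; rewrite !abelemE // => /andP[/centsP cG /exponentP eG] /andP[/centsP cH /exponentP eH].
apply/andP; split.
  apply/centsP=> -[x y] _ [x' y'] _; rewrite /commute -[LHS]/(x * x', y * y') -[RHS]/(x' * x, y' * y).
  by rewrite (cG x) ?(cH y) ?inE.
apply/exponentP=> -[x y] _; have -> m : (x, y) ^+ m = (x ^+ m, y ^+ m).
  by elim: m => // m IHm; rewrite !expgS IHm.
by rewrite eG ?eH ?inE.
Qed.

Lemma rigid_affine_small (T : finType) (A : {set T}) (G V : {group {perm T}}) :
    G \subset Sym A -> V <| G -> is_abelem V -> regular_on A V ->
    #|A| \in [:: 5; 7; 8; 9] ->
  rigid (even_sym A) (Sym A) G.
Proof.
move=> sGA nsVG /is_abelemP[p pr_p abV] regV oA.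
have sVA := subset_trans (normal_sub nsVG) sGA.
have oV : #|V| = #|A| by apply: card_regular => //; rewrite -card_gt0; move: oA; case: #|A|.
have pA : p.-nat #|A| by rewrite -oV; apply: abelem_pgroup abV.
have pP q : prime q -> q %| #|A| -> p = q.
  by move=> pr_q dq; apply/esym/eqP; have := pnat_dvd dq pA; rewrite (pnatE _ pr_q).
move: oA; rewrite !inE => /or4P[] /eqP oA.
- have ep := pP 5 isT ltac:(by rewrite oA); rewrite {}ep in abV.
  have dk : decode_ok 4 5 1 (fun i => inZp (digit 5 0 i) : 'I_5) by vm_compute.
  have gk : gens_ok 4 5 1 [:: 0; 1]%N by vm_compute.
  have rig := rigid_affine_table (isT : 4 <= 4) _ gk _ base_check5.
  exact: (rigid_affine_label sGA nsVG abV regV oA isT (@abelem_Zp 4 isT) (card_ord 5) dk (rig isT isT)).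
- have ep := pP 7 isT ltac:(by rewrite oA); rewrite {}ep in abV.
  have dk : decode_ok 6 7 1 (fun i => inZp (digit 7 0 i) : 'I_7) by vm_compute.
  have gk : gens_ok 6 7 1 [:: 0; 1]%N by vm_compute.
  have rig := rigid_affine_table (isT : 4 <= 6) _ gk _ base_check7.
  exact: (rigid_affine_label sGA nsVG abV regV oA isT (@abelem_Zp 6 isT) (card_ord 7) dk (rig isT isT)).
- have ep := pP 2 isT ltac:(by rewrite oA); rewrite {}ep in abV.
  pose dec i : 'I_2 * 'I_2 * 'I_2 :=
    (inZp (digit 2 0 i), inZp (digit 2 1 i), inZp (digit 2 2 i)).
  have dk : decode_ok 7 2 3 dec by vm_compute.
  have gk : gens_ok 7 2 3 [:: 0; 1; 2; 4]%N by vm_compute.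
  have rig := rigid_affine_table (isT : 4 <= 7) _ gk _ base_check8.
  have ab2 := @abelem_Zp 1 isT.
  have ab8 := abelem_pair (isT : prime 2) (abelem_pair (isT : prime 2) ab2 ab2) ab2.
  have oT : #|{: 'I_2 * 'I_2 * 'I_2}| = 8 by rewrite !card_prod !card_ord.
  exact: (rigid_affine_label sGA nsVG abV regV oA isT ab8 oT dk (rig isT isT)).
have ep := pP 3 isT ltac:(by rewrite oA); rewrite {}ep in abV.
pose dec i : 'I_3 * 'I_3 := (inZp (digit 3 0 i), inZp (digit 3 1 i)).
have dk : decode_ok 8 3 2 dec by vm_compute.
have gk : gens_ok 8 3 2 [:: 0; 1; 3]%N by vm_compute.
have rig := rigid_affine_table (isT : 4 <= 8) _ gk _ base_check9.
have ab3 := @abelem_Zp 2 isT.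
have ab9 := abelem_pair (isT : prime 3) ab3 ab3.
have oT : #|{: 'I_3 * 'I_3}| = 9 by rewrite !card_prod !card_ord.
exact: (rigid_affine_label sGA nsVG abV regV oA isT ab9 oT dk (rig isT isT)).
Qed.

(** * Solvable subgroups of the symmetric group *)

Theorem solvable_rigid (T : finType) (A : {set T}) (G : {group {perm T}}) :
  G \subset Sym A -> solvable G -> 5 <= #|A| -> rigid (even_sym A) (Sym A) G.
Proof.
have [n leAn] := ubnP #|A|.
elim: n A G leAn => // n IHn A G leAn sGA solG A5.
have GA g : g \in G -> g \in Sym A by apply: (subsetP sGA).
have IH (B : {set T}) : #|B| < #|A| -> 5 <= #|B| ->
    rigid (even_sym B) (Sym B) (restr_group B G).
  move=> ltBA B5; apply: IHn => //; first exact: leq_trans ltBA leAn.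
    exact: restr_group_Sym.
  exact: restr_group_sol.
have A1 : 1 < #|A| by apply: leq_trans A5.
have [[B sBA [/andP[B0 ltBA] GB]]|[P sysP [P1 cardP]]|[V nsVG [abV regV]]]
    := solvable_trichotomy sGA solG A1.
(* D will be B or its complement, whichever has at most four points. *)
- have small (D : {set T}) : D \subset A -> 0 < #|D| < #|A| -> #|D| <= 4 ->
      (forall g, g \in G -> g @: D = D) -> rigid (even_sym A) (Sym A) G.
    move=> sDA /andP[D0 ltDA] D4 GD.
    have cA : #|A :\: D| = (#|A| - #|D|)%N by rewrite cardsD (setIidPr sDA).
    have ltA : #|A :\: D| < #|A| by rewrite cA ltn_subrL D0 ltnW.
    have C0 : 0 < #|A :\: D| by rewrite cA subn_gt0.
    have [C5|C4] := leqP 5 #|A :\: D|; last first.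
      by apply: (rigid_small sDA sGA GD) => //; rewrite ?D0 ?C0.
    have [D1|D1] := leqP #|D| 1; last first.
      apply: (rigid_small_big sDA sGA GD); rewrite ?D1 //; last exact: IH.
      by rewrite -card_gt0.
    (* D is a single point, fixed by G, so the induction hypothesis applies to G itself on the other
       points. *)
    have sGC : G \subset Sym (A :\: D).
      apply/subsetP=> g Gg; rewrite inE; apply/subsetP=> x; rewrite inE => gx.
      have Ax : x \in A by apply: contraR gx => /(Sym_out (GA g Gg))->.
      rewrite inE Ax andbT; apply: contra gx => Dx; apply/eqP.
      by apply: (card_le1_eqP D1) => //; rewrite -(GD g Gg) imset_f.
    apply: (rigid_sub (subsetDl A D) sGC); apply: IHn => //.
    exact: leq_trans ltA leAn.
  have [B5|B4] := leqP 5 #|B|; last by apply: (small B) => //; rewrite B0.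
  have cA : #|A :\: B| = (#|A| - #|B|)%N by rewrite cardsD (setIidPr sBA).
  have ltA : #|A :\: B| < #|A| by rewrite cA ltn_subrL B0 ltnW.
  have [C5|C4] := leqP 5 #|A :\: B|.
    by apply: (rigid_prod sBA sGA GB); apply: IH.
  apply: (small (A :\: B)) => //; first exact: subsetDl.
    by rewrite ltA cA subn_gt0 ltBA.
  by move=> g Gg; rewrite imset_setD ?GB // Sym_imset // GA.
- have [partP actP trP] := sysP.
  have [B PB] : exists B, B \in P by apply/card_gt0P/ltnW.
  have /andP[B1 ltBA] := cardP B PB.
  have [B5|B4] := leqP 5 #|B|.
    by apply: (rigid_wreath sGA solG sysP PB); apply: IH.
  apply: (rigid_small_blocks sGA sysP (a := #|B|)); rewrite ?B1 // => C PC.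
  by have [g _ <-] := trP B C PB PC; rewrite card_imset //; apply: perm_inj.
have [small|large] := boolP (#|A| \in [:: 5; 7; 8; 9]).
  exact: (rigid_affine_small sGA nsVG abV regV small).
have [p pr_p abVp] := is_abelemP abV.
have oV : #|V| = #|A|.
  by apply: card_regular => //; [exact: subset_trans (normal_sub nsVG) sGA | rewrite -card_gt0 ltnW].
have oA : #|A| = (p ^ logn p #|A|)%N by rewrite -oV -(card_pgroup (abelem_pgroup abVp)).
have [||m [om m3 dm ltm]] := affine_cycle_length (d := logn p #|A|) pr_p; rewrite -?oA //.
by apply: (rigid_affine (m := m) sGA nsVG pr_p abVp regV) => //; rewrite {1 2}oA.
Qed.

(** * The socle of an almost simple group *)

Section InnerAut.

Variables (rT : finGroupType) (T : {group rT}).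

Lemma conj_autJ x a : x \in T -> a \in Aut T -> conj_aut T x ^ a = conj_aut T (a x).
Proof.
move=> Tx Aa; have Tax : a x \in T by rewrite (Aut_closed Aa).
have Ac y : y \in T -> conj_aut T y \in Aut T.
  by move=> Ty; apply: (subsetP (Aut_conj_aut T T)); rewrite mem_morphim // (subsetP (normG T)).
apply: (eq_Aut (A := T)); rewrite ?groupJ ?Ac // => y Ty.
rewrite -[y](permKV a) permJ permKV.
have Tay : a^-1 y \in T by rewrite (Aut_closed (groupVr Aa)).
rewrite !conj_autE ?permKV // -[y in RHS](permKV a) -!(autmE Aa) -morphJ //.
Qed.

Lemma inner_aut_normal : inner_aut T \subset Aut T /\ Aut T \subset 'N(inner_aut T).
Proof.
split; first exact: Aut_conj_aut.
apply/subsetP=> a Aa; rewrite inE; apply/subsetP=> _ /imsetP[_ /morphimP[x Nx Tx ->] ->].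
rewrite conj_autJ // mem_morphim ?(Aut_closed Aa) //.
by rewrite (subsetP (normG T)) ?(Aut_closed Aa).
Qed.

Hypotheses (simT : simple T) (nabT : ~~ abelian T).

Lemma simple_center1 : 'Z(T) = 1.
Proof.
have [_ /(_ _ (center_normal T)) [//|ZT]] := simpleP _ simT.
by case/negP: nabT; rewrite abelianE -{1}ZT subsetIr.
Qed.

Lemma injm_conj_aut : 'ker_T (conj_aut T) = 1.
Proof. by rewrite ker_conj_aut; apply: simple_center1. Qed.

(** If a commutes with conjugation by x, then x and a x induce the same inner automorphism and
    differ by an element of the trivial centre. *)
Lemma cent_inner_aut : 'C_(Aut T)(inner_aut T) = 1.
Proof.
apply/trivgP/subsetP=> a /setIP[Aa /centP ca]; rewrite inE; apply/eqP.
apply: (eq_Aut Aa (group1 _)) => x Tx; rewrite perm1.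
have Tax : a x \in T by rewrite (Aut_closed Aa).
have NT := subsetP (normG T).
have cx : conj_aut T x ^ a = conj_aut T x.
  by apply/conjg_fixP/commgP/commute_sym/ca; rewrite mem_morphim ?NT.
rewrite conj_autJ // in cx.
have : a x * x^-1 \in 'ker_T (conj_aut T).
  rewrite inE groupM ?groupV //=; apply/kerP; rewrite ?groupM ?groupV ?NT //.
  by rewrite morphM ?groupV ?NT // morphV ?NT // /= cx mulgV.
by rewrite injm_conj_aut inE -eq_mulgV1 => /eqP.
Qed.

Lemma inner_aut_isog : T \isog inner_aut T.
Proof.
have sTN := normG T.
apply/isogP; exists (restrm_morphism sTN (conj_aut_morphism T)).
  by rewrite ker_restrm injm_conj_aut.
by rewrite morphim_restrm setIid.
Qed.

End InnerAut.

(** The copy M of [inner_aut T] is normal and simple with trivial centraliser. A minimal normal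
    subgroup meeting M trivially would centralise it, so M is the only one. *)
Lemma almost_simple_socle (gT : finGroupType) (S : {group gT}) : almost_simple S ->
  [/\ simple (socle S), socle S <| S & 'C_S(socle S) = 1].
Proof.
move=> [rT [T [A [simT nabT sTA sAT /isogP[f injf imf]]]]].
have [_ nTA] := inner_aut_normal T.
pose I := [group of conj_aut T @* T].
have sIA : I \subset f @* S by rewrite imf.
pose M := (f @*^-1 I)%G.
have sMS : M \subset S by apply: subsetIl.
have fM : f @* M = I by apply: morphpreK.
have isoM : M \isog I by rewrite -fM; apply: sub_isog.
have simM : simple M by rewrite (isog_simple isoM) -(isog_simple (inner_aut_isog simT nabT)).
have nsM : M <| S.
  rewrite -(injm_normal injf) // imf fM; apply/andP; split=> //.
  exact: subset_trans sAT nTA.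
have cM : 'C_S(M) = 1.
  apply/trivgP; rewrite -(injmSK injf) ?subsetIl // morphim1.
  rewrite injm_subcent // imf fM -(cent_inner_aut simT nabT) setSI //.
have [ntM simPM] := simpleP _ simM.
have minM : minnormal M S.
  apply/mingroupP; split=> [|N /andP[ntN nNS] sNM]; first by rewrite ntM normal_norm.
  have nsN : N <| M by rewrite /normal sNM (subset_trans sMS).
  by case: (simPM N nsN) => // N1; rewrite N1 eqxx in ntN.
have socM : socle S = M.
  apply/eqP; rewrite eqEsubset; apply/andP; split; last first.
    by apply: sub_gen; apply: (bigcup_sup M); rewrite sMS.
  rewrite gen_subG; apply/bigcupsP=> N /andP[sNS minN].
  have /mingroupP[/andP[ntN nNS] minPN] := minN.
  have nsI : N :&: M <| S by rewrite normalI // /normal sNS.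
  have [I1|IM] := simPM (N :&: M)%G (normalS (subsetIr _ _) sMS nsI).
    case/negP: ntN; rewrite -subG1 -cM subsetI sNS /=.
    apply/commG1P/trivgP; rewrite -I1 commg_subI // subsetI ?subxx //.
      by rewrite (subset_trans sNS) // normal_norm.
    by rewrite (subset_trans sMS).
  have sMN : M \subset N by rewrite -IM subsetIl.
  by rewrite -(minPN M) ?subxx // ntM normal_norm.
by rewrite socM.
Qed.

(** * Three-cycles and automorphisms of alternating groups *)

Section Simulation.

Variables (T : finType) (x0 : T) (l : seq T).
Hypothesis Ul : uniq l.

(* p acts on the sequence l as f acts on indices. *)
Definition simulates (p : {perm T}) (f : nat -> nat) :=
  forall i, i < size l -> f i < size l /\ p (nth x0 l i) = nth x0 l (f i).

Lemma simulatesM p q f g :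
  simulates p f -> simulates q g -> simulates (p * q) (fun i => g (f i)).
Proof.
move=> sp sq i li; have [lf pf] := sp i li; have [lg qg] := sq _ lf.
by rewrite permM pf.
Qed.

Lemma simulatesX p f m : simulates p f -> simulates (p ^+ m) (iter m f).
Proof.
move=> sp; elim: m => [|m IHm] i li; first by rewrite perm1.
have [lf pf] := IHm i li; have [lg qg] := sp _ lf.
by rewrite expgSr permM pf.
Qed.

Lemma simulates_tperm a b : a < size l -> b < size l ->
  simulates (tperm (nth x0 l a) (nth x0 l b)) (swap a b).
Proof.
move=> la lb i li; rewrite /swap; have [->|ia] := eqVneq i a; first by rewrite tpermL.
have [->|ib] := eqVneq i b; first by rewrite tpermR.
by rewrite tpermD // nth_uniq // eq_sym.
Qed.

Lemma simulates_eq1 p f : simulates p f -> (forall x, x \notin l -> p x = x) ->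
  all (fun i => f i == i) (iota 0 (size l)) -> p = 1.
Proof.
move=> sp pout /allP fi; apply/permP=> x; rewrite perm1.
have [lx|/pout//] := boolP (x \in l).
have ix : index x l < size l by rewrite index_mem.
have [_] := sp _ ix; rewrite nth_index // => ->.
by rewrite (eqP (fi _ _)) ?mem_iota // nth_index.
Qed.

End Simulation.

(** The left factor acts first, so this is the cycle u -> v -> w -> u. *)
Definition cyc3 (T : finType) (u v w : T) := tperm u v * tperm u w.

Definition is_cyc3 (T : finType) (c : {perm T}) :=
  exists u v w, uniq [:: u; v; w] /\ c = cyc3 u v w.

Section Cyc3.

Variable T : finType.
Implicit Types (u v w x : T) (c b : {perm T}).

Lemma cyc3_out u v w x : x \notin [:: u; v; w] -> cyc3 u v w x = x.
Proof.
by rewrite !inE !negb_or => /and3P[xu xv xw]; rewrite permM !tpermD // eq_sym.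
Qed.

Lemma cyc3_1 u v w : uniq [:: u; v; w] -> cyc3 u v w u = v.
Proof.
rewrite /= !inE !negb_or !andbT => /andP[/andP[uv uw] vw].
by rewrite permM tpermL tpermD // eq_sym.
Qed.

Lemma cyc3_2 u v w : uniq [:: u; v; w] -> cyc3 u v w v = w.
Proof. by move=> _; rewrite permM tpermR tpermL. Qed.

Lemma cyc3_3 u v w : uniq [:: u; v; w] -> cyc3 u v w w = u.
Proof.
rewrite /= !inE !negb_or !andbT => /andP[/andP[uv uw] vw].
by rewrite permM [tperm u v w]tpermD // tpermR.
Qed.

Lemma uniq_rot3 u v w : uniq [:: u; v; w] = uniq [:: v; w; u].
Proof. by rewrite -(rot_uniq 1). Qed.

Lemma cyc3_rot u v w : uniq [:: u; v; w] -> cyc3 u v w = cyc3 v w u.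
Proof.
move=> U; have U' : uniq [:: v; w; u] by rewrite -uniq_rot3.
apply/permP=> x; have [|out] := boolP (x \in [:: u; v; w]); last first.
  by rewrite !cyc3_out //; move: out; rewrite !inE !negb_or => /and3P[-> -> ->].
rewrite !inE => /or3P[] /eqP->.
- by rewrite cyc3_1 // cyc3_3.
- by rewrite cyc3_2 // cyc3_1.
by rewrite cyc3_3 // cyc3_2.
Qed.

Lemma cyc3J u v w (s : {perm T}) : cyc3 u v w ^ s = cyc3 (s u) (s v) (s w).
Proof. by rewrite conjMg !tpermJ. Qed.

Lemma is_cyc3J c (s : {perm T}) : is_cyc3 c -> is_cyc3 (c ^ s).
Proof.
move=> [u [v [w [U ->]]]]; exists (s u), (s v), (s w); split; last exact: cyc3J.
by rewrite -[X in uniq X]/(map s [:: u; v; w]) map_inj_uniq //; apply: perm_inj.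
Qed.

Lemma cyc3_even u v w : uniq [:: u; v; w] -> cyc3 u v w \in 'Alt_T.
Proof.
rewrite Alt_even /= !inE !negb_or !andbT => /andP[/andP[uv uw] vw].
by rewrite odd_permM !odd_tperm uv uw.
Qed.

Lemma is_cyc3_Alt c : is_cyc3 c -> c \in 'Alt_T.
Proof. by move=> [u [v [w [U ->]]]]; apply: cyc3_even. Qed.

Lemma cyc3_sim (l : seq T) x0 (i j k : nat) : uniq l -> i < size l -> j < size l -> k < size l ->
  simulates x0 l (cyc3 (nth x0 l i) (nth x0 l j) (nth x0 l k)) (fun a => swap i k (swap i j a)).
Proof. by move=> Ul li lj lk; apply: simulatesM; apply: simulates_tperm. Qed.

(** A common arc u -> v, opposite arcs, one common point, none. In the first two cases w and x may
    coincide. *)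
Variant cyc3_pair_spec b c : Prop :=
  | Cyc3Same u v w x of uniq [:: u; v; w] & uniq [:: u; v; x] & b = cyc3 u v w & c = cyc3 u v x
  | Cyc3Opp u v w x of uniq [:: u; v; w] & uniq [:: v; u; x] & b = cyc3 u v w & c = cyc3 v u x
  | Cyc3Meet u v w x y of uniq [:: u; v; w; x; y] & b = cyc3 u v w & c = cyc3 u x y
  | Cyc3Disj u v w x y z of uniq [:: u; v; w; x; y; z] & b = cyc3 u v w & c = cyc3 x y z.

Lemma cyc3_pairP b c : is_cyc3 b -> is_cyc3 c -> cyc3_pair_spec b c.
Proof.
move=> [u [v [w [U ->]]]] [x [y [z [V ->]]]].
have rot2 u' v' w' : uniq [:: u'; v'; w'] -> cyc3 u' v' w' = cyc3 w' u' v'.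
  by move=> U'; rewrite [RHS]cyc3_rot // uniq_rot3.
have meet u' v' w' x' y' : uniq [:: u'; v'; w'] -> uniq [:: u'; x'; y'] ->
    cyc3_pair_spec (cyc3 u' v' w') (cyc3 u' x' y').
  clear => U V; have U1 := U; have V1 := V; rewrite uniq_rot3 in U1; rewrite uniq_rot3 in V1.
  have U2 := U1; have V2 := V1; rewrite uniq_rot3 in U2; rewrite uniq_rot3 in V2.
  have [xv|xv] := eqVneq x' v'.
    by rewrite xv in V *; apply: Cyc3Same U V _ _.
  have [yw|yw] := eqVneq y' w'.
    rewrite -(cyc3_rot U2) -(cyc3_rot V2); rewrite yw in V2 *.
    by apply: Cyc3Same U2 V2 _ _.
  have [xw|xw] := eqVneq x' w'.
    rewrite -(cyc3_rot U2); rewrite xw in V *.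
    by apply: (@Cyc3Opp _ _ w' u' v' y').
  have [yv|yv] := eqVneq y' v'.
    rewrite -(cyc3_rot V2); rewrite yv in V2 *.
    by apply: (@Cyc3Opp _ _ u' v' w' x').
  apply: Cyc3Meet; [|by []|by []].
  move: U V; rewrite /= !inE !negb_or !andbT => /andP[/andP[-> ->] ->] /andP[/andP[-> ->] ->].
  by rewrite !(eq_sym v') !(eq_sym w') xv xw yv yw.
have [|] := boolP (has (mem [:: x; y; z]) [:: u; v; w]); last first.
  move=> /hasPn dis; apply: Cyc3Disj; [|by []|by []].
  by rewrite -[_ :: _]/([:: u; v; w] ++ [:: x; y; z]) cat_uniq U V andbT has_sym; apply/hasPn.
case/hasP=> t tb tc.
have [v1 [w1 [U1 ->]]] : exists v1 w1, uniq [:: t; v1; w1] /\ cyc3 u v w = cyc3 t v1 w1.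
  move: tb; rewrite !inE => /or3P[] /eqP->.
  - by exists v, w.
  - by exists w, u; rewrite -uniq_rot3; split=> //; apply: cyc3_rot.
  - by exists u, v; rewrite uniq_rot3; split=> //; apply: rot2.
have [v2 [w2 [U2 ->]]] : exists v1 w1, uniq [:: t; v1; w1] /\ cyc3 x y z = cyc3 t v1 w1.
  move: tc; rewrite !inE => /or3P[] /eqP->.
  - by exists y, z.
  - by exists z, x; rewrite -uniq_rot3; split=> //; apply: cyc3_rot.
  - by exists x, y; rewrite uniq_rot3; split=> //; apply: rot2.
exact: meet.
Qed.

Lemma uniq4 u v w x : uniq [:: u; v; w] -> uniq [:: u; v; x] -> x != w -> uniq [:: u; v; w; x].
Proof.
rewrite /= !inE !negb_or !andbT => /andP[/andP[-> ->] ->] /andP[/andP[_ ->] ->].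
by rewrite eq_sym.
Qed.

Lemma uniq_swap u v w : uniq [:: u; v; w] -> uniq [:: v; u; w].
Proof.
rewrite /= !inE !negb_or !andbT => /andP[/andP[uv ->] ->].
by rewrite eq_sym uv.
Qed.

Definition cyc3_check m n i j k i' j' k' :=
  all (fun a => iter m (fun a => swap i' k' (swap i' j' (swap i k (swap i j a)))) a == a)
    (iota 0 n).

Lemma cyc3_mulX m u v w (x y z : T) (l : seq T) (i j k i' j' k' : nat) :
    uniq l -> [&& i < size l, j < size l, k < size l, i' < size l, j' < size l & k' < size l] ->
    nth u l i = u -> nth u l j = v -> nth u l k = w ->
    nth u l i' = x -> nth u l j' = y -> nth u l k' = z ->
    cyc3_check m (size l) i j k i' j' k' ->
  (cyc3 u v w * cyc3 x y z) ^+ m = 1.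
Proof.
move=> Ul /and5P[li lj lk li' /andP[lj' lk']] ei ej ek ei' ej' ek' chk.
have lm a z' : a < size l -> nth u l a = z' -> z' \in l by move=> la <-; apply: mem_nth.
have lu := lm _ _ li ei; have lv := lm _ _ lj ej; have lw := lm _ _ lk ek.
have lx := lm _ _ li' ei'; have ly := lm _ _ lj' ej'; have lz := lm _ _ lk' ek'.
have sb := cyc3_sim u Ul li lj lk; have sc := cyc3_sim u Ul li' lj' lk'.
rewrite ei ej ek in sb; rewrite ei' ej' ek' in sc.
apply: (simulates_eq1 (simulatesX m (simulatesM sb sc))) => [t nt|]; last exact: chk.
have out (a1 a2 a3 : T) : a1 \in l -> a2 \in l -> a3 \in l -> cyc3 a1 a2 a3 t = t.
  move=> l1 l2 l3; rewrite cyc3_out // !inE !negb_or.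
  by rewrite !(contraNneq _ nt) // => ->.
have f1 : (cyc3 u v w * cyc3 x y z) t = t by rewrite permM !out.
by elim: (m) => [|m' IHm]; rewrite ?perm1 // expgSr permM IHm.
Qed.

(* The product of two 3-cycles has cycles of length at most 5. *)
Lemma cyc3_mul_order b c : is_cyc3 b -> is_cyc3 c -> (b * c) ^+ 30 = 1.
Proof.
(* The product has order 1, 2, 3 or 5, and 30 is the least common multiple. *)
move=> b3 c3; have key := @cyc3_mulX 30.
case: (cyc3_pairP b3 c3) => [u v w x U V -> ->|u v w x U V -> ->|u v w x y U -> ->|u v w x y z U -> ->].
- have [->|xw] := eqVneq x w.
    apply: (key _ _ _ _ _ _ [:: u; v; w] 0%N 1%N 2%N 0%N 1%N 2%N U isT erefl erefl erefl erefl erefl erefl); vm_cast_no_check isT.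
  have U4 := uniq4 U V xw.
  apply: (key _ _ _ _ _ _ [:: u; v; w; x] 0%N 1%N 2%N 0%N 1%N 3%N U4 isT erefl erefl erefl erefl erefl erefl); vm_cast_no_check isT.
- have [->|xw] := eqVneq x w.
    apply: (key _ _ _ _ _ _ [:: u; v; w] 0%N 1%N 2%N 1%N 0%N 2%N U isT erefl erefl erefl erefl erefl erefl); vm_cast_no_check isT.
  have U4 := uniq4 U (uniq_swap V) xw.
  apply: (key _ _ _ _ _ _ [:: u; v; w; x] 0%N 1%N 2%N 1%N 0%N 3%N U4 isT erefl erefl erefl erefl erefl erefl); vm_cast_no_check isT.
- apply: (key _ _ _ _ _ _ [:: u; v; w; x; y] 0%N 1%N 2%N 0%N 3%N 4%N U isT erefl erefl erefl erefl erefl erefl); vm_cast_no_check isT.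
apply: (key _ _ _ _ _ _ [:: u; v; w; x; y; z] 0%N 1%N 2%N 3%N 4%N 5%N U isT erefl erefl erefl erefl erefl erefl); vm_cast_no_check isT.
Qed.

(** Detects a common arc by a relation that automorphisms preserve. In the other configurations the
    square of the product moves an explicit point. *)
Lemma cyc3_mul_invol b c : is_cyc3 b -> is_cyc3 c -> b != c -> b * c != 1 ->
    (b * c) ^+ 2 = 1 ->
  exists u v w x, [/\ uniq [:: u; v; w; x], b = cyc3 u v w & c = cyc3 u v x].
Proof.
move=> b3 c3 nbc bc1 bc2; have bcK x : c (b (c (b x))) = x.
  by move: (congr1 (fun p : {perm T} => p x) bc2); rewrite expgS expg1 !permM perm1.
case: (cyc3_pairP b3 c3) => [u v w x U V eb ec|u v w x U V eb ec|u v w x y U eb ec|u v w x y z U eb ec].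
- exists u, v, w, x; split=> //; apply: uniq4 => //.
  by apply: contraNneq nbc => xw; rewrite eb ec xw.
- have [xw|xw] := eqVneq x w.
    have ec' : c = cyc3 u w v by rewrite ec (cyc3_rot V) xw.
    case/negP: bc1; rewrite eb ec'; apply/eqP/permP=> t; rewrite perm1 permM.
    have V' : uniq [:: u; w; v] by move: V; rewrite xw uniq_rot3.
    have [|out] := boolP (t \in [:: u; v; w]); last first.
      by rewrite !cyc3_out //; move: out; rewrite !inE !negb_or => /and3P[-> -> ->].
    rewrite !inE => /or3P[] /eqP->.
    - by rewrite cyc3_1 // cyc3_3.
    - by rewrite cyc3_2 // cyc3_2.
    by rewrite cyc3_3 // cyc3_1.
  have := uniq4 U (uniq_swap V) xw.
  rewrite /= !inE !negb_or => /and4P[/and3P[uv uw ux] /andP[vw vx] _ _].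
  have := bcK v; rewrite eb ec (cyc3_2 U) (@cyc3_out v u x w) ?(cyc3_3 U) ?(cyc3_2 V); last first.
    by rewrite !inE !negb_or ![w == _]eq_sym vw uw xw.
  by move=> e; rewrite e eqxx in vx.
- move: (U); rewrite /= !inE !negb_or => /and5P[/and4P[uv uw ux uy] /and3P[vw vx vy] /andP[wx wy] xy _].
  have U1 : uniq [:: u; v; w] by rewrite /= !inE !negb_or uv uw vw.
  have := bcK u; rewrite eb ec (cyc3_1 U1) (@cyc3_out u x y v); last first.
    by rewrite !inE !negb_or vx vy eq_sym uv.
  rewrite (cyc3_2 U1) cyc3_out; last by rewrite !inE !negb_or wx wy eq_sym uw.
  by move=> e; rewrite e eqxx in uw.
move: (U); rewrite /= !inE !negb_or => /and5P[/and5P[uv uw ux uy uz] /and4P[vw vx vy vz] /and3P[wx wy wz] _ _].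
have U1 : uniq [:: u; v; w] by rewrite /= !inE !negb_or uv uw vw.
have := bcK u; rewrite eb ec (cyc3_1 U1) (@cyc3_out x y z v); last first.
  by rewrite !inE !negb_or vx vy vz.
rewrite (cyc3_2 U1) cyc3_out; last by rewrite !inE !negb_or wx wy wz.
by move=> e; rewrite e eqxx in uw.
Qed.

(** Transpositions at u generate the symmetric group, and modulo H each of them can be traded for t
    = (u v); so p or p * t lies in H according to the parity of p. *)
Lemma cyc3_gen u v (H : {group {perm T}}) : u != v ->
  (forall w, w != u -> w != v -> cyc3 u v w \in H) -> 'Alt_T \subset H.
Proof.
move=> uv Hw; pose t := tperm u v.
have t2 : t * t = 1 by apply: tperm2.
have st x : x != u -> tperm u x * t \in H /\ t * tperm u x \in H.
  move=> xu; have [->|xv] := eqVneq x v; first by rewrite t2 group1.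
  have Hx := Hw x xu xv; split=> //; rewrite -groupV invMg !tpermV; exact: Hx.
pose Q (p : {perm T}) := if odd_perm p then p * t \in H else p \in H.
have QM p x : x != u -> Q p -> Q (p * tperm u x).
  move=> xu; have [st1 st2] := st x xu.
  rewrite /Q odd_permM odd_tperm eq_sym xu addbT; case: odd_perm => /= Hp.
    by rewrite -[p](mulgK t) tpermV -mulgA groupM.
  by rewrite -mulgA groupM.
have Qall p : Q p.
  have : p \in <<[set tperm u y | y in T]>> by rewrite gen_tperm inE.
  case/gen_prodgP=> m [c Pc ->]; elim: m c Pc => [|m IHm] c Pc.
    by rewrite big_ord0 /Q odd_perm1 group1.
  rewrite big_ord_recr /=; have /imsetP[y _ ->] := Pc ord_max.
  have Qm : Q (\prod_(i < m) c (widen_ord (leqnSn m) i)) by apply: IHm => i; apply: Pc.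
  have [->|yu] := eqVneq y u; last exact: QM.
  by rewrite tperm1 mulg1.
by apply/subsetP=> p; rewrite Alt_even => /negbTE ep; have := Qall p; rewrite /Q ep.
Qed.

End Cyc3.

Section AltAut.

Variable T : finType.
Implicit Types (u v w x : T) (c b : {perm T}).

Lemma cyc3_same_sq u v w x : uniq [:: u; v; w; x] -> (cyc3 u v w * cyc3 u v x) ^+ 2 = 1.
Proof.
move=> U; apply: (@cyc3_mulX _ 2 _ _ _ _ _ _ [:: u; v; w; x] 0%N 1%N 2%N 0%N 1%N 3%N U isT
  erefl erefl erefl erefl erefl erefl); vm_cast_no_check isT.
Qed.

Lemma cyc3_order3 u v w : uniq [:: u; v; w] -> cyc3 u v w ^+ 3 = 1.
Proof.
move=> U; have sim := cyc3_sim u U (isT : 0 < 3) (isT : 1 < 3) (isT : 2 < 3).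
apply: (simulates_eq1 (simulatesX 3 sim)) => [t nt|]; last by vm_cast_no_check isT.
have f1 : cyc3 u v w t = t by apply: cyc3_out.
by elim: 3 => [|m IHm]; rewrite ?perm1 // expgSr permM IHm.
Qed.

Lemma cyc3_arc b u v : is_cyc3 b -> b u = v -> u != v ->
  uniq [:: u; v; b v] /\ b = cyc3 u v (b v).
Proof.
move=> [x [y [z [U ->]]]] buv uv.
have U1 := U; rewrite uniq_rot3 in U1; have U2 := U1; rewrite uniq_rot3 in U2.
have : u \in [:: x; y; z] by apply: contraR uv => /cyc3_out e; rewrite -buv e.
rewrite !inE => /or3P[] /eqP eu; rewrite -{}buv {}eu.
- by rewrite cyc3_1 // cyc3_2.
- by rewrite cyc3_2 // cyc3_3 //; split=> //; apply: cyc3_rot.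
by rewrite cyc3_3 // cyc3_1 //; split=> //; rewrite -cyc3_rot.
Qed.

Lemma cyc3_mul_invol_arc b c : is_cyc3 b -> is_cyc3 c -> b != c -> b * c != 1 ->
    (b * c) ^+ 2 = 1 ->
  exists u, [/\ b u != u, c u = b u & c (b (b u)) = b (b u)].
Proof.
move=> b3 c3 bc bc1 bc2; have [u [v [w [x [U eb ec]]]]] := cyc3_mul_invol b3 c3 bc bc1 bc2.
have := U; rewrite /= !inE !negb_or => /and4P[/and3P[uv uw ux] /andP[vw vx] wx _].
have U1 : uniq [:: u; v; w] by rewrite /= !inE !negb_or uv uw vw.
have U2 : uniq [:: u; v; x] by rewrite /= !inE !negb_or uv ux vx.
exists u; rewrite eb ec cyc3_1 // cyc3_2 // cyc3_1 //; split=> //; first by rewrite eq_sym.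
by apply: cyc3_out; rewrite !inE !negb_or ![w == _]eq_sym uw vw eq_sym wx.
Qed.

Lemma is_cyc3_dec c : is_cyc3 c \/ ~ is_cyc3 c.
Proof.
pose P := [exists u : T, exists v : T, exists w : T, uniq [:: u; v; w] && (c == cyc3 u v w)].
have [Pc|nPc] := boolP P; [left | right].
  have /existsP[u /existsP[v /existsP[w /andP[U /eqP ec]]]] := Pc.
  by exists u, v, w.
move=> [u [v [w [U ec]]]]; case/negP: nPc.
by apply/existsP; exists u; apply/existsP; exists v; apply/existsP; exists w; rewrite U ec eqxx.
Qed.

Lemma order3_cycle (y : {perm T}) u : y ^+ 3 = 1 -> y u != u ->
  uniq [:: u; y u; y (y u)] /\ y (y (y u)) = u.
Proof.
move=> y3 yu; have e : y (y (y u)) = u.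
  by move: (congr1 (fun p : {perm T} => p u) y3); rewrite !expgS expg0 mulg1 !permM perm1.
split=> //; rewrite /= !inE !negb_or !andbT (inj_eq perm_inj) ![u == y _]eq_sym yu ?andbT /=.
by apply: contra yu => /eqP e2; rewrite -{2}e e2.
Qed.

Lemma mem_cycle3 (y : {perm T}) u x : y (y (y u)) = u ->
  (y x \in [:: u; y u; y (y u)]) = (x \in [:: u; y u; y (y u)]).
Proof. by move=> eu; rewrite !inE -{1}eu !(inj_eq perm_inj) orbC -orbA. Qed.

Lemma order3_ncyc3 (y : {perm T}) : y ^+ 3 = 1 -> y != 1 -> ~ is_cyc3 y ->
  exists u v, [/\ uniq [:: u; y u; y (y u); v; y v; y (y v)], y (y (y u)) = u & y (y (y v)) = v].
Proof.
move=> y3 y1 ncyc; have [u yu] : exists u, y u != u.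
  apply/existsP; apply: contraR y1; rewrite negb_exists => /forallP y1.
  by apply/eqP/permP=> x; rewrite perm1; apply/eqP; rewrite -[_ == _]negbK.
have [U eu] := order3_cycle y3 yu.
have [v nv yv] : exists2 v, v \notin [:: u; y u; y (y u)] & y v != v.
  apply/exists_inP; apply: contra_notT ncyc; rewrite negb_exists_in => /forall_inP h.
  exists u, (y u), (y (y u)); split=> //; apply/permP=> x.
  have [|out] := boolP (x \in [:: u; y u; y (y u)]); last first.
    by rewrite cyc3_out //; apply/eqP; rewrite -[_ == _]negbK h.
  by rewrite !inE => /or3P[] /eqP->; rewrite ?cyc3_1 ?cyc3_2 ?cyc3_3.
have [V ev] := order3_cycle y3 yv; exists u, v; split=> //.
have yl := mem_cycle3 _ eu.
rewrite -[_ :: _]/([:: u; y u; y (y u)] ++ [:: v; y v; y (y v)]) cat_uniq U V andbT /=.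
by rewrite !yl (negPf nv).
Qed.

(* Conjugating y by a product of two transpositions, one joining two cycles of y and one using a further point e, gives a product with a cycle of length 7 or 9. *)
Lemma ncyc3_mul_order (y : {perm T}) : y ^+ 3 = 1 -> y != 1 -> ~ is_cyc3 y -> #|T| > 4 -> #|T| != 6 ->
  exists2 s : {perm T}, s \in 'Alt_T & (y * y ^ s) ^+ 30 != 1.
Proof.
move=> y3 y1 ncyc T4 T6; have [u [v [U eu ev]]] := order3_ncyc3 y3 y1 ncyc.
set l6 := [:: _; _; _; _; _; _] in U.
have [e ne] : exists e, e \notin l6.
  have ltl : #|l6| < #|T|.
    rewrite ltn_neqAle max_card andbT; apply: contra T6 => /eqP <-.
    by rewrite (card_uniqP U).
  have := cardC (mem l6); rewrite -[X in _ + X = _](eq_card (A := [predC l6])) //.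
  move=> oC; have : 0 < #|[predC l6]| by rewrite -(ltn_add2l #|l6|) addn0 oC.
  by case/card_gt0P=> e; rewrite inE; exists e.
have Ue : uniq (rcons l6 e) by rewrite rcons_uniq ne.
pose s := tperm u v * tperm (y u) e; exists s.
  rewrite Alt_even odd_permM !odd_tperm.
  have -> : u != v by apply: contraTneq U => uv; rewrite /l6 -uv /= !inE eqxx !orbT.
  by have -> : y u != e by apply: contraNneq ne => <-; rewrite /l6 !inE eqxx !orbT.
(* t is the table of y on l; the check says that 30 iterations of the product do not bring u, at
   position 0, back to itself. *)
have main (l : seq T) (t : seq nat) : uniq l -> size t = size l -> 6 < size l ->
    nth u l 0 = u -> nth u l 1%N = y u -> nth u l 3 = v -> nth u l 6 = e ->
    (forall i, i < size l -> nth 0 t i < size l /\ y (nth u l i) = nth u l (nth 0 t i)) ->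
    iter 30 (fun a => swap 1%N 6 (swap 0 3 (nth 0 t (swap 0 3 (swap 1%N 6 (nth 0 t a)))))) 0 \in iota 1%N (size l).-1 ->
    (y * y ^ s) ^+ 30 != 1.
  move=> Ul st l7 e0 e1 e3 e6 sy chk.
  have l3 : 3 < size l by apply: ltn_trans l7. have l1 : 1%N < size l by apply: ltn_trans l7.
  have l0 : 0 < size l by apply: ltn_trans l7.
  have sa := simulates_tperm u Ul l0 l3; have sb := simulates_tperm u Ul l1 l7.
  rewrite e0 e3 in sa; rewrite e1 e6 in sb.
  have sq := simulatesX 30 (simulatesM sy (simulatesM (simulatesM sb sa) (simulatesM sy (simulatesM sa sb)))).
  have [q1 q2] := sq 0 l0; apply: contraTneq chk => h.
  have h' : (y * (tperm (y u) e * tperm u v * (y * (tperm u v * tperm (y u) e)))) ^+ 30 = 1.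
    by rewrite -[RHS]h conjgE invMg !tpermV.
  rewrite h' perm1 in q2; move/eqP: q2; rewrite nth_uniq // => /eqP <-.
  by rewrite mem_iota.
(* Either y fixes e and seven points are enough, or e starts a third cycle of y and nine are
   needed. *)
have [ye|ye] := eqVneq (y e) e.
  apply: (main (rcons l6 e) [:: 1; 2; 0; 4; 5; 3; 6]%N Ue erefl isT erefl erefl erefl erefl).
    by case=> [|[|[|[|[|[|[|i]]]]]]] lti //; split=> //=; rewrite ?eu ?ev ?ye.
  by vm_cast_no_check isT.
have [E ee] := order3_cycle y3 ye.
have U9 : uniq (l6 ++ [:: e; y e; y (y e)]).
  have yl x : (y x \in l6) = (x \in l6).
    rewrite -[l6]/([:: u; y u; y (y u)] ++ [:: v; y v; y (y v)]) !mem_cat.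
    by rewrite !mem_cycle3.
  by rewrite cat_uniq U E andbT /= !yl (negPf ne).
apply: (main _ [:: 1; 2; 0; 4; 5; 3; 7; 8; 6]%N U9 erefl isT erefl erefl erefl erefl).
  by case=> [|[|[|[|[|[|[|[|[|i]]]]]]]]] lti //; split=> //=; rewrite ?eu ?ev ?ee.
by vm_cast_no_check isT.
Qed.

Variable phi : {perm T} -> {perm T}.
Hypothesis phiA : forall p, p \in 'Alt_T -> phi p \in 'Alt_T.
Hypothesis phiM : forall p q, p \in 'Alt_T -> q \in 'Alt_T -> phi (p * q) = phi p * phi q.
Hypothesis phi_inj : {in 'Alt_T &, injective phi}.

Lemma alt_endo1 : phi 1 = 1.
Proof. by apply: (mulgI (phi 1)); rewrite -phiM ?group1 // !mulg1. Qed.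

Lemma alt_endoX p m : p \in 'Alt_T -> phi (p ^+ m) = phi p ^+ m.
Proof.
move=> Ap; elim: m => [|m IHm]; first exact: alt_endo1.
by rewrite !expgS phiM ?groupX // IHm.
Qed.

Lemma alt_endo_eq1 p : p \in 'Alt_T -> phi p = 1 -> p = 1.
Proof. by move=> Ap e; apply: phi_inj; rewrite ?group1 // alt_endo1. Qed.

Lemma alt_endo_onto p : p \in 'Alt_T -> exists2 q, q \in 'Alt_T & p = phi q.
Proof.
have im : phi @: 'Alt_T = 'Alt_T :> {set _}.
  apply/eqP; rewrite eqEcard card_in_imset // leqnn andbT.
  by apply/subsetP=> _ /imsetP[q Aq ->]; apply: phiA.
by rewrite -{1}im => /imsetP[q Aq ->]; exists q.
Qed.

(* The 3-cycles (u v w) through a fixed arc u -> v are mapped to 3-cycles having pairwise products of order 2, hence sharing an arc al -> be; the third point of the image of (u v w) is the image of w under the sought permutation. *)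
Lemma alt_endo_induced : 4 < #|T| -> (forall c, is_cyc3 c -> is_cyc3 (phi c)) ->
  exists s : {perm T}, forall p, p \in 'Alt_T -> phi p = p ^ s.
Proof.
move=> T5 phi3.
have [u [v [w1 [w2 U]]]] : exists u v w1 w2 : T, uniq [:: u; v; w1; w2].
  have : size (enum T) > 4 by rewrite -cardE.
  have := enum_uniq T; case: (enum T) => [|u [|v [|w1 [|w2 l]]]] //= U _.
  exists u, v, w1, w2; move: U; rewrite /= !inE !negb_or.
  by move=> /and5P[/and4P[-> -> -> _] /and3P[-> -> _] /andP[-> _] _ _].
move: (U); rewrite /= !inE !negb_or => /and4P[/and3P[uv uw1 uw2] /andP[vw1 vw2] w12 _].
pose c w := cyc3 u v w; pose b w := phi (c w).
have Uw w : w != u -> w != v -> uniq [:: u; v; w].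
  by move=> wu wv; rewrite /= !inE !negb_or uv ![_ == w]eq_sym wu wv.
have Ac w : w != u -> w != v -> c w \in 'Alt_T by move=> wu wv; apply/cyc3_even/Uw.
have b3 w : w != u -> w != v -> is_cyc3 (b w).
  by move=> wu wv; apply: phi3; exists u, v, w; split=> //; apply: Uw.
have b_inj w x : w != u -> w != v -> x != u -> x != v -> b w = b x -> w = x.
  move=> wu wv xu xv /phi_inj e; have := congr1 (fun p : {perm T} => p v) (e (Ac _ wu wv) (Ac _ xu xv)).
  by rewrite !cyc3_2 ?Uw.
have arc w x : w != u -> w != v -> x != u -> x != v -> w != x ->
    exists y, [/\ b w y != y, b x y = b w y & b x (b w (b w y)) = b w (b w y)].
  move=> wu wv xu xv wx; apply: cyc3_mul_invol_arc; try exact: b3.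
  - by apply: contraNneq wx => /b_inj->.
  - apply/eqP; rewrite -phiM ?Ac // => /alt_endo_eq1 e.
    have := congr1 (fun p : {perm T} => p u) (e (groupM (Ac _ wu wv) (Ac _ xu xv))).
    rewrite permM perm1 cyc3_1 ?Uw // cyc3_2 ?Uw // => /eqP.
    by rewrite (negPf xu).
  rewrite -phiM ?Ac // -alt_endoX ?(groupM (Ac w wu wv) (Ac x xu xv)) // /c cyc3_same_sq ?alt_endo1 //.
  by apply: uniq4; rewrite ?Uw // eq_sym.
have [w1u w1v w2u w2v] : [/\ w1 != u, w1 != v, w2 != u & w2 != v] by rewrite ![_ == u]eq_sym ![_ == v]eq_sym.
have [al [be [ga [de [U4 e1 e2]]]]] : exists al be ga de, [/\ uniq [:: al; be; ga; de],
    b w1 = cyc3 al be ga & b w2 = cyc3 al be de].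
  have := @cyc3_mul_invol _ (b w1) (b w2) (b3 _ w1u w1v) (b3 _ w2u w2v).
  case.
  - by apply: contraNneq w12 => /b_inj->.
  - apply/eqP; rewrite -phiM ?Ac // => /alt_endo_eq1 e.
    have := congr1 (fun p : {perm T} => p u) (e (groupM (Ac _ w1u w1v) (Ac _ w2u w2v))).
    rewrite permM perm1 cyc3_1 ?Uw // cyc3_2 ?Uw // => /eqP.
    by rewrite (negPf w2u).
  - by rewrite -phiM ?Ac // -alt_endoX ?(groupM (Ac _ w1u w1v) (Ac _ w2u w2v)) // /c cyc3_same_sq ?alt_endo1.
  by move=> al [be [ga [de [U4 e1 e2]]]]; exists al, be, ga, de.
move: (U4); rewrite /= !inE !negb_or => /and4P[/and3P[ab ag ad] /andP[bg bd] gd _].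
have U1 : uniq [:: al; be; ga] by rewrite /= !inE !negb_or ab ag bg.
have U2 : uniq [:: al; be; de] by rewrite /= !inE !negb_or ab ad bd.
have E1 := (cyc3_1 U1, cyc3_2 U1, cyc3_3 U1); have E2 := (cyc3_1 U2, cyc3_2 U2, cyc3_3 U2).
have supp x y z t : cyc3 x y z t != t -> t \in [:: x; y; z].
  by apply: contraR => /cyc3_out->.
(* [b w] shares an arc with [b w1] and one with [b w2]. Were these not al -> be, [b w] would take
   two values at one point or one value at two points. *)
have bab w : w != u -> w != v -> b w al = be.
  move=> wu wv; have [->|nw1] := eqVneq w w1; first by rewrite e1 cyc3_1.
  have [->|nw2] := eqVneq w w2; first by rewrite e2 cyc3_1.
  have [y []] : exists y, [/\ b w1 y != y, b w y = b w1 y & b w (b w1 (b w1 y)) = b w1 (b w1 y)].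
    by apply: arc; rewrite // eq_sym.
  have [z []] : exists z, [/\ b w2 z != z, b w z = b w2 z & b w (b w2 (b w2 z)) = b w2 (b w2 z)].
    by apply: arc; rewrite // eq_sym.
  rewrite e1 e2 => /supp; rewrite !inE => zz fz gz /supp; rewrite !inE => yy fy gy.
  case/or3P: yy fy gy => /eqP->; rewrite ?E1 // => fy gy.
  - case/or3P: zz fz gz => /eqP->; rewrite ?E2 // => fz gz.
    + by move: gd; rewrite -fy fz eqxx.
    by move: ad; rewrite -(inj_eq (@perm_inj _ (b w))) gy fz eqxx.
  case/or3P: zz fz gz => /eqP->; rewrite ?E2 // => fz gz.
  + by move: bd; rewrite -fz gy eqxx.
  by move: gd; rewrite -(inj_eq (@perm_inj _ (b w))) fy fz eqxx.
pose s0 x := if x == u then al else if x == v then be else b x be.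
have bw w : w != u -> w != v -> uniq [:: al; be; b w be] /\ b w = cyc3 al be (b w be).
  by move=> wu wv; apply: cyc3_arc; rewrite ?bab //; apply: b3.
have inj_s0 : injective s0.
  have nab w : w != u -> w != v -> (b w be != al) && (b w be != be).
    move=> wu wv; have [Ub _] := bw w wu wv; move: Ub.
    by rewrite /= !inE !negb_or andbT => /andP[/andP[_ h1] h2]; rewrite ![b w be == _]eq_sym h1.
  move=> x y; rewrite /s0.
  have [->|xu] := eqVneq x u; have [->|yu] := eqVneq y u => //.
  - have [->|yv] := eqVneq y v; first by move=> e; rewrite e eqxx in ab.
    by move=> e; have := nab y yu yv; rewrite -e eqxx.
  - have [->|xv] := eqVneq x v; first by move=> e; rewrite e eqxx in ab.
    by move=> e; have := nab x xu xv; rewrite e eqxx.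
  have [->|xv] := eqVneq x v; have [->|yv] := eqVneq y v => //.
  - by move=> e; have := nab y yu yv; rewrite -e eqxx andbF.
  - by move=> e; have := nab x xu xv; rewrite e eqxx andbF.
  move=> e; apply: b_inj => //.
  by have [_ ->] := bw x xu xv; have [_ ->] := bw y yu yv; rewrite e.
pose s := perm inj_s0; exists s.
have Hs : group_set [set p in 'Alt_T | phi p == p ^ s].
  apply/group_setP; split; first by rewrite inE group1 alt_endo1 conj1g eqxx.
  move=> p q /setIdP[Ap /eqP ep] /setIdP[Aq /eqP eq].
  by rewrite inE groupM // phiM // ep eq conjMg eqxx.
have : 'Alt_T \subset Group Hs.
  apply: (cyc3_gen uv) => w wu wv; rewrite inE Ac //= cyc3J !permE /s0 !eqxx.
  rewrite [v == u]eq_sym (negPf uv) (negPf wu) (negPf wv).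
  by apply/eqP; have [_ {1}<-] := bw w wu wv.
by move=> sAH p Ap; have := subsetP sAH p Ap; rewrite inE => /andP[_ /eqP].
Qed.

(* Otherwise the image y of c and a suitable conjugate of y have a product whose order does not divide 30. *)
Lemma alt_endo_cyc3 c : 4 < #|T| -> #|T| != 6 -> is_cyc3 c -> is_cyc3 (phi c).
Proof.
move=> T4 T6 c3; have Ac := is_cyc3_Alt c3.
have y3 : phi c ^+ 3 = 1.
  rewrite -alt_endoX //; have [u [v [w [U ->]]]] := c3.
  by rewrite cyc3_order3 ?alt_endo1.
have y1 : phi c != 1.
  apply/eqP=> /(alt_endo_eq1 Ac) c1; have [u [v [w [U ec]]]] := c3.
  have := cyc3_1 U; rewrite -ec c1 perm1 => uv.
  by move: U; rewrite uv /= !inE eqxx.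
have [//|ncyc] := is_cyc3_dec (phi c).
have [s As sne] := ncyc3_mul_order y3 y1 ncyc T4 T6.
have [s' As' es] := alt_endo_onto As.
case/eqP: sne; have phiV : phi s'^-1 = s^-1.
  by apply: (mulgI s); rewrite mulgV {1}es -phiM ?groupV // mulgV alt_endo1.
have Acs : c ^ s' \in 'Alt_T by apply/is_cyc3_Alt/is_cyc3J.
have -> : phi c ^ s = phi (c ^ s').
  by rewrite !conjgE !phiM ?groupM ?groupV // phiV es.
by rewrite -phiM // -alt_endoX ?(groupM Ac Acs) // cyc3_mul_order ?alt_endo1 //; apply: is_cyc3J.
Qed.

End AltAut.

(** * Groups acting on an alternating normal subgroup *)

(** If s moved u, it would conjugate a 3-cycle through u that avoids s u to one that moves s u. *)
Lemma cent_Alt (T : finType) (s : {perm T}) : 3 < #|T| ->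
  (forall p, p \in 'Alt_T -> p ^ s = p) -> s = 1.
Proof.
move=> T4 cs; apply/permP=> u; rewrite perm1; apply/eqP; apply: contraT => su.
have : 1 < #|[set x : T | (x != u) && (x != s u)]|.
  have := cardsC [set u; s u]; rewrite cards2 eq_sym su => oC.
  rewrite -(ltn_add2l 2) -[X in _ < X]/(2 + _)%N; apply: leq_trans T4 _; rewrite -oC leq_add2l.
  by apply/subset_leq_card/subsetP=> x; rewrite !inE negb_or.
case/card_gt1P=> w [x []]; rewrite !inE => /andP[wu ws] /andP[xu xs] wx.
have U : uniq [:: u; w; x] by rewrite /= !inE !negb_or ![u == _]eq_sym wu xu wx.
have := congr1 (fun p : {perm T} => p (s u)) (cs _ (cyc3_even U)).
rewrite permJ cyc3_1 // cyc3_out; last by rewrite !inE !negb_or su ![s u == _]eq_sym ws xs.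
by move/perm_inj=> wu'; rewrite wu' eqxx in wu.
Qed.

Section Induced.

Variables (gT : finGroupType) (S N : {group gT}) (T : finType).
Variable f : {morphism N >-> {perm T}}.
Hypotheses (injf : 'injm f) (imf : f @* N = 'Alt_T) (nsN : N <| S).
Hypotheses (cN : 'C_S(N) = 1) (T4 : 4 < #|T|).

Let sNS : N \subset S := normal_sub nsN.
Let nNS : S \subset 'N(N) := normal_norm nsN.
Let fI : {in N &, injective f} := injmP injf.

Lemma normal_Alt x : x \in N -> f x \in 'Alt_T.
Proof. by move=> Nx; rewrite -imf mem_morphim. Qed.

Lemma Alt_normal p : p \in 'Alt_T -> exists2 x, x \in N & p = f x.
Proof. by rewrite -imf => /morphimP[x _ Nx ->]; exists x. Qed.

Lemma normal_memJ x s : s \in S -> (x ^ s \in N) = (x \in N).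
Proof. by move=> Ss; rewrite memJ_norm // (subsetP nNS). Qed.

(* Conjugation by s corresponds under f to conjugation by the permutation p. *)
Definition induces s (p : {perm T}) := [forall x in N, f (x ^ s) == f x ^ p].

Lemma inducesP s p : reflect (forall x, x \in N -> f (x ^ s) = f x ^ p) (induces s p).
Proof. by apply: (iffP forall_inP) => h x /h/eqP. Qed.

Lemma induces_inj s p q : induces s p -> induces s q -> p = q.
Proof.
move=> /inducesP sp /inducesP sq; apply/eqP; rewrite eq_mulgV1; apply/eqP.
apply: cent_Alt => [|_ /Alt_normal[x Nx ->]]; first exact: ltnW.
by rewrite conjgM -sp // sq // conjgK.
Qed.

Lemma inducesM s t p q : s \in S -> induces s p -> induces t q -> induces (s * t) (p * q).
Proof.
move=> Ss /inducesP sp /inducesP tq; apply/inducesP=> x Nx.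
by rewrite !conjgM tq ?normal_memJ // sp.
Qed.

Lemma induces1 : induces 1 1.
Proof. by apply/inducesP=> x _; rewrite !conjg1. Qed.

Lemma induces_self x : x \in N -> induces x (f x).
Proof. by move=> Nx; apply/inducesP=> y Ny; rewrite morphJ. Qed.

Lemma induces_eq1 s : s \in S -> induces s 1 -> s = 1.
Proof.
move=> Ss /inducesP s1; suff : s \in 'C_S(N) by rewrite cN => /set1P.
rewrite inE Ss; apply/centP=> x Nx; apply/commute_sym/commgP/conjg_fixP.
by apply: fI; rewrite ?normal_memJ // s1 // conjg1.
Qed.

(** The elements acting on N, read through f, as permutations of T; by [induced_neq6] they exhaust S
    unless T has six points. *)
Definition induced_set := [set s in S | [exists p, induces s p]].

Lemma induced_group_set : group_set induced_set.
Proof.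
apply/group_setP; split; first by rewrite inE group1; apply/existsP; exists 1; apply: induces1.
move=> s t /setIdP[Ss /existsP[p sp]] /setIdP[St /existsP[q tq]].
by rewrite inE groupM //; apply/existsP; exists (p * q); apply: inducesM.
Qed.
Canonical induced_group := Group induced_group_set.

Lemma sub_induced : N \subset induced_set.
Proof.
apply/subsetP=> x Nx; rewrite inE (subsetP sNS) //.
by apply/existsP; exists (f x); apply: induces_self.
Qed.

Definition induced_perm s : {perm T} := if [pick p | induces s p] is Some p then p else 1.

Lemma induced_permP s : s \in induced_set -> induces s (induced_perm s).
Proof.
case/setIdP=> _ /existsP[p sp]; rewrite /induced_perm; case: pickP => // /(_ p).
by rewrite sp.
Qed.

Lemma induced_permM : {in induced_set &, {morph induced_perm : s t / s * t}}.
Proof.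
move=> s t Is It; have Ist := groupM (Is : s \in induced_group) It.
apply: induces_inj (induced_permP Ist) _; apply: inducesM; rewrite ?induced_permP //.
by case/setIdP: Is.
Qed.
Canonical induced_perm_morphism := Morphism induced_permM.

Lemma induced_perm_id x : x \in N -> induced_perm x = f x.
Proof.
move=> Nx; apply: induces_inj (induced_permP _) (induces_self Nx).
exact: subsetP sub_induced _ Nx.
Qed.

Lemma induced_perm_eq1 s : s \in induced_set -> induced_perm s = 1 -> s = 1.
Proof.
move=> Is s1; apply: induces_eq1; first by case/setIdP: Is.
by rewrite -s1 induced_permP.
Qed.

Lemma rigid_induced (G : {group gT}) :
  G \subset induced_set -> solvable G -> rigid N S G.
Proof.
move=> sGI solG.
have [|||x [Ex rx]] := solvable_rigid (A := [set: T]) (G := (induced_perm @* G)%G).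
- by apply/subsetP=> p _; apply: Sym_setT.
- exact: morphim_sol.
- by rewrite cardsT.
have xP c i : exists y, y \in N /\ x c i = f y.
  by have /setIP[_ /Alt_normal[y Ny ->]] := Ex c i; exists y.
have [y yP] := fin_all_exists (fun c => fin_all_exists (xP c)).
have Ny c i : y c i \in N by case: (yP c i).
have Iy c i : y c i \in induced_set by apply: subsetP sub_induced _ _.
exists y; split=> // c c' g Sg Gy.
(* g is any element of S, but the first coset condition expresses it through G and N, both inside
   [induced_set]. *)
have Ig : g \in induced_set.
  have := subsetP sGI _ (Gy ord0).
  by rewrite -[induced_set]/(gval induced_group) groupMr ?groupV ?groupMl //; apply: Iy.
have [i|ecc g1] := rx c c' (induced_perm g) (Sym_setT _).
  have [_ ->] := yP c i; have [_ ->] := yP c' i.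
  rewrite -!induced_perm_id // -morphV //= -induced_permM ?groupV //=; try exact: Iy.
  rewrite -induced_permM ?groupM ?groupV //; try exact: Iy.
  by apply: mem_morphim; rewrite ?Gy //= (subsetP sGI) ?Gy.
by split=> //; apply: induced_perm_eq1.
Qed.

Definition conj_Alt s p := f (invm injf p ^ s).

Section ConjAlt.

Variable s : gT.
Hypothesis Ss : s \in S.

Lemma conj_AltE x : x \in N -> conj_Alt s (f x) = f (x ^ s).
Proof. by move=> Nx; rewrite /conj_Alt invmE. Qed.

Lemma conj_AltA p : p \in 'Alt_T -> conj_Alt s p \in 'Alt_T.
Proof. by case/Alt_normal=> x Nx ->; rewrite conj_AltE // normal_Alt // normal_memJ. Qed.

Lemma conj_AltM p q : p \in 'Alt_T -> q \in 'Alt_T ->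
  conj_Alt s (p * q) = conj_Alt s p * conj_Alt s q.
Proof.
case/Alt_normal=> x Nx -> /Alt_normal[y Ny ->].
by rewrite -morphM // !conj_AltE ?groupM // conjMg morphM ?normal_memJ.
Qed.

Lemma conj_Alt_inj : {in 'Alt_T &, injective (conj_Alt s)}.
Proof.
move=> _ _ /Alt_normal[x Nx ->] /Alt_normal[y Ny ->]; rewrite !conj_AltE // => /fI.
by rewrite !normal_memJ // => /(_ Nx Ny)/conjg_inj->.
Qed.

Lemma induced_cyc3 : (forall c, is_cyc3 c -> is_cyc3 (conj_Alt s c)) -> s \in induced_set.
Proof.
move=> h; have [p pP] := alt_endo_induced conj_AltM conj_Alt_inj T4 h.
rewrite inE Ss; apply/existsP; exists p; apply/inducesP=> x Nx.
by rewrite -pP ?normal_Alt // conj_AltE.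
Qed.

Lemma induced_neq6 : #|T| != 6 -> s \in induced_set.
Proof.
move=> T6; apply: induced_cyc3 => c.
exact: (alt_endo_cyc3 (@conj_AltA) (@conj_AltM) conj_Alt_inj T4 T6).
Qed.

End ConjAlt.

End Induced.

(** * Exotic automorphisms of the alternating group of degree 6 *)

Section AltSix.

Variable T : finType.
Implicit Types (u v w x : T) (c b p y z : {perm T}).

Lemma perm_of_uniq (l l' : seq T) : uniq l -> uniq l' -> size l = size l' ->
  exists p : {perm T}, map p l = l'.
Proof.
elim: l l' => [|x l IHl] [|x' l'] //=; first by exists 1.
case/andP=> xl Ul /andP[xl' Ul'] [e]; have [p ep] := IHl _ Ul Ul' e.
exists (p * tperm (p x) x'); rewrite permM tpermL ; congr (_ :: _); rewrite -[RHS]ep.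
apply/eq_in_map=> z lz; rewrite permM tpermD //.
  by rewrite (inj_eq perm_inj); apply: contraNneq xl => ->.
by apply: contraNneq xl' => ->; rewrite -ep map_f.
Qed.

(** Two points remain outside l', and transposing them repairs the parity. *)
Lemma even_perm_of_uniq (l l' : seq T) : uniq l -> uniq l' -> size l = size l' ->
    size l + 2 <= #|T| ->
  exists2 p : {perm T}, p \in 'Alt_T & map p l = l'.
Proof.
move=> Ul Ul' e lT; have [p ep] := perm_of_uniq Ul Ul' e.
have [op|np] := boolP (odd_perm p); last by exists p; rewrite ?Alt_even.
have /card_gt1P[a [b []]] : 1 < #|[set x : T | x \notin l']|.
  have := cardsC [set x in l']; rewrite cardsE (card_uniqP Ul') -e => oC.
  rewrite -(leq_add2l (size l)); apply: leq_trans lT _; rewrite -oC leq_add2l.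
  by apply/subset_leq_card/subsetP=> x; rewrite !inE.
rewrite !inE => al' bl' ab; exists (p * tperm a b).
  by rewrite Alt_even odd_permM op odd_tperm ab.
rewrite -[RHS]ep; apply/eq_in_map=> z lz; rewrite permM tpermD //.
  by apply: contraNneq al' => ->; rewrite -ep map_f.
by apply: contraNneq bl' => ->; rewrite -ep map_f.
Qed.

Lemma cyc3_conj b c : 4 < #|T| -> is_cyc3 b -> is_cyc3 c ->
  exists2 p, p \in 'Alt_T & c = b ^ p.
Proof.
move=> T4 [u [v [w [U ->]]]] [x [y [z [V ->]]]].
have [p Ap [pu pv pw]] := even_perm_of_uniq U V erefl T4.
by exists p; rewrite // cyc3J pu pv pw.
Qed.

Lemma cyc3V u v w : (cyc3 u v w)^-1 = cyc3 u w v.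
Proof. by rewrite invMg !tpermV. Qed.

Lemma is_cyc3V c : is_cyc3 c^-1 -> is_cyc3 c.
Proof.
move=> [u [v [w [U e]]]]; exists u, w, v; rewrite -cyc3V -e invgK; split=> //.
by move: U; rewrite /= !inE !negb_or !andbT [w == v]eq_sym => /andP[/andP[-> ->] ->].
Qed.

Hypothesis T6 : #|T| = 6.

Lemma mem_uniq6 (l : seq T) x : uniq l -> size l = 6 -> x \in l.
Proof.
move=> Ul e; have : [set x in l] = [set: T].
  by apply/eqP; rewrite eqEcard subsetT cardsT T6 cardsE (card_uniqP Ul) e.
by move/setP/(_ x); rewrite !inE.
Qed.

Lemma swap3_map (a b c d e f : T) : uniq [:: a; b; c; d; e; f] ->
  map (tperm a d * tperm b e * tperm c f) [:: d; e; f; a; b; c] = [:: a; b; c; d; e; f].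
Proof.
move=> U; set l := [:: a; b; c; d; e; f] in U *; set w := (_ * _ * _).
have tp i j : i < size l -> j < size l -> simulates a l (tperm (nth a l i) (nth a l j)) (swap i j).
  exact: simulates_tperm.
have sim : simulates a l w (fun i => swap 2 5 (swap 1%N 4 (swap 0%N 3 i))).
  have := simulatesM (simulatesM (tp 0%N 3 isT isT) (tp 1%N 4 isT isT)) (tp 2 5 isT isT).
  by [].
have [_ w0] := sim 0%N isT; have [_ w1] := sim 1%N isT; have [_ w2] := sim 2 isT.
have [_ w3] := sim 3 isT; have [_ w4] := sim 4 isT; have [_ w5] := sim 5 isT.
by rewrite /= in w0 w1 w2 w3 w4 w5 *; rewrite w0 w1 w2 w3 w4 w5.
Qed.

(** An odd conjugating permutation is made even by first exchanging the two 3-cycles of b, a product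
    of three transpositions that commutes with b. *)
Lemma ncyc3_conj b c : b ^+ 3 = 1 -> b != 1 -> ~ is_cyc3 b ->
    c ^+ 3 = 1 -> c != 1 -> ~ is_cyc3 c ->
  exists2 p, p \in 'Alt_T & c = b ^ p.
Proof.
move=> b3 b1 nb c3 c1 nc.
have [u [v [U eu ev]]] := order3_ncyc3 b3 b1 nb.
have [x [y [V ex ey]]] := order3_ncyc3 c3 c1 nc.
have U' : uniq [:: v; b v; b (b v); u; b u; b (b u)].
  by rewrite -(rot_uniq 3).
have conj (u' v' : T) p : uniq [:: u'; b u'; b (b u'); v'; b v'; b (b v')] ->
    b (b (b u')) = u' -> b (b (b v')) = v' ->
    map p [:: u'; b u'; b (b u'); v'; b v'; b (b v')] = [:: x; c x; c (c x); y; c y; c (c y)] ->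
  c = b ^ p.
  move=> W eu' ev' [p1 p2 p3 p4 p5 p6]; apply/permP=> t; rewrite -[t](permKV p).
  move: (p^-1 t) (mem_uniq6 (p^-1 t) W erefl) => {}t.
  rewrite permJ !inE => /or4P[|||/or3P[]] /eqP->.
  - by rewrite p1 p2.
  - by rewrite p2 p3.
  - by rewrite p3 eu' p1.
  - by rewrite p4 p5.
  - by rewrite p5 p6.
  by rewrite p6 ev' p4.
have [p ep] := perm_of_uniq U V erefl.
have [op|np] := boolP (odd_perm p); last first.
  by exists p; rewrite ?Alt_even //; apply: conj ep.
have [p1 p2 p3 p4 p5 p6] := ep.
pose w := tperm u v * tperm (b u) (b v) * tperm (b (b u)) (b (b v)).
exists (w * p).
  have : uniq [:: u; v] by move: U; rewrite /= !inE !negb_or => /and5P[/and5P[_ _ ->]].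
  rewrite /= inE andbT => uv.
  by rewrite Alt_even !odd_permM !odd_tperm op !(inj_eq perm_inj) uv.
apply: (conj v u) => //.
transitivity (map p (map w [:: v; b v; b (b v); u; b u; b (b u)])).
  by rewrite -map_comp; apply: eq_map => t; rewrite permM.
by rewrite /w (swap3_map U).
Qed.

(** An involution on six points has one, two or three disjoint transpositions, and evenness leaves
    two. *)
Lemma even_involution z : z \in 'Alt_T -> z * z = 1 -> z != 1 ->
  exists a b c d : T, uniq [:: a; b; c; d] /\ z = tperm a b * tperm c d.
Proof.
rewrite Alt_even => ez zz z1; have zK x : z (z x) = x.
  by rewrite -permM zz perm1.
have moved (p : {perm T}) : p != 1 -> exists x, p x != x.
  move=> p1; apply/existsP; apply: contraR p1; rewrite negb_exists => /forallP p1.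
  by apply/eqP/permP=> x; rewrite perm1; apply/eqP; rewrite -[_ == _]negbK.
have [a az] := moved z z1; pose b := z a; pose z' := tperm a b * z.
have z'E x : x != a -> x != b -> z' x = z x.
  by move=> xa xb; rewrite permM tpermD // eq_sym.
have z'a : z' a = a by rewrite permM tpermL zK.
have z'b : z' b = b by rewrite permM tpermR.
have [|c cz] := moved z'.
  apply: contraNneq ez => e; rewrite -[z]mul1g -(tperm2 a b) -mulgA -/z' e mulg1.
  by rewrite odd_tperm eq_sym.
have [ca cb] : c != a /\ c != b by split; apply: contraNneq cz => ->; apply/eqP.
rewrite z'E // in cz; pose d := z c; pose z'' := tperm c d * z'.
have da : d != a by rewrite -(inj_eq (@perm_inj _ z)) zK.
have db : d != b by rewrite (inj_eq perm_inj).
have U : uniq [:: a; b; c; d].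
  rewrite /= !inE !negb_or andbT [a == b]eq_sym [a == c]eq_sym [a == d]eq_sym.
  by rewrite [b == c]eq_sym [b == d]eq_sym [c == d]eq_sym az ca da cb db.
have z''ev : ~~ odd_perm z''.
  by rewrite !odd_permM !odd_tperm [a == b]eq_sym [c == d]eq_sym az cz (negPf ez).
exists a, b, c, d; split=> //; suff z1'' : z'' = 1.
  have -> : z = tperm a b * z' by rewrite mulgA tperm2 mul1g.
  have -> : z' = tperm c d * z'' by rewrite mulgA tperm2 mul1g.
  by rewrite z1'' mulg1.
apply/eqP; apply: contraT => /moved[e ze]; case/negP: z''ev.
have out x : x \in [:: a; b; c; d] -> z'' x = x.
  rewrite !inE => /or4P[] /eqP->.
  - by rewrite permM tpermD.
  - by rewrite permM tpermD.
  - by rewrite permM tpermL z'E // zK.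
  by rewrite permM tpermR z'E.
have nl x : z'' x != x -> x \notin [:: a; b; c; d] by apply: contraNN => /out->; apply/eqP.
pose f := z'' e; have zf : z'' f != f by rewrite (inj_eq perm_inj).
have U6 : uniq [:: e; f; a; b; c; d].
  by rewrite /= [e \in _]inE negb_or eq_sym ze (nl _ ze) (nl _ zf).
have -> : z'' = tperm e f.
  have z''f : z'' f = e.
    have := mem_uniq6 (z'' f) U6 erefl; rewrite inE => /orP[/eqP//|].
    rewrite inE (negPf zf) /=; apply: contraTeq => _.
    by apply: nl; rewrite (inj_eq perm_inj).
  apply/permP=> x; have := mem_uniq6 x U6 erefl; rewrite inE => /orP[/eqP->|].
    by rewrite tpermL.
  rewrite inE => /orP[/eqP->|lx]; first by rewrite tpermR z''f.
  rewrite (out _ lx) tpermD //; first by apply: contraNneq (nl _ ze) => ->.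
  by apply: contraNneq (nl _ zf) => ->.
by rewrite odd_tperm eq_sym.
Qed.

Lemma odd_expg_swap (g : {perm T}) m (x y : T) :
  odd m -> g ^+ m = 1 -> g x = y -> g y = x -> x = y.
Proof.
move=> om gm gx gy; have g2 k : (g ^+ k.*2) x = x.
  by elim: k => [|k IHk]; rewrite ?perm1 // doubleS !expgSr !permM IHk gx gy.
move: (congr1 (fun p : {perm T} => p x) gm).
by rewrite -[m]odd_double_half om -[(true + _)%N]/((m./2).*2.+1) expgSr permM g2 gx perm1.
Qed.

(** The centraliser of (a b)(c d) in degree 6 is a 2-group; the proof follows the points directly,
    as an element of odd order cannot exchange two points. *)
Lemma commute_even_involution z g m : z \in 'Alt_T -> z * z = 1 -> z != 1 ->
  commute g z -> odd m -> g ^+ m = 1 -> g = 1.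
Proof.
move=> Az zz z1 cgz om gm; have [a [b [c [d [U ez]]]]] := even_involution Az zz z1.
have swapF := odd_expg_swap om gm.
move: (U); rewrite /= !inE !negb_or => /and4P[/and3P[ab ac ad] /andP[bc bd] cd _].
have za : z a = b by rewrite ez permM tpermL tpermD // eq_sym.
have zb : z b = a by rewrite ez permM tpermR tpermD // eq_sym.
have zc : z c = d by rewrite ez permM [tperm a b c]tpermD // tpermL.
have zd : z d = c by rewrite ez permM [tperm a b d]tpermD // tpermR.
have gz x : g (z x) = z (g x) by rewrite -!permM cgz.
have zout x : x \notin [:: a; b; c; d] -> z x = x.
  rewrite !inE !negb_or ez => /and4P[xa xb xc xd].
  by rewrite permM !tpermD // eq_sym.
have zin x : x \in [:: a; b; c; d] -> z x != x.
  by rewrite !inE => /or4P[] /eqP->; rewrite ?za ?zb ?zc ?zd // eq_sym.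
have gin x : (g x \in [:: a; b; c; d]) = (x \in [:: a; b; c; d]).
  have memE t : (t \in [:: a; b; c; d]) = (z t != t).
    by apply/idP/idP=> [/zin//|]; apply: contraR => /zout->.
  by rewrite !memE -gz (inj_eq perm_inj).
have gout x : x \notin [:: a; b; c; d] -> g x = x.
  move=> nx; apply/eqP; apply: contraT => gx.
  have gnx : g x \notin [:: a; b; c; d] by rewrite gin.
  have ggnx : g (g x) \notin [:: a; b; c; d] by rewrite gin.
  have U6 : uniq [:: x; g x; a; b; c; d].
    by rewrite /= [x \in _]inE negb_or eq_sym gx nx gnx.
  have := mem_uniq6 (g (g x)) U6 erefl; rewrite inE => /orP[/eqP ggx|].
    by rewrite -(swapF _ _ erefl ggx) eqxx in gx.
  by rewrite inE (inj_eq perm_inj) (negPf gx) (negPf ggnx).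
have fix1 x : g x = x -> g (z x) = z x by rewrite gz => ->.
have cross (c' : T) : c' != a -> g a = c' -> g c' = a \/ g c' = b -> False.
  move=> c'a ga [gc|gc]; first by rewrite (swapF _ _ ga gc) eqxx in c'a.
  have gg x : (g * g) x = g (g x) by rewrite permM.
  have ggb : (g * g) b = a by rewrite gg -za gz ga gz gc zb.
  have gga : (g * g) a = b by rewrite gg ga.
  case/eqP: ab; apply: odd_expg_swap om _ gga ggb.
  by rewrite -(expgS g 1) -expgM mulnC expgM gm expg1n.
have crossF (c' : T) : c' \in [:: c; d] -> g a = c' -> False.
  move=> c'in ga; have c'in2 : (c' == c) || (c' == d) by move: c'in; rewrite !inE.
  have [c'a c'b] : c' != a /\ c' != b.
    by case/orP: (c'in2) => /eqP->; rewrite ![_ == a]eq_sym ![_ == b]eq_sym ?ac ?bc ?ad ?bd.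
  apply: (cross _ c'a ga); have : g c' \in [:: a; b; c; d].
    by rewrite gin !inE orbA c'in2 orbT.
  have gc1 : g c' != c' by rewrite -{2}ga (inj_eq perm_inj).
  have gc2 : g c' != z c'.
    by rewrite -ga -gz za (inj_eq perm_inj) ga.
  rewrite !inE => /or4P[/eqP|/eqP|/eqP e|/eqP e]; [by left|by right| |].
    by case/orP: (c'in2) => /eqP ec; move: gc1 gc2; rewrite e ec ?zc ?zd eqxx.
  by case/orP: (c'in2) => /eqP ec; move: gc1 gc2; rewrite e ec ?zc ?zd eqxx.
have : g a \in [:: a; b; c; d] by rewrite gin !inE eqxx.
rewrite !inE => /or4P[/eqP ga|/eqP ga|/eqP ga|/eqP ga].
- have gb : g b = b by rewrite -za fix1.
  have : g c \in [:: a; b; c; d] by rewrite gin !inE eqxx !orbT.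
  rewrite !inE -[g c == a](inj_eq (@perm_inj _ g^-1)) permK -{1}ga permK [c == a]eq_sym (negPf ac) /=.
  rewrite -[g c == b](inj_eq (@perm_inj _ g^-1)) permK -{1}gb permK [c == b]eq_sym (negPf bc) /=.
  case/orP=> /eqP gc; last first.
    by have gd : g d = c; [rewrite -zc gz gc | rewrite (swapF _ _ gc gd) eqxx in cd].
  have gd : g d = d by rewrite -zc fix1.
  apply/permP=> x; rewrite perm1; have [|/gout//] := boolP (x \in [:: a; b; c; d]).
  by rewrite !inE => /or4P[] /eqP->.
- have gb : g b = a by rewrite -za gz ga zb.
  by rewrite (swapF _ _ ga gb) eqxx in ab.
- by case: (crossF c _ ga); rewrite !inE eqxx.
by case: (crossF d _ ga); rewrite !inE eqxx orbT.
Qed.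

End AltSix.

Section Exotic.

Variables (gT : finGroupType) (S N : {group gT}) (T : finType).
Variable f : {morphism N >-> {perm T}}.
Hypotheses (injf : 'injm f) (imf : f @* N = 'Alt_T) (nsN : N <| S).
Hypotheses (cN : 'C_S(N) = 1) (T6 : #|T| = 6).

Let T4 : 4 < #|T|. Proof. by rewrite T6. Qed.
Let sNS : N \subset S := normal_sub nsN.
Let nNS : S \subset 'N(N) := normal_norm nsN.
Let fI : {in N &, injective f} := injmP injf.
Let fNJ x s : s \in S -> (x ^ s \in N) = (x \in N) := @normal_memJ _ _ _ nsN x s.
Let I := induced_group f nsN.

Definition image_cyc3 x := is_cyc3 (f x).

Lemma image_cyc3_J x y : x \in N -> y \in N -> image_cyc3 (x ^ y) -> image_cyc3 x.
Proof.
move=> Nx Ny; rewrite /image_cyc3 morphJ // => /(is_cyc3J (f y)^-1).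
by rewrite conjgK.
Qed.

Lemma image_cyc3_V x : x \in N -> image_cyc3 x^-1 -> image_cyc3 x.
Proof. by move=> Nx; rewrite /image_cyc3 morphV //; apply: is_cyc3V. Qed.

Lemma image_cyc3_order x : x \in N -> image_cyc3 x -> x ^+ 3 = 1 /\ x != 1.
Proof.
move=> Nx [u [v [w [U ex]]]]; split.
  by apply: fI; rewrite ?groupX // morphX // ex cyc3_order3 ?morph1.
apply: contraTneq (U) => x1; have := cyc3_1 U.
by rewrite -ex x1 morph1 perm1 => <-; rewrite /= inE eqxx.
Qed.

Lemma image_cyc3_conj x y : x \in N -> y \in N -> image_cyc3 x -> image_cyc3 y ->
  exists2 n, n \in N & y = x ^ n.
Proof.
move=> Nx Ny cx cy; have [p Ap ep] := cyc3_conj T4 cx cy.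
have [n Nn en] := Alt_normal imf Ap; exists n => //.
by apply: fI; rewrite ?groupJ // morphJ // -en.
Qed.

Lemma image_ncyc3_conj x y : x \in N -> y \in N ->
    x ^+ 3 = 1 -> x != 1 -> ~ image_cyc3 x -> y ^+ 3 = 1 -> y != 1 -> ~ image_cyc3 y ->
  exists2 n, n \in N & y = x ^ n.
Proof.
have f3 z : z \in N -> z ^+ 3 = 1 -> f z ^+ 3 = 1.
  by move=> Nz z3; rewrite -morphX // z3 morph1.
have f1 z : z \in N -> z != 1 -> f z != 1.
  by move=> Nz; apply: contra => /eqP e; apply/eqP/fI; rewrite ?group1 // morph1.
move=> Nx Ny x3 x1 cx y3 y1 cy.
have [p Ap ep] := ncyc3_conj T6 (f3 _ Nx x3) (f1 _ Nx x1) cx (f3 _ Ny y3) (f1 _ Ny y1) cy.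
have [n Nn en] := Alt_normal imf Ap; exists n => //.
by apply: fI; rewrite ?groupJ // morphJ // -en.
Qed.

Section Element.

Variable s : gT.
Hypotheses (Ss : s \in S) (nIs : s \notin induced_set S f).

(** The 3-cycles are conjugate in N: if one stayed a 3-cycle under s, all would, and s would be
    induced by a permutation. *)
Lemma exotic_cyc x : x \in N -> image_cyc3 x -> ~ image_cyc3 (x ^ s).
Proof.
move=> Nx cx cxs; case/negP: nIs; apply: (induced_cyc3 (injf := injf) imf nsN T4 Ss) => c c3.
have [y Ny ey] := Alt_normal imf (is_cyc3_Alt c3); rewrite ey in c3 *.
rewrite conj_AltE //; have [n Nn ->] := image_cyc3_conj Nx Ny cx c3.
rewrite conjJg morphJ ?fNJ //; exact: is_cyc3J.
Qed.

(* x ^ s is conjugate to the image by s of a 3-cycle, so if it is not a 3-cycle then x is one. *)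
Lemma exotic_ncyc x : x \in N -> x ^+ 3 = 1 -> x != 1 -> ~ image_cyc3 x -> image_cyc3 (x ^ s).
Proof.
move=> Nx x3 x1 ncx; have [//|ncxs] := is_cyc3_dec (f (x ^ s)).
have [c [y [Ny ey] c3]] : exists2 c, exists y, y \in N /\ c = f y & is_cyc3 c.
  have [c c3 [y [Ny ey]]] : exists2 c : {perm T}, is_cyc3 c & exists y, y \in N /\ c = f y.
    have : size (enum T) > 4 by rewrite -cardE.
    have := enum_uniq T; case: (enum T) => [|u [|v [|w l]]] //= U _.
    have c3 : is_cyc3 (cyc3 u v w).
      exists u, v, w; split=> //; move: U.
      by rewrite /= !inE !negb_or => /and4P[/and3P[-> -> _] /andP[-> _] _].
    exists (cyc3 u v w) => //.
    by have [y Ny ->] := Alt_normal imf (is_cyc3_Alt c3); exists y.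
  by exists c => //; exists y.
rewrite ey in c3; have [y3 y1] := image_cyc3_order Ny c3.
have ncys := exotic_cyc Ny c3.
have conj3 z : z ^+ 3 = 1 -> (z ^ s) ^+ 3 = 1 by move=> z3; rewrite -conjXg z3 conj1g.
have conj1 z : z != 1 -> z ^ s != 1 by rewrite conjg_eq1.
have Nxs : x ^ s \in N by rewrite fNJ.
have Nys : y ^ s \in N by rewrite fNJ.
have [n Nn exy] := image_ncyc3_conj Nys Nxs (conj3 _ y3) (conj1 _ y1) ncys (conj3 _ x3) (conj1 _ x1) ncxs.
have Nns : n ^ s^-1 \in N by rewrite fNJ ?groupV.
have ex : x = y ^ (n ^ s^-1).
  by apply: (@conjg_inj _ s); rewrite conjJg conjgKV.
case: ncx; rewrite ex /image_cyc3 morphJ //; exact: is_cyc3J.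
Qed.

Lemma exotic_square : s * s \in induced_set S f.
Proof.
have Sss : s * s \in S by apply: groupM.
apply: (induced_cyc3 (injf := injf) imf nsN T4 Sss) => c c3.
have [y Ny ey] := Alt_normal imf (is_cyc3_Alt c3); rewrite ey in c3 *.
rewrite conj_AltE // conjgM; have [y3 y1] := image_cyc3_order Ny c3.
apply: exotic_ncyc; rewrite ?fNJ -?conjXg ?y3 ?conj1g ?conjg_eq1 //.
exact: exotic_cyc.
Qed.

End Element.

(** s * s acts as a permutation, and the square of a permutation is even. *)
Lemma expg4_normal s : s \in S -> s ^+ 4 \in N.
Proof.
move=> Ss; have Iss : s * s \in I.
  have [Is|nIs] := boolP (s \in induced_set S f); last exact: exotic_square.
  exact: (groupM (Is : s \in I)).
have Iss2 := groupM Iss Iss.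
have Ap : induced_perm f (s * s) * induced_perm f (s * s) \in 'Alt_T.
  by rewrite Alt_even odd_permM addbb.
have [x Nx ex] := Alt_normal imf Ap.
suff -> : s ^+ 4 = x by [].
have -> : s ^+ 4 = s * s * (s * s) by rewrite !expgS expg0 mulg1 !mulgA.
have Ix : x \in I by apply: subsetP (sub_induced f nsN) _ Nx.
apply/eqP; rewrite eq_mulgV1; apply/eqP.
apply: (induced_perm_eq1 injf nsN cN); first by apply: groupM; rewrite ?groupV.
pose a := s * s * (s * s); have Iax : a * x^-1 \in I by rewrite groupM ?groupV.
have := induced_permM imf nsN T4 Iax Ix; rewrite /= mulgKV (induced_permM imf nsN T4 Iss Iss) (induced_perm_id imf nsN T4 Nx) ex.
by rewrite -[LHS]mul1g => /mulIg<-.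
Qed.

Section SylowNormalized.

Variables (G : {group gT}) (t : gT).
Hypotheses (sGS : G \subset S) (solG : solvable G) (Gt : t \in G).
Hypothesis nIt : t \notin induced_set S f.

Let St : t \in S := subsetP sGS t Gt.
Let H := (G :&: N)%G.
Let sHN : H \subset N. Proof. exact: subsetIr. Qed.
Let sHG : H \subset G. Proof. exact: subsetIl. Qed.
Let nsHG : H <| G. Proof. exact: normalGI sGS nsN. Qed.

(** A nontrivial element of <[x ^ h]> is x ^ h or its inverse, of the same kind as x, whereas t
    changes the kind. *)
Lemma exotic_order3 x h : x \in N -> #[x] = 3 -> h \in N -> x ^ t \notin <[x ^ h]>.
Proof.
move=> Nx ox Nh; apply/negP=> xt.
have x3 : x ^+ 3 = 1 by rewrite -ox expg_order.
have x1 : x != 1 by rewrite -order_gt1 ox.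
have Nxh : x ^ h \in N by rewrite groupJ.
have ncE : image_cyc3 (x ^ h) -> image_cyc3 x by apply: image_cyc3_J.
have cE : image_cyc3 x -> image_cyc3 (x ^ h) by move=> cx; rewrite /image_cyc3 morphJ //; apply: is_cyc3J.
have : x ^ t = x ^ h \/ x ^ t = (x ^ h)^-1.
  have : x ^ t != 1 by rewrite conjg_eq1.
  case/cycleP: xt => m ->; rewrite -(expg_mod_order _ m) orderJ ox.
  have : m %% 3 < 3 by rewrite ltn_mod.
  case: (m %% 3) => [|[|[|//]]] _; rewrite ?eqxx // => _; first by left.
  by right; apply/eqP; rewrite eq_sym eq_invg_mul -expgS -conjXg x3 conj1g.
have exc := exotic_cyc St nIt Nx; have exn := exotic_ncyc St nIt Nx x3 x1.
have [cx|ncx] := is_cyc3_dec (f x).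
  case=> e; apply: (exc cx); rewrite e; first exact: cE.
  by apply: image_cyc3_V; rewrite ?groupV // invgK; apply: cE.
by case=> e; apply/ncx/ncE; have := exn ncx; rewrite e // => /(image_cyc3_V Nxh).
Qed.

(* A Sylow subgroup of order 3 would be mapped by t to a conjugate of itself, but t exchanges the two classes of elements of order 3. *)
Lemma sylow3_meet : (#|H|`_3)%N <> 3.
Proof.
move=> o3; have [X sylX] := Sylow_exists 3 H.
have oX : #|X| = 3 by rewrite (card_Hall sylX).
have [x defX] : exists x, X :=: <[x]>.
  by apply/cyclicP/prime_cyclic; rewrite oX.
have sXH := pHall_sub sylX.
have Hx : x \in H by rewrite (subsetP sXH) // defX cycle_id.
have sylXt : 3.-Sylow(H) (X :^ t).
  by rewrite -[H : {set _}](normsP (normal_norm nsHG) t Gt) pHallJ2.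
have [h Hh eXt] := Sylow_trans sylX (sylXt : 3.-Sylow(H) (X :^ t)%G).
have := @exotic_order3 x h (subsetP sHN _ Hx) _ (subsetP sHN _ Hh).
rewrite orderE -defX oX => /(_ erefl)/negP; apply.
by rewrite cycleJ -defX -eXt memJ_conjg defX cycle_id.
Qed.

(** Fourth powers of G fall in H, so G is a 2-group; inside a Sylow 2-subgroup Q of S, it normalises
    [N :&: Q]. *)
Lemma sylow2_normalized : 2.-group H ->
  exists2 P : {group gT}, 2.-Sylow(N) P & G \subset 'N(P).
Proof.
move=> H2; have G2 : 2.-group G.
  apply/pgroupP=> p p_pr /(Cauchy p_pr)[x Gx ox].
  have Hx4 : x ^+ 4 \in H by rewrite inE groupX // expg4_normal // (subsetP sGS).
  have /p_natP[k ok] : 2.-nat #[x ^+ 4] := mem_p_elt H2 Hx4.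
  have : p %| 2 ^ (2 + k).
    by rewrite -ox order_dvdn expnD expgM -ok expg_order.
  by rewrite Euclid_dvdX // => /andP[]; rewrite dvdn_prime2.
have [Q sylQ sGQ] := Sylow_superset sGS G2.
exists (N :&: Q)%G; first exact: Sylow_setI_normal nsN sylQ.
rewrite normsI ?(subset_trans sGS nNS) //.
exact: subset_trans sGQ (normG Q).
Qed.

Lemma card_normal6 : #|N| = 360.
Proof.
have := card_Alt (T := T); rewrite T6 => /(_ isT).
rewrite -imf (card_injm injf) // => e; apply/eqP.
by rewrite -(eqn_pmul2l (isT : 0 < 2)) e.
Qed.

Lemma cent_involution z : z \in N -> #[z] = 2 -> 2.-group 'C_N[z].
Proof.
move=> Nz oz; apply/pgroupP=> p p_pr /(Cauchy p_pr)[x /setIP[Nx /cent1P czx] ox].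
rewrite inE; apply: contraT => p2.
have om : odd p by case: (even_prime p_pr) p2 => [->|].
have z1 : f z != 1.
  apply/eqP=> e; have e1 : z = 1 by apply: fI; rewrite ?group1 // morph1.
  by rewrite e1 order1 in oz.
have zz : f z * f z = 1.
  by rewrite -morphM // -(expgS z 1) -oz expg_order morph1.
have c : commute (f x) (f z) by rewrite /commute -!morphM // czx.
have xp : f x ^+ p = 1 by rewrite -morphX // -ox expg_order morph1.
have fx1 := commute_even_involution T6 (normal_Alt imf Nz) zz z1 c om xp.
have x1 : x = 1 by apply: fI; rewrite ?group1 // morph1.
by move: p_pr; rewrite -ox x1 order1.
Qed.

(* If H is a 2-group then so is G, because 4th powers of elements of S lie in N. Otherwise a minimal normal subgroup of G inside H must be a Sylow subgroup of N: if it were a smaller 3-group it would have order 3, and if it were a smaller 2-group then H would be a 2-group or have a Sylow 3-subgroup of order 3. *)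
Lemma exotic_Sylow : exists p, exists2 P : {group gT},
  [/\ p \in [:: 2; 3; 5] & p.-Sylow(N) P] & G \subset 'N(P).
Proof.
have [H2|nH2] := boolP (2.-group H).
  by have [P] := sylow2_normalized H2; exists 2; exists P.
have ntH : H :!=: 1.
  by apply: contra nH2 => /eqP->; apply: pgroup1.
have [Q minQ sQH] := minnormal_exists ntH (normal_norm nsHG).
have [_ ntQ /is_abelemP[r r_pr abelQ]] := minnormal_solvable minQ (subset_trans sQH sHG) solG.
have nQG : G \subset 'N(Q) by have /mingroupp/andP[] := minQ.
have sQN := subset_trans sQH sHN.
have rQ := abelem_pgroup abelQ.
have dQ : #|Q| %| 360 by rewrite -card_normal6 cardSg.
have sylow : (#|Q| == 360`_r)%N -> r.-Sylow(N) Q by move=> e; rewrite pHallE sQN card_normal6.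
have [_ rdQ [k oQ]] := pgroup_pdiv rQ ntQ.
have : r \in primes 360 by rewrite mem_primes r_pr (dvdn_trans rdQ dQ).
rewrite (_ : primes 360 = [:: 2; 3; 5]) // => r235.
(* #|Q| is r ^ k.+1, so Q is a Sylow subgroup exactly when k is maximal here. *)
have : k < logn r 360 by rewrite -pfactor_dvdn // -oQ.
rewrite p_part in sylow; move: (r235); rewrite !inE => /or3P[] /eqP er; rewrite er in r235 oQ sylow rQ abelQ *.
- rewrite (_ : logn 2 360 = 3) // in sylow *; rewrite ltnS leq_eqVlt => /orP[/eqP k2|k2].
    by exists 2; exists Q; rewrite // sylow ?oQ ?k2.
  (* Q has order 2 or 4, so z has at most three conjugates under H, while its centraliser in H is a
     2-group. *)
  exfalso; have [z Qz z1] := trivgPn _ ntQ.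
  have oz := abelem_order_p abelQ Qz z1.
  have Hz := subsetP sQH _ Qz; have Nz := subsetP sHN _ Hz.
  have C2 : 2.-group 'C_H[z].
    by apply: pgroupS (cent_involution Nz oz); rewrite setSI.
  have oH : #|H| = (#|z ^: H| * #|'C_H[z]|)%N.
    by rewrite -index_cent1 mulnC Lagrange // subsetIl.
  have le3 : #|z ^: H| <= 3.
    have : #|z ^: H| <= #|Q :\ 1|.
      apply/subset_leq_card/subsetP=> _ /imsetP[h Hh ->].
      by rewrite !inE conjg_eq1 z1 memJ_norm // (subsetP nQG) ?(subsetP sHG).
    move/leq_trans; apply; move: oQ; rewrite (cardsD1 1) group1 /= add1n => oQ.
    by rewrite -ltnS oQ; move: k2; case: (k) => [|[|]].
  have c0 : 0 < #|z ^: H| by rewrite -index_cent1.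
  have [o3|n3] := eqVneq #|z ^: H| 3.
    apply: sylow3_meet; rewrite oH partnM // o3 part_pnat_id // (part_p'nat (n := #|_|)) //.
    by apply: sub_pgroup C2 => q; rewrite !inE => /eqP->.
  case/negP: nH2; rewrite /pgroup oH pnatM; apply/andP; split; last exact: C2.
  by move: n3 c0 le3; move: #|_| => [|[|[|[|m]]]].
- rewrite (_ : logn 3 360 = 2) // in sylow *; rewrite ltnS leq_eqVlt => /orP[/eqP k1|].
    by exists 3; exists Q; rewrite // sylow ?oQ ?k1.
  (* Q would be generated by an element of order 3 and normalised by t, against [exotic_order3] with
     h = 1. *)
  rewrite ltnS leqn0 => /eqP k0; rewrite k0 in oQ.
  have [x Qx x1] := trivgPn _ ntQ; have ox := abelem_order_p abelQ Qx x1.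
  have eQ : Q :=: <[x]> by apply/esym/eqP; rewrite eqEcard cycle_subG Qx oQ -ox leqnn.
  have := exotic_order3 (subsetP sQN _ Qx) ox (group1 N).
  by rewrite conjg1 -eQ memJ_norm ?Qx // (subsetP nQG).
rewrite (_ : logn 5 360 = 1%N) // in sylow *; rewrite ltnS leqn0 => /eqP k0.
by exists 5; exists Q; rewrite // sylow ?oQ ?k0.
Qed.

End SylowNormalized.

End Exotic.

(** * Rigid configurations of Sylow subgroups in degree 6 *)

Section Words.

Implicit Types w : seq (nat * nat).

(* A word lists transpositions, the first one acting first. *)
Definition word_table w : seq nat :=
  foldl (fun l e => [seq swap e.1 e.2 k | k <- l]) (iota 0 6) w.

Definition word_perm w : {perm 'I_6} := \prod_(e <- w) tperm (inord e.1) (inord e.2).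

Definition perm_table (p : {perm 'I_6}) : seq nat := [seq val (p (inord k)) | k <- iota 0 6].

Definition word_ok w := all (fun e => [&& e.1 < 6, e.2 < 6 & e.1 != e.2]) w.

Lemma perm_table_inj : injective perm_table.
Proof.
move=> p q /eq_in_map e; apply/permP=> i; apply: val_inj.
by have := e i; rewrite mem_iota ltn_ord inord_val; apply.
Qed.

Lemma word_perm_cat w x : word_perm (w ++ x) = word_perm w * word_perm x.
Proof. by rewrite /word_perm big_cat. Qed.

Lemma word_permE w : word_ok w -> perm_table (word_perm w) = word_table w.
Proof.
elim/last_ind: w => [|w [a b] IHw].
  move=> _; rewrite /word_perm big_nil.
  by rewrite -[RHS]map_id; apply/eq_in_map=> k; rewrite mem_iota perm1 => k6; rewrite /= inordK.
rewrite /word_ok all_rcons => /andP[/= /and3P[a6 b6 ab] /IHw e].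
rewrite /word_table foldl_rcons -/(word_table w) -e -map_comp; apply: eq_map => k /=.
rewrite -cats1 word_perm_cat permM [word_perm [:: _]]big_seq1 /=.
rewrite /swap; case: tpermP => [->|->|]; rewrite ?inordK ?eqxx //.
  by case: eqP.
move=> na nb; rewrite !ifN //; first by apply/eqP=> e'; case: nb; apply: val_inj; rewrite /= inordK.
by apply/eqP=> e'; case: na; apply: val_inj; rewrite /= inordK.
Qed.

Lemma odd_word_perm w : word_ok w -> odd_perm (word_perm w) = odd (size w).
Proof.
elim: w => [|[a b] w IHw] /=; first by rewrite /word_perm big_nil odd_perm1.
case/andP=> /and3P[a6 b6 ab] /IHw e.
rewrite -cat1s word_perm_cat [word_perm [:: _]]big_seq1 odd_permM e odd_tperm.
by rewrite -val_eqE /= !inordK // ab.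
Qed.

(* The table of a Sylow p-subgroup of Alt_6 given by a sequence l of the six points: (l0 l1 l2 l3)(l4 l5) and (l0 l2)(l4 l5) generate it for p = 2, (l0 l1 l2) and (l3 l4 l5) for p = 3, and (l0 l1 l2 l3 l4) for p = 5. *)
Definition sylow_words p (l : seq nat) : seq (seq (nat * nat)) := (
  let a := nth 0 l in
  let: (x, n, z, m) :=
    if p == 2 then
      ([:: (a 0, a 1); (a 0, a 2); (a 0, a 3); (a 4, a 5)], 4, [:: (a 0, a 2); (a 4, a 5)], 2)
    else if p == 3 then ([:: (a 0, a 1); (a 0, a 2)], 3, [:: (a 3, a 4); (a 3, a 5)], 3)
    else ([:: (a 0, a 1); (a 0, a 2); (a 0, a 3); (a 0, a 4)], 5, [::], 1) in
  [seq flatten (nseq i x) ++ flatten (nseq j z) | i <- iota 0 n, j <- iota 0 m])%N.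

Definition tables (L : seq (seq (nat * nat))) := [seq word_table w | w <- L].

Definition group_words n L :=
  let t := tables L in
  [&& all (fun w => word_ok w && ~~ odd (size w)) L, uniq t, size L == n, word_table [::] \in t
    & all (fun w => all (fun w' => word_table (w ++ w') \in t) L) L].

(** z spells an involution, so [z ++ w ++ z] spells the conjugate of w. *)
Definition normal_words z L :=
  let t := tables L in all (fun w => word_table (z ++ w ++ z) \in t) L.

(** By [even_involution] these spell all even involutions of degree 6, each in several ways. *)
Definition involution_words : seq (seq (nat * nat)) :=
  let pairs := [seq (a, b) | a <- iota 0 6, b <- iota 0 6] in
  [seq w <- [seq [:: e1; e2] | e1 <- pairs, e2 <- pairs] | uniq (unzip1 w ++ unzip2 w)].

(* z is the only even involution normalising both groups, so an automorphism stabilising the two groups fixes it. *)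
Definition unique_normalizer L L' z :=
  [&& [&& word_ok z, word_table (z ++ z) == word_table [::] & word_table z != word_table [::]],
      normal_words z L, normal_words z L' & all (fun z' =>
    if word_ok z' then if normal_words z' L then if normal_words z' L' then
      word_table z' == word_table z else true else true else true) involution_words].

(* Four sequences of points defining Sylow subgroups, then pairs of indices of these subgroups together with an involution as in [unique_normalizer], and finally, for k < 4, a word in the involutions (referred to by their positions) equal to the 3-cycle (0, 1, k + 2). *)
Definition config := (seq (seq nat) * seq (nat * nat * seq (nat * nat)) * seq (seq nat))%type.

Definition config_check p n (c : config) :=
  let: (ls, zs, ws) := c in
  let L i := sylow_words p (nth [::] ls i) in
  [&& all (fun i => group_words n (L i)) (iota 0 4),
      all (fun e => [&& e.1.1 < 4, e.1.2 < 4, ~~ odd (size e.2) &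
        unique_normalizer (L e.1.1) (L e.1.2) e.2]) zs
    & all (fun k => let w := nth [::] ws k in
        all (fun i => i < size zs) w &&
        (word_table (flatten [seq (nth (0, 0, [::]) zs i).2 | i <- w])
           == word_table [:: (0, 1); (0, k.+2)])) (iota 0 4)]%N.

(* These configurations were found by a computer search. *)
Definition config2 : config := (
  [:: [:: 0; 3; 4; 5; 1; 2]; [:: 1; 2; 3; 5; 0; 4]; [:: 1; 3; 2; 4; 0; 5]; [:: 0; 2; 5; 4; 1; 3]],
  [:: (0, 1, [:: (1, 2); (3, 5)]); (0, 2, [:: (0, 5); (3, 4)]);
      (1, 3, [:: (0, 4); (2, 5)]); (2, 3, [:: (1, 3); (2, 4)])],
  [:: [:: 1; 2; 1; 0]; [:: 2; 1; 2; 3]; [:: 2; 0; 3; 0]; [:: 1; 3; 0; 3]])%N.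

Definition config3 : config := (
  [:: [:: 0; 2; 3; 1; 4; 5]; [:: 0; 2; 4; 1; 3; 5]; [:: 0; 1; 2; 3; 4; 5]; [:: 0; 1; 3; 2; 4; 5]],
  [:: (0, 1, [:: (0, 2); (1, 5)]); (0, 2, [:: (0, 2); (4, 5)]); (0, 3, [:: (0, 3); (4, 5)]);
      (1, 2, [:: (0, 2); (3, 5)]); (1, 3, [:: (1, 3); (2, 4)]); (2, 3, [:: (0, 1); (4, 5)])],
  [:: [:: 5; 1]; [:: 5; 2]; [:: 1; 0; 5]; [:: 0; 1; 5]])%N.

Definition config5 : config := (
  [:: [:: 0; 2; 5; 4; 3; 1]; [:: 0; 1; 2; 3; 5; 4]; [:: 0; 1; 5; 3; 2; 4]; [:: 0; 2; 3; 5; 4; 1]],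
  [:: (0, 1, [:: (0, 2); (3, 5)]); (0, 3, [:: (0, 4); (2, 5)]);
      (1, 2, [:: (0, 1); (2, 5)]); (2, 3, [:: (0, 5); (2, 3)])],
  [:: [:: 0; 2; 3; 2]; [:: 2; 0; 3]; [:: 2; 1]; [:: 3; 2; 0; 2]])%N.

Lemma config2_check : config_check 2 8 config2. Proof. by vm_compute. Qed.
Lemma config3_check : config_check 3 9 config3. Proof. by vm_compute. Qed.
Lemma config5_check : config_check 5 5 config5. Proof. by vm_compute. Qed.

Lemma word_table_perm w w' : word_ok w -> word_ok w' ->
  word_table w = word_table w' -> word_perm w = word_perm w'.
Proof. by move=> ow ow' e; apply: perm_table_inj; rewrite !word_permE. Qed.

Lemma word_ok_cat w w' : word_ok (w ++ w') = word_ok w && word_ok w'.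
Proof. exact: all_cat. Qed.

Lemma card_Alt6 : #|'Alt_('I_6)| = 360.
Proof.
have := card_Alt (T := 'I_6); rewrite card_ord => /(_ isT) e.
by apply/eqP; rewrite -(eqn_pmul2l (isT : 0 < 2)) e.
Qed.

Definition table_set L := [set x : {perm 'I_6} | perm_table x \in tables L].

Lemma table_setP n L x : group_words n L ->
  reflect (exists w, [/\ w \in L, word_ok w & x = word_perm w]) (x \in table_set L).
Proof.
case/and5P=> /allP ok _ _ _ _; rewrite inE; apply: (iffP mapP) => [[w Lw e]|[w [Lw ow ->]]].
  have /andP[ow _] := ok w Lw.
  by exists w; split=> //; apply: perm_table_inj; rewrite e word_permE.
by exists w; rewrite ?word_permE.
Qed.

Lemma table_set_group n L : group_words n L -> group_set (table_set L).
Proof.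
move=> gL; have /and5P[_ _ _ L1 /allP LM] := gL.
apply/group_setP; split.
  by rewrite inE -[perm_table 1]/(perm_table 1) -(word_permE (isT : word_ok [::])) in L1 *; rewrite /word_perm big_nil in L1.
move=> _ _ /(table_setP _ gL)[w [Lw ow ->]] /(table_setP _ gL)[w' [Lw' ow' ->]].
rewrite inE -word_perm_cat word_permE ?word_ok_cat ?ow //.
exact: (allP (LM w Lw)).
Qed.

Lemma table_set_card n L : group_words n L -> #|table_set L| = n.
Proof.
move=> gL; have /and5P[/allP ok UL /eqP <- _ _] := gL.
have <- : size (map word_perm L) = size L by rewrite size_map.
have UP : uniq (map word_perm L).
  rewrite -(map_inj_uniq perm_table_inj) -map_comp.
  have -> // : map (perm_table \o word_perm) L = tables L.
  by apply/eq_in_map => w Lw /=; have /andP[ow _] := ok w Lw; rewrite word_permE.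
rewrite -(card_uniqP UP); apply: eq_card => x; apply/(table_setP _ gL)/mapP=> [[w [Lw ow ->]]|[w Lw ->]].
  by exists w.
by have /andP[ow _] := ok w Lw; exists w.
Qed.

Lemma table_set_even n L : group_words n L -> table_set L \subset 'Alt_('I_6).
Proof.
move=> gL; have /and5P[/allP ok _ _ _ _] := gL.
apply/subsetP=> _ /(table_setP _ gL)[w [Lw ow ->]].
by rewrite Alt_even odd_word_perm //; have /andP[] := ok w Lw.
Qed.

Lemma normal_wordsP n L z : group_words n L -> word_ok z ->
  reflect (forall x, x \in table_set L -> word_perm z * x * word_perm z \in table_set L)
    (normal_words z L).
Proof.
move=> gL oz; have /and5P[/allP ok _ _ _ _] := gL.
have E w : w \in L -> (word_table (z ++ w ++ z) \in tables L) =
    (word_perm z * word_perm w * word_perm z \in table_set L).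
  move=> Lw; have /andP[ow _] := ok w Lw.
  by rewrite inE -!word_perm_cat -catA word_permE // !word_ok_cat oz ow.
apply: (iffP allP) => [h _ /(table_setP _ gL)[w [Lw ow ->]]|h w Lw].
  by rewrite -E // h.
by rewrite E // h //; apply/(table_setP _ gL); exists w; have /andP[] := ok w Lw.
Qed.

Lemma involution_word z : z \in 'Alt_('I_6) -> z * z = 1 -> z != 1 ->
  exists2 w, w \in involution_words & word_ok w /\ z = word_perm w.
Proof.
move=> Az zz z1; have [a [b [c [d [U ->]]]]] := even_involution (card_ord 6) Az zz z1.
exists [:: (val a, val b); (val c, val d)].
  rewrite mem_filter; apply/andP; split.
    rewrite -[X in uniq X]/(map val [:: a; c; b; d]) (map_inj_uniq val_inj).
    move: U; rewrite /= !inE !negb_or => /and4P[/and3P[-> -> ->] /andP[bc ->] cd _].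
    by rewrite [c == b]eq_sym bc cd.
  by apply/allpairsP; exists ((val a, val b), (val c, val d)); split=> //;
    apply/allpairsP; [exists (val a, val b) | exists (val c, val d)]; rewrite !mem_iota !ltn_ord.
move: U; rewrite /= !inE !negb_or => /and4P[/and3P[ab _ _] _ cd _].
rewrite /word_ok /= !ltn_ord !val_eqE ab cd; split=> //.
by rewrite /word_perm big_cons big_seq1 !inord_val.
Qed.

(** A map phi stabilising all the R i preserves the even involutions that normalise two of them;
    where there is only one, phi fixes it. The involutions fixed in this way generate the 3-cycles
    (0, 1, k + 2), hence the whole alternating group. *)
Lemma config_rigid p n c : config_check p n c -> n = (360`_p)%N ->
  exists2 R : 'I_4 -> {group {perm 'I_6}}, forall i, p.-Sylow('Alt_('I_6)) (R i) &
    forall phi : {perm 'I_6} -> {perm 'I_6},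
      (forall q, q \in 'Alt_('I_6) -> phi q \in 'Alt_('I_6)) ->
      (forall q r, q \in 'Alt_('I_6) -> r \in 'Alt_('I_6) -> phi (q * r) = phi q * phi r) ->
      {in 'Alt_('I_6) &, injective phi} ->
      (forall i q, q \in R i -> phi q \in R i) ->
    forall q, q \in 'Alt_('I_6) -> phi q = q.
Proof.
case: c => [[ls zs] ws] /and3P[/allP gls /allP gzs /allP gws] en.
pose L i := sylow_words p (nth [::] ls i).
have gL i : i < 4 -> group_words n (L i) by move=> i4; apply: gls; rewrite mem_iota.
pose R (i : 'I_4) := Group (table_set_group (gL i (ltn_ord i))).
exists R => [i|phi phiA phiM phi_inj phiR].
  rewrite pHallE (table_set_even (gL i (ltn_ord i))) /=.
  by rewrite (table_set_card (gL i (ltn_ord i))) card_Alt6 en.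
have phi_norm i z : i < 4 -> word_ok z -> ~~ odd (size z) -> normal_words z (L i) ->
  forall x, x \in table_set (L i) -> phi (word_perm z) * x * phi (word_perm z) \in table_set (L i).
  move=> i4 oz ez /(normal_wordsP (gL i i4) oz) nz x Rx.
  have phiRi y : y \in table_set (L i) -> phi y \in table_set (L i) by apply: (phiR (Ordinal i4)).
  have RA y : y \in table_set (L i) -> y \in 'Alt_('I_6) by apply/subsetP/(table_set_even (gL i i4)).
  have AZ : word_perm z \in 'Alt_('I_6) by rewrite Alt_even odd_word_perm.
  have im : phi @: table_set (L i) = table_set (L i).
    apply/eqP; rewrite eqEcard card_in_imset ?leqnn ?andbT.
      by apply/subsetP=> _ /imsetP[y Ry ->]; apply: phiRi.
    by move=> q r /RA Aq /RA Ar; apply: phi_inj.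
  have /imsetP[y Ry ->] : x \in phi @: table_set (L i) by rewrite im.
  have Ay := RA y Ry.
  by rewrite -!phiM ?groupM //; apply: phiRi; apply: nz.
have phi_z i j z : i < 4 -> j < 4 -> ~~ odd (size z) -> unique_normalizer (L i) (L j) z ->
  phi (word_perm z) = word_perm z.
  move=> i4 j4 ez /and4P[/and3P[oz zz z1] ni nj /allP uz]; set Z := word_perm z.
  have AZ : Z \in 'Alt_('I_6) by rewrite Alt_even odd_word_perm.
  have phiZ : phi Z \in 'Alt_('I_6) := phiA _ AZ.
  have ZZ : Z * Z = 1.
    rewrite -word_perm_cat (word_table_perm _ (isT : word_ok [::]) (eqP zz)) ?word_ok_cat ?oz //.
    by rewrite /word_perm big_nil.
  have Z1 : Z != 1.
    apply: contraNneq z1 => e; rewrite -word_permE // -[word_perm z]/Z e.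
    by rewrite -(word_permE (isT : word_ok [::])) /word_perm big_nil.
  have phiZZ : phi Z * phi Z = 1 by rewrite -phiM // ZZ (alt_endo1 phiM).
  have phiZ1 : phi Z != 1 by apply: contraNneq Z1 => /(alt_endo_eq1 phiM phi_inj AZ)->.
  have [z' iz' [oz' ez']] := involution_word phiZ phiZZ phiZ1.
  have norm' k : k < 4 -> normal_words z (L k) -> normal_words z' (L k).
    by move=> k4 nk; apply/(normal_wordsP (gL k k4) oz') => x Rx; rewrite -ez'; apply: phi_norm.
  have := uz z' iz'; rewrite oz' !norm' // => /eqP e.
  by rewrite ez'; apply: word_table_perm.
pose H := [set q in 'Alt_('I_6) | phi q == q].
have gH : group_set H.
  apply/group_setP; split; first by rewrite inE group1 (alt_endo1 phiM) eqxx.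
  move=> q r /setIdP[Aq /eqP eq] /setIdP[Ar /eqP er].
  by rewrite inE groupM // phiM // eq er eqxx.
have Hz e : e \in zs -> word_perm e.2 \in H /\ word_ok e.2.
  move=> ze; have /and4P[i4 j4 ez uz] := gzs e ze; have /and4P[/and3P[oz _ _] _ _ _] := uz.
  by rewrite inE Alt_even odd_word_perm // ez (phi_z _ _ _ i4 j4 ez uz) eqxx.
have : 'Alt_('I_6) \subset Group gH.
  apply: (@cyc3_gen _ (inord 0) (inord 1)) => [|w w0 w1]; first by rewrite -val_eqE /= !inordK.
  have [k k4 ew] : exists2 k, k < 4 & val w = k.+2.
    move: w0 w1; rewrite -!val_eqE /= !inordK //; have := ltn_ord w.
    by case: (val w) => [|[|k]] //; exists k.
  have := gws k; rewrite mem_iota => /(_ k4) /andP[/allP lw /eqP e].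
  have -> : cyc3 (inord 0) (inord 1) w = word_perm [:: (0, 1); (0, k.+2)]%N.
    by rewrite /word_perm big_cons big_seq1 /= -ew inord_val.
  have zsE i : i \in nth [::] ws k -> nth (0, 0, [::])%N zs i \in zs by move=> wi; rewrite mem_nth ?lw.
  have ok2 : word_ok [:: (0, 1); (0, k.+2)]%N by rewrite /word_ok /= !andbT.
  rewrite -(word_table_perm _ ok2 e); last first.
  - move=> {e}; elim: (nth _ _ _) zsE => //= i l IHl zsE; rewrite word_ok_cat.
    rewrite (Hz _ (zsE i _)).2 ?inE ?eqxx // IHl // => i' li'; apply: zsE.
    by rewrite inE li' orbT.
  move=> {e}; elim: (nth _ _ _) zsE => [|i l IHl] zsE; first by rewrite /word_perm big_nil group1.
  rewrite /= word_perm_cat; apply: (@groupM _ (Group gH)).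
    by apply: (Hz _ (zsE i _)).1; rewrite inE eqxx.
  by apply: IHl => i' li'; apply: zsE; rewrite inE li' orbT.
by move=> sAH q Aq; have := subsetP sAH q Aq; rewrite inE => /andP[_ /eqP].
Qed.

End Words.

Lemma sylow_rigid p : p \in [:: 2; 3; 5] ->
  exists2 R : 'I_4 -> {group {perm 'I_6}}, forall i, p.-Sylow('Alt_('I_6)) (R i) &
    forall phi : {perm 'I_6} -> {perm 'I_6},
      (forall q, q \in 'Alt_('I_6) -> phi q \in 'Alt_('I_6)) ->
      (forall q r, q \in 'Alt_('I_6) -> r \in 'Alt_('I_6) -> phi (q * r) = phi q * phi r) ->
      {in 'Alt_('I_6) &, injective phi} ->
      (forall i q, q \in R i -> phi q \in R i) ->
    forall q, q \in 'Alt_('I_6) -> phi q = q.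
Proof.
rewrite !inE => /or3P[] /eqP->.
- by apply: (config_rigid config2_check); rewrite p_part.
- by apply: (config_rigid config3_check); rewrite p_part.
by apply: (config_rigid config5_check); rewrite p_part.
Qed.

(** G normalises a Sylow subgroup P of N, and four conjugates of P correspond to the R i. An element
    g meeting the four conditions normalises these conjugates, so it acts trivially on N and is
    1. *)
Lemma rigid_exotic (gT : finGroupType) (S N G : {group gT}) (f : {morphism N >-> {perm 'I_6}}) t :
    'injm f -> f @* N = 'Alt_('I_6) -> N <| S -> 'C_S(N) = 1 ->
    G \subset S -> solvable G -> t \in G -> t \notin induced_set S f ->
  rigid N S G.
Proof.
move=> injf imf nsN cN sGS solG Gt nIt.
have fI := injmP injf; have sNS := normal_sub nsN.
have [p [P [p235 sylP] nPG]] := exotic_Sylow injf imf nsN cN (card_ord 6) sGS solG Gt nIt.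
have [R sylR rigR] := sylow_rigid p235.
have sPN := pHall_sub sylP.
have sylfP : p.-Sylow('Alt_('I_6)) (f @* P) by rewrite -imf morphim_pHall.
have xP i : exists2 x, x \in N & R i = f @* (P :^ x) :> {set _}.
  have [q Aq ->] := Sylow_trans sylfP (sylR i).
  by have [x Nx ->] := Alt_normal imf Aq; exists x; rewrite ?morphimJ.
have [x Nx Rx] := fin_all_exists2 xP.
apply: (rigid_base4 (x := x) sNS) => [|//|g Sg Gx].
  by rewrite -(card_injm injf) // imf card_Alt6.
have gfix q : q \in 'Alt_('I_6) -> conj_Alt injf g q = q.
  apply: rigR.
  - exact: (conj_AltA injf imf nsN Sg).
  - exact: (conj_AltM injf imf nsN Sg).
  - exact: (conj_Alt_inj imf nsN Sg).
  move=> i r; rewrite Rx => /morphimP[y Ny Py ->]; rewrite conj_AltE //.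
  have Nyg : y ^ g \in N by rewrite (normal_memJ nsN).
  apply: mem_morphim => //; move: Py; rewrite mem_conjg => Py; rewrite mem_conjg.
  have -> : (y ^ g) ^ (x i)^-1 = (y ^ (x i)^-1) ^ (x i * g * (x i)^-1).
    by rewrite -!conjgM !mulgA mulVg mul1g.
  by rewrite memJ_norm // (subsetP nPG).
suff : g \in 'C_S(N) by rewrite cN => /set1P.
rewrite inE Sg; apply/centP=> y Ny; apply/commute_sym/commgP/conjg_fixP.
apply: fI; rewrite ?(normal_memJ nsN) //.
by rewrite -(conj_AltE injf g Ny) gfix // (normal_Alt imf).
Qed.

Theorem theorem1 (n : nat) (gT : finGroupType) (S G : {group gT})
    (hn : 5 <= n) (hS : almost_simple S) (hsoc : socle S \isog 'Alt_('I_n))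
    (sGS : G \subset S) (solG : solvable G) :
  5 <= Reg G S 5 /\ base_size G S <= 5.
Proof.
apply: rigid_regular => //.
have [_ nsN cN] := almost_simple_socle hS.
pose N := socle_group S.
suff [x [Nx rx]] : rigid N S G.
  exists x; split=> // c i; exact: subsetP (normal_sub nsN) _ (Nx c i).
have /isogP[f injf imf] := (hsoc : N \isog 'Alt_('I_n)).
have T4 : 4 < #|'I_n| by rewrite card_ord.
have [sGI|] := boolP (G \subset induced_set S f).
  exact: (rigid_induced injf imf nsN cN T4 sGI solG).
case/subsetPn=> t Gt nIt; have n6 : n = 6.
  apply: contraNeq nIt => n6; apply: (induced_neq6 injf imf nsN T4 (subsetP sGS t Gt)).
  by rewrite card_ord.
move: n6 f injf imf nIt => -> f injf imf nIt; exact: rigid_exotic nIt.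
Qed.
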